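(* Let $1\le m\le n$ and $p\ge 2$ be integers and let $D_{m,n,p}$ be the double-broom. Then $\mathrm{adern}(D_{m,n,p})=1$ for $D_{m,n,2}$ with $2\notin\{m,n\}$ and $m\ne n-2$, or $D_{m,n,3}$ with $m\ge 4$ and $m\ne n-2$; $\mathrm{adern}(D_{m,n,p})=5$ for $D_{1,2,4}$, $D_{1,2,p}$ with $p\ge 6$, or $D_{m,m+2,3}$ with $m\ge 2$; $\mathrm{adern}(D_{m,n,p})=4$ for $D_{1,2,5}$, $D_{1,3,3}$, or $D_{2,n,p}$ with $p\ge 5$; $\mathrm{adern}(D_{m,n,p})=3$ for $D_{1,1,p}$ with $p\ge 3$, $D_{1,2,p}$ with $p\le 3$, $D_{1,n,p}$ with $n\ge 4$ and $p\ge 4$, $D_{2,n,p}$ with $p\le 4$ except $D_{2,4,3}$, $D_{3,n,p}$ with $p\ge 4$, $D_{m,m,p}$ with $m\ge 4$ and $p\ge 5$, $D_{m,m+1,p}$ with $m\ge 4$ and $p\ge 4$, $D_{m,m+2,p}$ with $m\notin\{2,3\}$ and $p\ne 3$, or $D_{3,5,2}$; and $\mathrm{adern}(D_{m,n,p})=2$ otherwise.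
   Context: All graphs are finite and simple. For integers $m,n\ge 1$, $p\ge 2$, the double-broom $D_{m,n,p}$ is the tree on $m+n+p$ vertices obtained from a path on $p$ vertices by attaching $m$ new leaf neighbours to one end of the path and $n$ new leaf neighbours to the other end. The degree $d(e)$ of an edge $e$ is the number of edges sharing an endpoint with $e$. A decard of $G$ is the pair $(G-e,d(e))$ with $G-e$ taken up to isomorphism; the dedeck of $G$ is the multiset of its decards over all edges $e$. A multiset $\mathcal S$ of decards of $G$ determines $G$ if every graph whose dedeck contains $\mathcal S$ as a sub-multiset is isomorphic to $G$. The adversary degree-associated edge-reconstruction number $\mathrm{adern}(G)$ is the least $k$ such that every sub-multiset of size $k$ of the dedeck of $G$ determines $G$. *)

(* Defs.v *)
From mathcomp Require Import all_boot.
From mathcomp Require Import boolp.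

Set Implicit Arguments.
Unset Strict Implicit.
Unset Printing Implicit Defensive.

Record sgraph := SGraph {
  vertex :> finType;
  adj : rel vertex;
  adj_sym : symmetric adj;
  adj_irrefl : irreflexive adj
}.

Definition graph_iso (G H : sgraph) : Prop :=
  exists2 f : G -> H, bijective f & forall x y, adj (f x) (f y) = adj x y.

Definition edges (G : sgraph) : {set {set G}} :=
  [set e | [exists x : G, exists y : G, adj x y && (e == [set x; y])]].

Definition edge_degree (G : sgraph) (e : {set G}) : nat :=
  #|[set f in edges G | (f != e) && (f :&: e != set0)]|.

Definition del_adj (G : sgraph) (e : {set G}) : rel G :=
  fun x y => adj x y && ([set x; y] != e).

Lemma del_adj_sym (G : sgraph) (e : {set G}) : symmetric (del_adj e).
Proof. by move=> x y; rewrite /del_adj adj_sym setUC. Qed.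

Lemma del_adj_irrefl (G : sgraph) (e : {set G}) : irreflexive (del_adj e).
Proof. by move=> x; rewrite /del_adj adj_irrefl. Qed.

Definition del_edge (G : sgraph) (e : {set G}) : sgraph :=
  SGraph (@del_adj_sym G e) (@del_adj_irrefl G e).

Definition decard : Type := (sgraph * nat)%type.

Definition same_decard (c c' : decard) : Prop :=
  graph_iso c.1 c'.1 /\ c.2 = c'.2.

(* A finite multiset of decards is represented as a family indexed by a finite
   type; its entries are only ever compared up to [same_decard], so that the
   first component of a decard counts up to isomorphism. *)
Record decards := Decards {
  slot : finType;
  decard_at : slot -> decard
}.

Definition decards_size (S : decards) : nat := #|slot S|.

(* Inclusion with multiplicities: distinct slots of S are matched with distinct
   slots of T carrying the same decard. *)
Definition sub_decards (S T : decards) : Prop :=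
  exists2 f : slot S -> slot T,
    injective f & forall i, same_decard (decard_at i) (decard_at (f i)).

Definition dedeck (G : sgraph) : decards :=
  @Decards {e : {set G} | e \in edges G}
    (fun e => (del_edge (val e), edge_degree (val e))).

Definition determines (S : decards) (G : sgraph) : Prop :=
  forall H : sgraph, sub_decards S (dedeck H) -> graph_iso H G.

Definition all_determine (G : sgraph) (k : nat) : Prop :=
  forall S : decards,
    decards_size S = k -> sub_decards S (dedeck G) -> determines S G.

Lemma all_determine_exists (G : sgraph) : exists k, `[< all_determine G k >].
Proof.
exists (decards_size (dedeck G)).+1; apply/asboolP => S sizeS [f f_inj _].
by have := leq_card f f_inj; rewrite -/(decards_size S) sizeS ltnn.
Qed.

Definition adern (G : sgraph) : nat := ex_minn (all_determine_exists G).

(* The summand 'I_p carries the path 0, 1, ..., p-1; the m leaves in 'I_m hang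
   from vertex 0 and the n leaves in 'I_n from vertex p-1. *)
Definition broom_adj (m n p : nat) : rel ('I_m + 'I_n + 'I_p)%type :=
  fun u v =>
    match u, v with
    | inr i, inr j => (i.+1 == j :> nat) || (j.+1 == i :> nat)
    | inl (inl _), inr i | inr i, inl (inl _) => i == 0 :> nat
    | inl (inr _), inr i | inr i, inl (inr _) => i.+1 == p :> nat
    | inl _, inl _ => false
    end.

Lemma broom_adj_sym (m n p : nat) : symmetric (@broom_adj m n p).
Proof. by move=> [[a|a]|i] [[b|b]|j] //=; rewrite orbC. Qed.

Lemma broom_adj_irrefl (m n p : nat) : irreflexive (@broom_adj m n p).
Proof. by move=> [[a|a]|i] //=; rewrite orbb -[i.+1]addn1 -[X in _ == X]addn0 eqn_add2l. Qed.

Definition double_broom (m n p : nat) : sgraph :=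
  SGraph (@broom_adj_sym m n p) (@broom_adj_irrefl m n p).

(* The parameter families below are read under 1 <= m <= n and 2 <= p. *)
Definition family1 (m n p : nat) : Prop :=
  [\/ [/\ p = 2, m <> 2, n <> 2 & n <> m + 2]
    | [/\ p = 3, 4 <= m & n <> m + 2]].

Definition family5 (m n p : nat) : Prop :=
  [\/ [/\ m = 1, n = 2 & p = 4],
      [/\ m = 1, n = 2 & 6 <= p]
    | [/\ n = m + 2, p = 3 & 2 <= m]].

Definition family4 (m n p : nat) : Prop :=
  [\/ [/\ m = 1, n = 2 & p = 5],
      [/\ m = 1, n = 3 & p = 3]
    | m = 2 /\ 5 <= p].

Definition family3 (m n p : nat) : Prop :=
  (m = 1 /\ n = 1 /\ 3 <= p) \/
  (m = 1 /\ n = 2 /\ p <= 3) \/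
  (m = 1 /\ 4 <= n /\ 4 <= p) \/
  (m = 2 /\ p <= 4 /\ ~ (n = 4 /\ p = 3)) \/
  (m = 3 /\ 4 <= p) \/
  (n = m /\ 4 <= m /\ 5 <= p) \/
  (n = m + 1 /\ 4 <= m /\ 4 <= p) \/
  (n = m + 2 /\ m <> 2 /\ m <> 3 /\ p <> 3) \/
  (m = 3 /\ n = 5 /\ p = 2).

(* Main.v *)
(** Call edges [e] of [G] and [f] of [H] mates when they yield the same decard; then [adern G - 1] is
    the largest number of disjoint pairs of mates between [G] and a graph [H] not isomorphic to [G].

    Upper bounds: [H - f] is either a smaller broom plus an isolated vertex or two disjoint brooms, and
    in it a vertex of large degree has at most one non-leaf neighbour. A connected [H] of the right
    degrees in which this still holds for the large vertices is the double-broom itself, so otherwise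
    some large vertex has two non-leaf neighbours and every such [f] must repair this, which leaves few
    choices for [f]. If [H] is disconnected, the sizes of its sides fix the position of the deleted path
    edge; if it has an isolated vertex, then [f] is located by the degrees of its ends.

    Lower bounds: take [H = G - ab + cd] where the deletion of [ab] and of [cd] gives the same edge
    degree. Then the degrees of [G] and [H] have equal sums of squares, so any further isomorphism
    [G - e = H - f] automatically preserves edge degrees. *)

(* Nothing about the unknown graph [H] can be computed. The records [leafdel] and [pathdel]
   therefore list isomorphism-invariant facts about an edge-deleted broom, and these are transported
   to [del_edge f]. Since [del_edge f] keeps the vertices of [H], degrees in [H] and in [H - f] are
   compared vertex by vertex, and the second component of a decard becomes the sum of the degrees in
   [H - f] of the two ends of [f]. This sum is what locates [f]. Most upper bounds end with a
   pigeonhole: mates are sorted into a few classes, each holding at most one pair because it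
   determines either [f] or [e]. The exceptional families come from coincidences: for [n = m + 1] or
   [n = m + 2] an edge at the other large vertex has the right degree sum; for small [m] or [n] a
   new vertex of degree 3 competes with an end of the broom; for small [p] a component of [H - f] is
   a star, or two candidate edges coincide. *)
Require Import Defs.
From mathcomp Require Import all_boot.
From mathcomp Require Import zify.
From mathcomp Require boolp.

Set Implicit Arguments.
Unset Strict Implicit.
Unset Printing Implicit Defensive.

(* [lia] without the graph-theoretic hypotheses, whose preprocessing dominates the running time. *)
Ltac arith P :=
  lazymatch P with
  | nat => idtac
  | @eq ?T _ _ => unify T nat
  | is_true (leq _ _) => idtac
  | is_true (leq _ _ && _) => idtac
  | is_true (leq _ _ || _) => idtac
  | is_true (@eq_op ?T _ _) => unify (Equality.sort T) nat
  | is_true (negb (@eq_op ?T _ _)) => unify (Equality.sort T) nat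
  | is_true (negb ?b) => arith (is_true b)
  | not ?Q => arith Q
  | ?Q \/ ?R => arith Q; arith R
  | ?Q /\ ?R => arith Q; arith R
  | False => idtac
  | is_true false => idtac
  | _ => fail
  end.
Ltac nlia :=
  intros; match goal with |- ?G => tryif arith G then idtac else exfalso end;
  repeat match goal with H : ?P |- _ => tryif arith P then fail else clear H end;
  lia.

(** * Degrees, isomorphisms and common decards *)

Definition dg (G : sgraph) (x : G) : nat := #|[set y | adj x y]|.

Lemma set2_inj (T : finType) (a b c d : T) :
  [set a; b] = [set c; d] -> (a = c /\ b = d) \/ (a = d /\ b = c).
Proof.
move=> E.
have ha : a \in [set c; d] by rewrite -E set21.
have hb : b \in [set c; d] by rewrite -E set22.
have hc : c \in [set a; b] by rewrite E set21.
have hd : d \in [set a; b] by rewrite E set22.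
by case/set2P: ha => ?; case/set2P: hb => ?; subst; auto;
  [move/set2P: hd => [|] -> | move/set2P: hc => [|] ->]; auto.
Qed.

Lemma edgesP (G : sgraph) (e : {set G}) :
  reflect (exists x y, adj x y /\ e = [set x; y]) (e \in edges G).
Proof.
rewrite inE; apply: (iffP existsP) => [[x /existsP[y /andP[h /eqP ->]]]|].
  by exists x, y.
by move=> [x [y [h ->]]]; exists x; apply/existsP; exists y; rewrite h /=.
Qed.

Lemma adj_neq (G : sgraph) (x y : G) : adj x y -> x != y.
Proof. by move=> h; apply/eqP => E; move: h; rewrite E adj_irrefl. Qed.

Lemma adj_del (G : sgraph) (e : {set G}) (x y : G) :
  @adj (del_edge e) x y = adj x y && ([set x; y] != e).
Proof. by []. Qed.

Lemma del_sub (G : sgraph) (e : {set G}) (x y : G) :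
  @adj (del_edge e) x y -> adj x y.
Proof. by case/andP. Qed.

Lemma dg_del (G : sgraph) (a b z : G) : adj a b ->
  @dg (del_edge [set a; b]) z + (z \in [set a; b]) = dg z.
Proof.
move=> h; have nab := adj_neq h.
have H (c d : G) : adj c d -> @dg (del_edge [set c; d]) c + 1 = dg c.
  move=> hcd; rewrite /dg (cardsD1 d [set y | adj c y]) inE hcd addnC; congr (_ + _).
  apply: eq_card => y; rewrite !inE /= /del_adj andbC; congr (~~ _ && _).
  apply/eqP/eqP => [/set2_inj[[]|[E1 E2]]|->] //.
  by move: hcd; rewrite -E1 adj_irrefl.
case: (boolP (z \in _)) => [/set2P[]->|nz]; first exact: H.
  by rewrite [X in del_edge X]setUC; apply: H; rewrite adj_sym.
rewrite addn0; apply: eq_card => y; rewrite !inE /= /del_adj.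
case: (adj z y) => //=; apply/eqP => E; move: nz; rewrite -E set21.
by [].
Qed.

(** The edges meeting [ab], other than [ab], split without overlap into those at [a] and those at
    [b]. In this form the edge degree is read in [G - ab], the graph known up to isomorphism. *)
Lemma edge_degreeE (G : sgraph) (a b : G) : adj a b ->
  edge_degree [set a; b] = @dg (del_edge [set a; b]) a + @dg (del_edge [set a; b]) b.
Proof.
move=> h; have nab := adj_neq h.
set F := del_edge [set a; b].
have inj (c : G) : {in [set y | @adj F c y] &, injective (fun y : G => [set c; y])}.
  move=> y z; rewrite !inE => /del_sub hy /del_sub hz /set2_inj[[]//|[E1 E2]].
  by move: hz; rewrite E1 adj_irrefl.
rewrite /edge_degree /dg -(card_in_imset (inj a)) -(card_in_imset (inj b)) -cardsUI.
set A := imset _ _; set B := imset _ _.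
have -> : A :&: B = set0.
  apply/setP => f; rewrite !inE; apply/negP => /andP[/imsetP[y hy Ey] /imsetP[z hz Ez]].
  rewrite !inE in hy hz; move: Ez; rewrite Ey => /set2_inj[[E _]|[E1 E2]].
    by rewrite E eqxx in nab.
  by move: hy; rewrite E2 adj_del eqxx andbF.
rewrite cards0 addn0; apply: eq_card => f; rewrite !inE.
apply/idP/idP.
  move=> /andP[/existsP[x /existsP[y /andP[hxy /eqP ->]]] /andP[nf /set0Pn[z]]].
  rewrite !inE => /andP[zf zab]; apply/orP.
  have [w hw Ew] : exists2 w, adj z w & [set x; y] = [set z; w].
    by case/orP: zf => /eqP ->; [exists y | exists x; rewrite 1?setUC // adj_sym].
  rewrite Ew in nf *.
  case/orP: zab => /eqP E; subst z; [left|right]; apply/imsetP; exists w => //;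
  by rewrite inE adj_del hw.
case/orP=> /imsetP[y]; rewrite inE adj_del => /andP[hy ny ->]; rewrite ny /=.
  apply/andP; split; first by apply/existsP; exists a; apply/existsP; exists y; rewrite hy /=.
  by apply/set0Pn; exists a; rewrite !inE eqxx.
apply/andP; split; first by apply/existsP; exists b; apply/existsP; exists y; rewrite hy /=.
by apply/set0Pn; exists b; rewrite !inE eqxx orbT.
Qed.

Lemma iso_refl (G : sgraph) : graph_iso G G.
Proof. by exists id => //; exists id. Qed.

Lemma iso_sym (G H : sgraph) : graph_iso G H -> graph_iso H G.
Proof.
move=> [f [g fK gK] hf]; exists g; first by exists f.
by move=> x y; rewrite -[in RHS](gK x) -[in RHS](gK y) hf.
Qed.

Lemma iso_trans (G H K : sgraph) : graph_iso G H -> graph_iso H K -> graph_iso G K.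
Proof.
move=> [f bf hf] [g bigs hg]; exists (g \o f); first exact: bij_comp.
by move=> x y /=; rewrite hg hf.
Qed.

Lemma dg_iso (G H : sgraph) (f : G -> H) : bijective f ->
  (forall x y, adj (f x) (f y) = adj x y) -> forall x, dg (f x) = dg x.
Proof.
move=> bf hf x; rewrite /dg -(card_imset [set y | adj x y] (bij_inj bf)).
apply: eq_card => z; rewrite inE; have [g fK gK] := bf.
rewrite -(gK z) hf; apply/idP/imsetP => [h|[y]]; first by exists (g z); rewrite ?inE.
by rewrite inE => h /(bij_inj bf) ->.
Qed.

Lemma iso_card (G H : sgraph) : graph_iso G H -> #|G| = #|H|.
Proof. by move=> [f bf _]; exact: bij_eq_card bf. Qed.

Lemma iso_sum (G H : sgraph) (phi : nat -> nat) : graph_iso G H ->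
  \sum_(x : G) phi (dg x) = \sum_(x : H) phi (dg x).
Proof.
move=> [f bf hf]; rewrite [RHS](reindex f); last exact: onW_bij.
by apply: eq_bigr => x _; rewrite (dg_iso bf hf).
Qed.

(** Only the terms of the two ends change; the identity is arranged to avoid truncated subtraction.
    It is used with [phi] the identity and the square. *)
Lemma sum_del (G : sgraph) (a b : G) (phi : nat -> nat) : adj a b ->
  let F := del_edge [set a; b] in
  \sum_(x : G) phi (dg x) + phi (@dg F a) + phi (@dg F b) =
  \sum_(x : F) phi (dg x) + phi (@dg F a).+1 + phi (@dg F b).+1.
Proof.
move=> h F; have nab := adj_neq h.
have ba : b != a by rewrite eq_sym.
have -> : \sum_(x : F) phi (dg x) = \sum_(x : G) phi (@dg F x) by [].
rewrite !(bigD1 (P := predT) a) //= !(bigD1 (P := fun i => i != a) b) //=.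
rewrite -!(dg_del _ h) -/F set21 set22 !addn1.
rewrite (eq_bigr (fun x : G => phi (@dg F x))); last first.
  by move=> x /andP[xa xb]; rewrite -(dg_del _ h) !inE (negPf xa) (negPf xb) addn0.
move: (\sum_(i | _) _) (phi _) (phi _) (phi _) (phi _) => *; lia.
Qed.

(** An injective homomorphism never lowers degrees, so the bound on the degree sum forces equality
    at every vertex, and each neighbourhood is mapped onto a neighbourhood. Non-edges need no
    check. *)
Lemma iso_of_hom (G H : sgraph) (f : G -> H) : injective f -> #|H| <= #|G| ->
  (forall x y, adj x y -> adj (f x) (f y)) ->
  \sum_(x : H) dg x <= \sum_(x : G) dg x -> graph_iso G H.
Proof.
move=> fi cGH hom sum.
have bf := inj_card_bij fi cGH.
have le x : dg x <= dg (f x).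
  rewrite /dg -(card_imset _ fi); apply: subset_leq_card; apply/subsetP => y.
  by move=> /imsetP[z]; rewrite inE => hz ->; rewrite inE; apply: hom.
have eq x : dg x = dg (f x).
  apply/eqP; rewrite eqn_leq le /= leqNgt; apply/negP => lt.
  move: sum; rewrite (reindex f) /=; last exact: onW_bij.
  rewrite (bigD1 x) //= [X in _ <= X](bigD1 x) //=.
  have : \sum_(i | i != x) dg i <= \sum_(i | i != x) dg (f i) by apply: leq_sum.
  by lia.
exists f => // x y; apply/idP/idP; last exact: hom.
move=> h.
have: f @: [set y | adj x y] = [set y | adj (f x) y].
  apply/eqP; rewrite eqEcard; apply/andP; split.
    apply/subsetP => z /imsetP[w]; rewrite !inE => hw ->; exact: hom.
  by rewrite (card_imset _ fi) -/(dg x) -/(dg (f x)) eq.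
move=> /setP/(_ (f y)); rewrite inE h => /imsetP[z]; rewrite inE => hz /fi ->.
by [].
Qed.

Definition mate (G H : sgraph) (e : {set G}) (f : {set H}) : Prop :=
  [/\ e \in edges G, f \in edges H, graph_iso (del_edge e) (del_edge f) &
      edge_degree e = edge_degree f].

(** Injectivity of both families makes the pairs disjoint: this is a common sub-multiset of size [k]
    of the two dedecks. *)
Definition common (k : nat) (G H : sgraph) : Prop :=
  exists (e : 'I_k -> {set G}) (f : 'I_k -> {set H}),
    [/\ injective e, injective f & forall i, mate (e i) (f i)].

Lemma mate_iso (G G' H : sgraph) (g : G -> G') (bigs : bijective g)
  (hg : forall x y, adj (g x) (g y) = adj x y) (e : {set G}) (f : {set H}) :
  mate e f -> mate (g @: e) f.
Proof.
move=> [/edgesP[x [y [h ->]]] hf iso deg].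
have E : g @: [set x; y] = [set g x; g y] by rewrite imsetU1 imset_set1.
have h' : adj (g x) (g y) by rewrite hg.
have hgd (u v : del_edge [set x; y]) : @adj (del_edge [set g x; g y]) (g u) (g v) = adj u v.
  rewrite !adj_del hg; congr (_ && _); rewrite -E -(inj_eq (imset_inj (bij_inj bigs))).
  by rewrite !imsetU1 !imset_set1.
have iso' : graph_iso (del_edge [set x; y]) (del_edge [set g x; g y]) by exists g.
split => //; rewrite E.
- by apply/edgesP; exists (g x), (g y).
- exact: iso_trans (iso_sym iso') iso.
- rewrite -deg !edge_degreeE //; congr (_ + _).
    exact: (@dg_iso (del_edge _) (del_edge _) g bigs hgd x).
  exact: (@dg_iso (del_edge _) (del_edge _) g bigs hgd y).
Qed.

Lemma common_iso (k : nat) (G G' H : sgraph) :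
  graph_iso G G' -> common k G H -> common k G' H.
Proof.
move=> [g bigs hg] [e [f [ei fi h]]].
exists (fun i => g @: e i), f; split => //.
  by move=> i j /(imset_inj (bij_inj bigs)) /ei.
by move=> i; apply: mate_iso.
Qed.

Lemma commonW (j k : nat) (G H : sgraph) : j <= k -> common k G H -> common j G H.
Proof.
move=> le [e [f [ei fi h]]].
exists (fun i => e (widen_ord le i)), (fun i => f (widen_ord le i)); split=> //.
- by move=> a b /ei [] /val_inj.
- by move=> a b /fi [] /val_inj.
Qed.

Lemma all_determineP (G : sgraph) (k : nat) :
  all_determine G k <-> forall H, common k G H -> graph_iso H G.
Proof.
split.
  move=> det H [e [f [ei fi h]]].
  pose S := @Decards 'I_k (fun i => (del_edge (e i), edge_degree (e i))).
  have he i : e i \in edges G by case: (h i).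
  have hf i : f i \in edges H by case: (h i).
  apply: (det S); first by rewrite /decards_size card_ord.
    exists (fun i => exist _ (e i) (he i)); first by move=> i j [] /ei.
    by move=> i; split => //=; exact: iso_refl.
  exists (fun i => exist _ (f i) (hf i)); first by move=> i j [] /fi.
  by move=> i; case: (h i) => *; split.
move=> det S sz [e ei he] H [f fi hf]; apply: det.
pose o (i : 'I_k) : slot S := enum_val (cast_ord (esym sz) i).
have oi : injective o by move=> a b /enum_val_inj /cast_ord_inj.
exists (fun i => val (e (o i))), (fun i => val (f (o i))); split.
- by move=> a b /val_inj /ei /oi.
- by move=> a b /val_inj /fi /oi.
move=> i; have [i1 d1] := he (o i); have [i2 d2] := hf (o i).
split; try exact: valP.
  exact: iso_trans (iso_sym i1) i2.
by rewrite -[LHS]d1 d2.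
Qed.

Lemma adern_eq (G B H : sgraph) (k : nat) : graph_iso G B ->
  common k B H -> ~ graph_iso H B ->
  (forall H', common k.+1 B H' -> graph_iso H' B) -> adern G = k.+1.
Proof.
move=> iGB cH nH up; rewrite /adern; case: ex_minnP => d /boolp.asboolP det mn.
apply/eqP; rewrite eqn_leq; apply/andP; split.
  apply: mn; apply/boolp.asboolP/all_determineP => K c.
  by apply: iso_trans (iso_sym iGB); apply: up; apply: common_iso c.
rewrite ltnNge; apply/negP => le; apply: nH.
apply: (iso_trans _ iGB); move/all_determineP: det; apply.
by apply: common_iso (iso_sym iGB) _; apply: commonW cH.
Qed.

(** * Brooms coded by natural numbers *)

(** Replaces a cardinal by the length of an explicit list of values, so that computing a degree
    reduces to a membership test left to [lia]. *)
Lemma card_nat N (P : pred nat) (s : seq nat) : uniq s ->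
  (forall y, (y \in s) = (y < N) && P y) -> #|[set z : 'I_N | P z]| = size s.
Proof.
move=> us h; rewrite cardE -(size_map (@nat_of_ord N)).
apply: perm_size; apply: uniq_perm => //.
  by rewrite map_inj_uniq; [exact: enum_uniq | exact: val_inj].
move=> y; rewrite h; apply/mapP/idP.
  by move=> [z]; rewrite mem_enum inE => hz ->; rewrite ltn_ord.
by move=> /andP[hy hxy]; exists (Ordinal hy); rewrite // mem_enum inE.
Qed.

Section NatGraph.
Variables (N : nat) (R : rel nat).

(** Symmetrising [R] and removing loops makes any relation acceptable, so each edge need be listed
    in one direction only. *)
Definition nat_graph_adj : rel 'I_N := fun x y => (x != y :> nat) && (R x y || R y x).

Lemma nat_graph_sym : symmetric nat_graph_adj.
Proof. by move=> x y; rewrite /nat_graph_adj eq_sym orbC. Qed.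

Lemma nat_graph_irrefl : irreflexive nat_graph_adj.
Proof. by move=> x; rewrite /nat_graph_adj eqxx. Qed.

Definition nat_graph : sgraph := SGraph nat_graph_sym nat_graph_irrefl.

Lemma adj_nat_graph (x y : nat_graph) : adj x y = (x != y :> nat) && (R x y || R y x).
Proof. by []. Qed.

Lemma dg_nat_graph (x : nat_graph) (s : seq nat) : uniq s ->
  (forall y, (y \in s) = [&& y < N, x != y :> nat & R x y || R y x]) -> dg x = size s.
Proof. exact: (@card_nat N (fun y => (x != y :> nat) && (R x y || R y x))). Qed.

Lemma nat_graph_del (a b x y : nat_graph) : @adj (del_edge [set a; b]) x y =
  [&& x != y :> nat, R x y || R y x &
      ~~ ((x == a :> nat) && (y == b :> nat) || (x == b :> nat) && (y == a :> nat))].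
Proof.
rewrite adj_del adj_nat_graph -andbA; congr [&& _, _ & ~~ _].
apply/eqP/idP => [/set2_inj[[-> ->]|[-> ->]]|]; rewrite ?eqxx ?orbT //.
by move=> /orP[/andP[/eqP/val_inj -> /eqP/val_inj ->]|/andP[/eqP/val_inj -> /eqP/val_inj ->]];
  rewrite // setUC.
Qed.

End NatGraph.

(** Edges are listed from the smaller to the larger number. Right leaves have no upper bound here;
    the vertex type of [B] provides it. *)
Definition broom_rel (m p : nat) : rel nat := fun x y =>
  [|| (x.+1 == y) && (y < p), (x == 0) && (p <= y < p + m) | (x.+1 == p) && (p + m <= y)].

(* Path [0, ..., p-1]; left leaves [p, ..., p+m-1]; right leaves [p+m, ..., p+m+n-1]. *)
Definition B (m n p : nat) : sgraph := nat_graph (p + m + n) (broom_rel m p).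

Definition broom_code (m n p : nat) (x : 'I_m + 'I_n + 'I_p) : nat :=
  match x with
  | inl (inl a) => p + a
  | inl (inr b) => p + m + b
  | inr i => i
  end.

Lemma broom_code_lt m n p (x : 'I_m + 'I_n + 'I_p) : broom_code x < p + m + n.
Proof. by case: x => [[a|b]|i] /=; have := ltn_ord; [move/(_ _ a)|move/(_ _ b)|move/(_ _ i)]; lia. Qed.

Lemma double_broom_B m n p : 0 < p -> graph_iso (double_broom m n p) (B m n p).
Proof.
move=> p0; pose f (x : double_broom m n p) : B m n p := Ordinal (broom_code_lt x).
exists f.
  apply: inj_card_bij.
    move=> x y [] E; case: x y E => [[a|b]|i] [[a'|b']|i'] /= E;
    try (have := ltn_ord a); try (have := ltn_ord b); try (have := ltn_ord i);
    try (have := ltn_ord a'); try (have := ltn_ord b'); try (have := ltn_ord i');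
    move=> *; try lia; try (do ?congr inl; do ?congr inr; apply: val_inj => /=; lia).
  by rewrite card_ord !card_sum !card_ord; lia.
move=> x y; rewrite adj_nat_graph /f /=.
case: x y => [[a|b]|i] [[a'|b']|i'] /=;
    try (have := ltn_ord a); try (have := ltn_ord b); try (have := ltn_ord i);
    try (have := ltn_ord a'); try (have := ltn_ord b'); try (have := ltn_ord i');
  rewrite /broom_rel => *; lia.
Qed.

(** Reverses the path and exchanges the two blocks of leaves, so that facts about left leaf edges
    also serve for right ones. *)
Definition mirror (m n p x : nat) : nat :=
  if x < p then p.-1 - x else if x < p + m then x + n else x - m.

Lemma mirror_lt m n p (x : 'I_(p + m + n)) : mirror m n p x < p + n + m.
Proof. by have := ltn_ord x; rewrite /mirror; do 2?case: ifP; lia. Qed.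

Lemma mirrorK m n p x : x < p + m + n -> mirror n m p (mirror m n p x) = x.
Proof.
rewrite /mirror => xN; case: (ltnP x p) => xp.
  by case: ifP; lia.
by case: (ltnP x (p + m)) => xm; do 2?case: ifP; lia.
Qed.

Lemma mirror_ed m n p x y : 0 < p -> x < p + m + n -> y < p + m + n -> broom_rel m p x y ->
  broom_rel n p (mirror m n p x) (mirror m n p y) || broom_rel n p (mirror m n p y) (mirror m n p x).
Proof.
move=> p0 xN yN; rewrite {1}/broom_rel => /or3P[] /andP[h1 h2]; rewrite /mirror.
- have [-> ->] : x < p /\ y < p by lia.
  by rewrite /broom_rel; lia.
- have [-> [-> ->]] : x < p /\ (y < p) = false /\ y < p + m by lia.
  by rewrite /broom_rel; lia.
- have [-> [-> ->]] : x < p /\ (y < p) = false /\ (y < p + m) = false by lia.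
  by rewrite /broom_rel; lia.
Qed.

Lemma B_mirror_map m n p : 0 < p -> exists g : B m n p -> B n m p,
  [/\ bijective g, forall x y, adj (g x) (g y) = adj x y &
      forall x, g x = mirror m n p x :> nat].
Proof.
move=> p0; pose f (x : B m n p) : B n m p := Ordinal (mirror_lt x).
pose g (x : B n m p) : B m n p := Ordinal (mirror_lt x).
have fK : cancel f g by move=> x; apply: val_inj; rewrite /= mirrorK.
have gK : cancel g f by move=> x; apply: val_inj; rewrite /= mirrorK.
have hom (m' n' : nat) (x y : B m' n' p) : adj x y ->
    broom_rel n' p (mirror m' n' p x) (mirror m' n' p y) || broom_rel n' p (mirror m' n' p y) (mirror m' n' p x).
  case/andP=> _ /orP[] h; last rewrite orbC; exact: mirror_ed.
exists f; split=> //; first by exists g.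
move=> x y; apply/idP/idP => [|h]; last first.
  rewrite adj_nat_graph hom // andbT; have := adj_neq h.
  by rewrite -(inj_eq (can_inj fK)) -val_eqE.
move=> h; rewrite -(fK x) -(fK y) adj_nat_graph hom // andbT.
by rewrite val_eqE (inj_eq (can_inj gK)); exact: adj_neq h.
Qed.

Lemma B_mirror m n p : 0 < p -> graph_iso (B m n p) (B n m p).
Proof. by case/(B_mirror_map m n) => g [bigs hg _]; exists g. Qed.

Lemma dg_B m n p (x : B m n p) : 2 <= p ->
  dg x = if x < p then (if x == 0 :> nat then m.+1 else if x.+1 == p then n.+1 else 2) else 1.
Proof.
move=> p2; have := ltn_ord x.
case: ifP => xp; [case: ifP => x0; [|case: ifP => x1]|] => xN.
- rewrite (@dg_nat_graph _ _ x (1 :: iota p m)).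
  + by rewrite /= size_iota.
  + by rewrite /= iota_uniq mem_iota andbT; lia.
  + by move=> y; rewrite !inE mem_iota /broom_rel; lia.
- rewrite (@dg_nat_graph _ _ x (p.-2 :: iota (p + m) n)).
  + by rewrite /= size_iota.
  + by rewrite /= iota_uniq mem_iota andbT; lia.
  + by move=> y; rewrite !inE mem_iota /broom_rel; lia.
- rewrite (@dg_nat_graph _ _ x [:: x.-1; x.+1]) //.
  + by rewrite /= !inE andbT; lia.
  + by move=> y; rewrite !inE /broom_rel; lia.
- rewrite (@dg_nat_graph _ _ x [:: if x < p + m then 0 else p.-1]) //.
  by move=> y; rewrite !inE /broom_rel; case: ifP; lia.
Qed.

Lemma B_del m n p (a b x y : B m n p) : @adj (del_edge [set a; b]) x y =
  [&& x != y :> nat, broom_rel m p x y || broom_rel m p y x &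
      ~~ ((x == a :> nat) && (y == b :> nat) || (x == b :> nat) && (y == a :> nat))].
Proof. exact: nat_graph_del. Qed.

(** Adjacency in [B] as nested tests on positions: once these are decided, only linear conditions
    remain. *)
Definition broom_nbr (m p x y : nat) : bool :=
  if x < p then
    if y < p then (x.+1 == y) || (y.+1 == x) else if y < p + m then x == 0 else x.+1 == p
  else (y < p) && (if x < p + m then y == 0 else y.+1 == p).

Lemma adj_B m n p (x y : B m n p) : 0 < p -> adj x y = broom_nbr m p x y.
Proof.
move=> p0; rewrite adj_nat_graph /broom_nbr; case: (ltnP x p) => xp.
  case: (ltnP y p) => yp; first by rewrite /broom_rel; lia.
  by case: (ltnP y (p + m)) => ym; rewrite /broom_rel; lia.
case: (ltnP y p) => yp; last by rewrite /broom_rel; lia.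
by case: (ltnP x (p + m)) => ym; rewrite /broom_rel; lia.
Qed.

Lemma adj_B_del m n p (a b x y : B m n p) : 0 < p -> @adj (del_edge [set a; b]) x y =
  broom_nbr m p x y && ~~ ((x == a :> nat) && (y == b :> nat) || (x == b :> nat) && (y == a :> nat)).
Proof. by move=> p0; rewrite B_del andbA -(adj_B _ _ p0). Qed.

(** * Edge-deleted brooms *)

(** Unions of components. Connectivity, separation and component sizes are all expressed through
    them, mostly without any reasoning on paths. *)
Definition adj_closed (G : sgraph) (Z : {set G}) : Prop :=
  forall a b, adj a b -> a \in Z -> b \in Z.

(** In a broom both ends of the path have this property; its failure at a large vertex of [H] is
    what every mate must repair. *)
Definition full (G : sgraph) (z : G) : Prop :=
  forall a b, adj z a -> adj z b -> dg a <> 1 -> dg b <> 1 -> a = b.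

(* What is used of [D_{m,n,p}] minus an edge at a left leaf: [q] is the isolated leaf, [u] and [w] are
   the left and right ends of the path. The right leaves are covered by exchanging [m] and [n]. *)
Record leafdel m n p (F : sgraph) (q u w : F) : Prop := {
  L_uw : u != w;
  L_qu : q != u;
  L_qw : q != w;
  L_q : forall z, ~~ adj q z;
  L_con : forall Z : {set F}, adj_closed Z ->
    forall a b, a \in Z -> a != q -> b != q -> b \in Z;
  L_du : dg u = m;
  L_dw : dg w = n.+1;
  L_dz : forall z, z != q -> z != u -> z != w -> 1 <= dg z <= 2;
  L_fu : full u;
  L_fw : full w;
  (* For [m = 1] the end [u] is itself a leaf of [F] and may be far from [w]. *)
  L_att : 1 < m -> forall z, dg z = 1 -> adj u z || adj w z;
  L_p2 : p = 2 -> forall z, z != q -> z != u -> z != w -> dg z = 1;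
  L_p3 : p = 3 -> forall z, z != q -> z != u -> z != w -> dg z = 2 -> adj u z && adj w z;
  L_pn3 : p <> 3 -> forall z, ~~ (adj u z && adj w z);
  (* Every edge is a bridge: it is the only edge leaving [S]. *)
  L_br : forall x y, adj x y -> exists S : {set F}, [/\ x \in S, y \notin S &
    forall a b, adj a b -> a \in S -> b \notin S -> a = x /\ b = y] }.

(* What is used of [D_{m,n,p}] minus the [i]-th path edge: [S] is the component of the left end [u],
   and [w] is the right end. *)
Record pathdel m n p i (F : sgraph) (S : {set F}) (u w : F) : Prop := {
  P_S : #|S| = m + i;
  P_cl : adj_closed S;
  P_con : forall Z : {set F}, adj_closed Z -> forall a b, a \in Z ->
    (a \in S) = (b \in S) -> b \in Z;
  P_u : u \in S;
  P_w : w \notin S;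
  P_du : dg u = m + (1 < i);
  P_dw : dg w = n + (i.+1 < p);
  P_dz : forall z, z != u -> z != w -> 1 <= dg z <= 2;
  P_fu : full u;
  P_fw : full w;
  (* For [i <= 2] the left component is a star centred at [u], with [m] leaves if [i = 1] and
     [m + 1] if [i = 2]. *)
  P_su : i <= 2 -> forall z, z \in S -> z != u -> adj u z && (dg z == 1);
  P_sw : p <= i.+2 -> forall z, z \notin S -> z != w -> adj w z && (dg z == 1) }.

Lemma full_iso (X F : sgraph) (h : X -> F) : bijective h ->
  (forall x y, adj (h x) (h y) = adj x y) -> forall z, full z -> full (h z).
Proof.
move=> bh hh z fz a b; have [k hK kK] := bh.
rewrite -(kK a) -(kK b) !hh !(dg_iso bh hh) => *; congr h; exact: fz.
Qed.

Lemma closed_iso (X F : sgraph) (h : X -> F) :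
  (forall x y, adj (h x) (h y) = adj x y) -> forall Z : {set F}, adj_closed Z -> adj_closed (h @^-1: Z).
Proof. by move=> hh Z cZ a b; rewrite -hh !inE; exact: cZ. Qed.

Lemma leafdel_iso m n p (X F : sgraph) (h : X -> F) q u w : bijective h ->
  (forall x y, adj (h x) (h y) = adj x y) -> @leafdel m n p X q u w -> leafdel m n p (h q) (h u) (h w).
Proof.
move=> bh hh [uw qu qw Lq con du dw dz fu fw att p2 p3 pn3 br].
have [k hK kK] := bh; have hi := bij_inj bh; have hd := dg_iso bh hh.
split; rewrite ?(inj_eq hi) ?hd //; try exact: full_iso.
- by move=> z; rewrite -(kK z) hh.
- move=> Z /(closed_iso hh) cZ a b; rewrite -(kK a) -(kK b) !(inj_eq hi).
  by have := con _ cZ (k a) (k b); rewrite !inE.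
- by move=> z; rewrite -(kK z) !(inj_eq hi) hd; apply: dz.
- by move=> m1 z; rewrite -(kK z) hd !hh; apply: att.
- by move=> e z; rewrite -(kK z) !(inj_eq hi) hd; apply: p2.
- by move=> e z; rewrite -(kK z) !(inj_eq hi) hd !hh; apply: p3.
- by move=> e z; rewrite -(kK z) !hh; apply: pn3.
- move=> x y; rewrite -(kK x) -(kK y) hh => /br[S [xS yS bS]].
  exists (h @: S); rewrite !(mem_imset _ _ hi); split => // a b.
  rewrite -(kK a) -(kK b) hh !(mem_imset _ _ hi) => ab aS nbS.
  by have [-> ->] := bS _ _ ab aS nbS.
Qed.

Lemma pathdel_iso m n p i (X F : sgraph) (h : X -> F) S u w : bijective h ->
  (forall x y, adj (h x) (h y) = adj x y) -> @pathdel m n p i X S u w ->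
  pathdel m n p i (h @: S) (h u) (h w).
Proof.
move=> bh hh [cS clS con uS wS du dw dz fu fw su swap_graph].
have [k hK kK] := bh; have hi := bij_inj bh; have hd := dg_iso bh hh.
split; rewrite ?hd ?(mem_imset _ _ hi) //; try exact: full_iso.
- by rewrite card_imset.
- by move=> a b; rewrite -(kK a) -(kK b) hh !(mem_imset _ _ hi); apply: clS.
- move=> Z /(closed_iso hh) cZ a b; rewrite -(kK a) -(kK b) !(mem_imset _ _ hi).
  by have := con _ cZ (k a) (k b); rewrite !inE.
- by move=> z; rewrite -(kK z) !(inj_eq hi) hd; apply: dz.
- by move=> e z; rewrite -(kK z) !(mem_imset _ _ hi) !(inj_eq hi) hd !hh; apply: su.
- by move=> e z; rewrite -(kK z) !(mem_imset _ _ hi) !(inj_eq hi) hd !hh; apply: swap_graph.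
Qed.

(** Vertices are given by their numbers so that this step can be iterated by induction along the
    path. *)
Lemma closed_step m n p (a b : B m n p) (Z : {set del_edge [set a; b]}) : 0 < p -> adj_closed Z ->
  forall i j, i < p + m + n -> j < p + m + n -> broom_nbr m p i j ->
  ~~ ((i == a :> nat) && (j == b :> nat) || (i == b :> nat) && (j == a :> nat)) ->
  (forall x : B m n p, x = i :> nat -> x \in Z) -> forall x : B m n p, x = j :> nat -> x \in Z.
Proof.
move=> p0 cZ i j iN jN nij nab hi x xj.
apply: (cZ (Ordinal iN)); last exact: hi.
by rewrite adj_B_del //= xj nij.
Qed.

Lemma leafdel_B m n p (q u w : B m n p) : 2 <= p -> 0 < n -> u = 0 :> nat -> w = p.-1 :> nat ->
  p <= q < p + m -> @leafdel m n p (del_edge [set u; q]) q u w.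
Proof.
move=> p2 n0 u0 wp qp; have p0 : 0 < p by lia.
have uq : adj u q by rewrite adj_B // /broom_nbr u0 ?p0; do 2?case: ifP; lia.
pose F := del_edge [set u; q].
have dF (z : F) : @dg F z = if z < p then (if z == 0 :> nat then m else
    if z.+1 == p then n.+1 else 2) else (z != q :> nat).
  have := @dg_del (B m n p) u q z uq; rewrite (dg_B _ p2) -/F !inE -!val_eqE /= u0.
  by do 4?case: ifP; lia.
have lf (z : F) : p <= z -> z != q -> @dg F z = 1.
  by move=> h1; rewrite dF -val_eqE /=; case: ifP; lia.
have pth (z : F) : z != q -> @dg F z <> 1 -> z < p.
  by move=> zq h; case: (ltnP z p) => // /lf /(_ zq).
have uE (z : F) : @adj F u z -> z != q.
  by rewrite adj_B_del // -val_eqE /= eqxx /=; case: eqP; rewrite ?andbF.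
have wE (z : F) : @adj F w z -> z != q.
  rewrite adj_B_del // -val_eqE /= wp /broom_nbr; do 3?case: ifP; lia.
split.
- by rewrite -val_eqE /=; lia.
- by rewrite -val_eqE /=; lia.
- by rewrite -val_eqE /=; lia.
- move=> z; rewrite adj_B_del // /broom_nbr u0; case: ifP => [|_]; first by lia.
  by case: ifP; lia.
- move=> Z cZ a b aZ aq bq.
  (* [P] is carried from [a] down to the vertex [0], and from there to [b]. *)
  pose P k := forall x : F, x = k :> nat -> x \in Z.
  have st := @closed_step m n p u q Z p0 cZ; rewrite u0 in st.
  have sp i j : i < p -> j < p -> (i.+1 == j) || (j.+1 == i) -> P i -> P j.
    move=> ip jp h; apply: st; try lia; rewrite /broom_nbr ip jp //.
  have up k i : k < p -> P i -> i <= k -> P k.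
    elim: k => [|k IH] kp Pi ik; first by have -> : 0 = i by lia.
    case: (ltngtP i k.+1) => h; [|lia|by rewrite -h].
    by apply: (sp k); try lia; apply: IH => //; lia.
  have dn k i : k < p -> P k -> i <= k -> P i.
    elim: k i => [|k IH] i kp Pk ik; first by have -> : i = 0 by lia.
    case: (ltngtP i k.+1) => h; [|lia|by rewrite h].
    by apply: IH => //; try lia; apply: (sp k.+1) => //; lia.
  have Pa : P a by move=> x /val_inj ->.
  rewrite -!val_eqE /= in aq bq.
  have P0 : P 0.
    have aN := ltn_ord a.
    case: (ltnP a p) => ap; first by apply: (dn a).
    case: (ltnP a (p + m)) => am.
      by apply: (st a) => //; try lia; rewrite /broom_nbr; do 3?case: ifP; lia.
    apply: (dn p.-1); try lia.
    by apply: (st a) => //; try lia; rewrite /broom_nbr; do 3?case: ifP; lia.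
  suff Pb : P b by apply: Pb.
  have bN := ltn_ord b.
  case: (ltnP b p) => bp; first by apply: (up b 0).
  case: (ltnP b (p + m)) => bm.
    by apply: (st 0) => //; try lia; rewrite /broom_nbr; do 3?case: ifP; lia.
  have Pp : P p.-1 by apply: (up _ 0) => //; lia.
  by apply: (st p.-1) => //; try lia; rewrite /broom_nbr; do 3?case: ifP; lia.
- by rewrite dF u0; case: ifP; lia.
- by rewrite dF wp; do 3?case: ifP; lia.
- move=> z; rewrite -!val_eqE /= dF; do 3?case: ifP; lia.
- move=> a b ha hb /(pth _ (uE _ ha)) ap /(pth _ (uE _ hb)) bp; apply: val_inj.
  by move: ha hb; rewrite !adj_B_del // /broom_nbr ap bp u0 ?p0 /=; lia.
- move=> a b ha hb /(pth _ (wE _ ha)) ap /(pth _ (wE _ hb)) bp; apply: val_inj.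
  by move: ha hb; rewrite !adj_B_del // /broom_nbr ap bp wp (_ : p.-1 < p) /=; lia.
- move=> m1 z; have zN := ltn_ord z; rewrite dF.
  case: (ltnP z p) => zp; first by do 2?case: ifP; lia.
  rewrite !adj_B_del // /broom_nbr u0 wp ?p0 ltnNge zp /= (_ : p.-1 < p); last by lia.
  by case: ifP; lia.
- by move=> e z; rewrite -!val_eqE dF /=; do 3?case: ifP; lia.
- move=> e z; rewrite -!val_eqE => zq zu zw; rewrite /= in zq zu zw; rewrite dF.
  case: (ltnP z p) => zp; last by lia.
  by rewrite !adj_B_del // /broom_nbr u0 wp ?p0 zp (_ : p.-1 < p) /=; lia.
- move=> e z; rewrite !adj_B_del // /broom_nbr u0 wp ?p0 (_ : p.-1 < p); last by lia.
  by case: ifP => ?; [|case: ifP]; lia.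
- move=> x y; rewrite adj_B_del // => /andP[h _].
  have xN := ltn_ord x; have yN := ltn_ord y.
  (* The side [S] may be taken in the whole broom: all but [y] if [y] is a leaf, [x] alone if [x] is
     a leaf, otherwise the part of the path on the side of [x] with its leaves. *)
  suff [S [xS yS hS]] : exists S : pred nat, [/\ S x, ~~ S y & forall a b, broom_nbr m p a b ->
      S a -> ~~ S b -> a = x /\ b = y].
    exists [set z : F | S z]; split; [by rewrite inE | by rewrite inE | move=> a b].
    rewrite adj_B_del // !inE => /andP[ab _] aS bS.
    by have [E1 E2] := hS _ _ ab aS bS; split; apply: val_inj.
  move: h; rewrite {1}/broom_nbr; case: (ltnP y p) => yp; last first.
    move=> h; exists (fun z => z != y :> nat); rewrite eqxx; split=> //.
      by move: h; do 2?case: ifP; lia.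
    move=> a b ab _; rewrite negbK => /eqP E; subst b; move: ab; rewrite /broom_nbr (_ : (y < p) = false); last lia; move: h.
    by do 4?case: ifP; lia.
  case: (ltnP x p) => xp h; last first.
    exists (fun z => z == x :> nat); rewrite eqxx; split=> //.
      by move: h; case: ifP; lia.
    move=> a b ab /eqP E _; subst a; move: ab; rewrite /broom_nbr (_ : (x < p) = false); last lia; move: h.
    by do 2?case: ifP; lia.
  case: (ltnP x y) => xy.
    exists (fun z => (z <= x) || (p <= z < p + m)); split; try lia.
    by move=> a b; rewrite /broom_nbr; do 5?case: ifP; lia.
  exists (fun z => (x <= z < p) || (p + m <= z)); split; try lia.
  by move=> a b; rewrite /broom_nbr; do 5?case: ifP; lia.
Qed.

(** The [i]-th path edge joins the path vertices [i - 1] and [i], so [i] path vertices and the [m]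
    left leaves stay on the left. *)
Lemma pathdel_B m n p i (a b u w : B m n p) : 0 < m -> 0 < n -> 0 < i < p -> a.+1 = i :> nat ->
  b = i :> nat -> u = 0 :> nat -> w = p.-1 :> nat ->
  @pathdel m n p i (del_edge [set a; b]) [set z : B m n p | (z < i) || (p <= z < p + m)] u w.
Proof.
move=> m0 n0 ip ai bi u0 wp; have p0 : 0 < p by lia.
have ab : adj a b by rewrite adj_B // /broom_nbr; do 3?case: ifP; lia.
pose F := del_edge [set a; b].
have dF (z : F) : @dg F z = if z < p then (if z == 0 :> nat then m.+1 else
    if z.+1 == p then n.+1 else 2) - ((z.+1 == i) + (z == i :> nat)) else 1.
  have := @dg_del (B m n p) a b z ab; rewrite (@dg_B m n p z) -/F; last lia.
  by rewrite !inE -!val_eqE /=; do 4?case: ifP; lia.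
have pth (z : F) : @dg F z <> 1 -> z < p by rewrite dF; case: ifP.
have aE (x y : F) : @adj F x y = broom_nbr m p x y &&
    ~~ ((x.+1 == i) && (y == i :> nat) || (y.+1 == i) && (x == i :> nat)).
  by rewrite adj_B_del // bi -ai !eqSS [X in _ || X]andbC.
have nE (x y : F) : x < p -> y < p -> @adj F x y =
   ((x.+1 == y) || (y.+1 == x)) && ((x < i) == (y < i)).
  by move=> xp yp; rewrite aE /broom_nbr xp yp; lia.
split.
- rewrite (@card_nat _ (fun z => (z < i) || (p <= z < p + m)) (iota 0 i ++ iota p m)).
  + by rewrite size_cat !size_iota addnC.
  + rewrite cat_uniq !iota_uniq andbT; apply/hasPn => z; rewrite !mem_iota; lia.
  + by move=> z; rewrite mem_cat !mem_iota; lia.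
- move=> x y; rewrite !inE aE /broom_nbr => /andP[]; have := ltn_ord x; have := ltn_ord y.
  by do 4?case: ifP; lia.
- move=> Z cZ x y xZ; rewrite !inE => xy.
  pose P k := forall z : F, z = k :> nat -> z \in Z.
  have st := @closed_step m n p a b Z p0 cZ; rewrite bi in st.
  have sp k l : k < p -> l < p -> (k.+1 == l) || (l.+1 == k) -> (k < i) = (l < i) -> P k -> P l.
    by move=> kp lp h h'; apply: st; try lia; rewrite /broom_nbr kp lp //.
  have up k j : k < p -> P j -> j <= k -> (j < i) = (k < i) -> P k.
    elim: k => [|k IH] kp Pj jk h'; first by have -> : 0 = j by lia.
    case: (ltngtP j k.+1) => h; [|lia|by rewrite -h].
    by apply: (sp k); try lia; apply: IH => //; lia.
  have dn k j : k < p -> P k -> j <= k -> (j < i) = (k < i) -> P j.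
    elim: k j => [|k IH] j kp Pk jk h'; first by have -> : j = 0 by lia.
    case: (ltngtP j k.+1) => h; [|lia|by rewrite h].
    by apply: IH => //; try lia; apply: (sp k.+1) => //; lia.
  have Px : P x by move=> z /val_inj ->.
  suff Py : P y by apply: Py.
  have xN := ltn_ord x; have yN := ltn_ord y.
  case: (boolP ((x < i) || (p <= x < p + m))) xy => hx; rewrite ?(negPf hx) => hy.
    have P0 : P 0.
      case: (ltnP x p) => xp; first by apply: (dn x) => //; lia.
      by apply: (st x) => //; try lia; rewrite /broom_nbr; do 3?case: ifP; lia.
    case: (ltnP y p) => yp; first by apply: (up _ 0) => //; lia.
    by apply: (st 0) => //; try lia; rewrite /broom_nbr; do 3?case: ifP; lia.
  have P1 : P p.-1.
    case: (ltnP x p) => xp; first by apply: (up _ x) => //; lia.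
    by apply: (st x) => //; try lia; rewrite /broom_nbr; do 3?case: ifP; lia.
  case: (ltnP y p) => yp; first by apply: (dn p.-1) => //; lia.
  by apply: (st p.-1) => //; try lia; rewrite /broom_nbr; do 3?case: ifP; lia.
- by rewrite inE u0; lia.
- by rewrite inE wp; lia.
- by rewrite dF u0 p0 /=; lia.
- by rewrite dF wp; do 3?case: ifP; lia.
- by move=> z; rewrite -!val_eqE /= dF; do 3?case: ifP; lia.
- move=> x y + + /pth xp /pth yp; rewrite !nE ?u0 // => hx hy; apply: val_inj => /=; lia.
- move=> x y + + /pth xp /pth yp; rewrite !nE ?wp //; try lia.
  by move=> hx hy; apply: val_inj => /=; lia.
- move=> i2 z; rewrite inE -val_eqE => zi zu; rewrite /= in zu; rewrite aE dF /broom_nbr u0 p0.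
  by do 3?case: ifP; lia.
- move=> i2 z; rewrite inE -val_eqE => zi zu; rewrite /= in zu; have zN := ltn_ord z.
  by rewrite aE dF /broom_nbr wp; do 4?case: ifP; lia.
Qed.

Lemma sum_B m n p : 0 < m -> 0 < n -> 2 <= p ->
  \sum_(x : B m n p) dg x + 2 = 2 * (p + m + n).
Proof.
move=> m0 n0 p2.
have sumP (P : pred nat) s c : uniq s -> (forall y, (y \in s) = (y < p + m + n) && P y) ->
    \sum_(x : B m n p) P x * c = size s * c.
  move=> us hs; rewrite -big_distrl /= -(@card_nat (p + m + n) P s us hs) -sum1_card.
  by congr (_ * _); rewrite big_mkcond [RHS]big_mkcond; apply: eq_bigr => z _; rewrite inE; case: (P z).
(* Degrees as indicators: one everywhere, one more on the path, and the excess [m - 1] or [n - 1] at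
   its ends. *)
rewrite (eq_bigr (fun x : B m n p => 1 + ((x < p) * 1 + ((x == 0 :> nat) * m.-1 +
   (x == p.-1 :> nat) * n.-1)))); last first.
  by move=> x _; rewrite (dg_B _ p2); do 3?case: ifP; nia.
rewrite !big_split /= sum1_card card_ord.
rewrite (sumP (fun x => x < p) (iota 0 p)) ?iota_uniq //; last by move=> y; rewrite mem_iota; lia.
rewrite (sumP (fun x => x == 0) [:: 0]) //; last by move=> y; rewrite inE; lia.
rewrite (sumP (fun x => x == p.-1) [:: p.-1]) //; last by move=> y; rewrite inE; lia.
by rewrite size_iota /=; lia.
Qed.

Definition Ledges m n p : {set {set B m n p}} :=
  [set e | [exists u : B m n p, exists q : B m n p,
     [&& e == [set u; q], u == 0 :> nat & p <= q < p + m]]].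

Definition Redges m n p : {set {set B m n p}} :=
  [set e | [exists u : B m n p, exists q : B m n p,
     [&& e == [set u; q], u.+1 == p & p + m <= q]]].

Definition path_edge m n p i (e : {set B m n p}) : Prop :=
  exists a b : B m n p, [/\ e = [set a; b], a.+1 = i & b = i :> nat].

(** Serves to bound a number of mates by counting the edges [e] instead of the edges [f]. *)
Lemma card_Ledges m n p : #|Ledges m n p| <= m.
Proof.
have E : #|[set z : B m n p | p <= z < p + m]| = m.
  rewrite (@card_nat _ (fun z => p <= z < p + m) (iota p m)) ?size_iota ?iota_uniq //.
  by move=> y; rewrite mem_iota; lia.
case: (posnP (p + m + n)) => [N0|N0].
  apply: leq_trans (leq0n _); rewrite leqn0 cards_eq0; apply/eqP/setP => e; rewrite !inE.
  by apply/existsP => -[u _]; have := ltn_ord u; lia.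
pose u0 : B m n p := Ordinal N0.
rewrite -[X in _ <= X]E; apply: leq_trans (leq_imset_card (fun z => [set u0; z]) _).
apply/subset_leq_card/subsetP => e; rewrite inE => /existsP[u /existsP[q /and3P[/eqP-> /eqP hu hq]]].
by apply/imsetP; exists q; rewrite ?inE //; congr [set _; _]; apply: val_inj.
Qed.

Lemma card_Redges m n p : #|Redges m n p| <= n.
Proof.
have E : #|[set z : B m n p | p + m <= z]| = n.
  rewrite (@card_nat _ (fun z => p + m <= z) (iota (p + m) n)) ?size_iota ?iota_uniq //.
  by move=> y; rewrite mem_iota; lia.
case: (posnP p) => [N0|N0].
  apply: leq_trans (leq0n _); rewrite leqn0 cards_eq0; apply/eqP/setP => e; rewrite !inE.
  by apply/existsP => -[u /existsP[q /and3P[]]]; lia.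
have h : p.-1 < p + m + n by lia.
pose u0 : B m n p := Ordinal h.
rewrite -[X in _ <= X]E; apply: leq_trans (leq_imset_card (fun z => [set u0; z]) _).
apply/subset_leq_card/subsetP => e; rewrite inE => /existsP[u /existsP[q /and3P[/eqP-> /eqP hu hq]]].
by apply/imsetP; exists q; rewrite ?inE //; congr [set _; _]; apply: val_inj => /=; lia.
Qed.

Lemma path_edge_inj m n p i (e e' : {set B m n p}) : path_edge i e -> path_edge i e' -> e = e'.
Proof.
move=> [a [b [-> ai bi]]] [a' [b' [-> ai' bi']]].
by congr [set _; _]; apply: val_inj => /=; lia.
Qed.

(** The edge degree [m] counts the other [m - 1] left leaf edges and the first path edge. *)
Definition leaf_mate m n p (H : sgraph) (f : {set H}) : Prop :=
  exists x y q u w : H, [/\ f = [set x; y], adj x y,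
    @dg (del_edge f) x + @dg (del_edge f) y = m & @leafdel m n p (del_edge f) q u w].

(** In the edge degree, an end of the edge interior to the path contributes 1, and an end of the
    path contributes its leaves. *)
Definition path_mate m n p i (H : sgraph) (f : {set H}) : Prop :=
  exists (x y : H) (S : {set H}) (u w : H), [/\ f = [set x; y], adj x y,
    @dg (del_edge f) x + @dg (del_edge f) y =
      (if i == 1 then m else 1) + (if i.+1 == p then n else 1) &
    @pathdel m n p i (del_edge f) S u w].

Lemma mate_left m n p (H : sgraph) (u q : B m n p) (f : {set H}) : 2 <= p -> 0 < n ->
  u = 0 :> nat -> p <= q < p + m -> mate [set u; q] f -> leaf_mate m n p f.
Proof.
move=> p2 n0 u0 hq [_ /edgesP[x [y [xy ->]]] [h bh hh] deg].
have h1 : p.-1 < p + m + n by lia.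
have uq : adj u q by rewrite adj_B /broom_nbr; [do 3?case: ifP|]; lia.
have F := leafdel_B p2 n0 u0 (erefl : (Ordinal h1 : B m n p) = p.-1 :> nat) hq.
exists x, y, (h q), (h u), (h (Ordinal h1)); split => //; last exact: leafdel_iso F.
rewrite -edge_degreeE // -deg edge_degreeE //.
have := @dg_del _ _ _ u uq; have := @dg_del _ _ _ q uq.
by rewrite set21 set22 !dg_B // u0 /=; do 4?case: ifP; lia.
Qed.

Lemma mate_cases m n p (H : sgraph) (e : {set B m n p}) (f : {set H}) : 0 < m -> 0 < n ->
  2 <= p -> mate e f ->
  (e \in Ledges m n p /\ leaf_mate m n p f) \/ (e \in Redges m n p /\ leaf_mate n m p f) \/
  exists i, [/\ 0 < i < p, path_edge i e & path_mate m n p i f].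
Proof.
move=> m0 n0 p2 M; have p0 : 0 < p by lia.
have [/edgesP[x [y [xy E]]] _ _ _] := M.
have [x' [y' [xy' E' lt]]] : exists x y : B m n p, [/\ adj x y, e = [set x; y] & x < y].
  case: (ltngtP x y) => h; [by exists x, y | by exists y, x; rewrite setUC adj_sym |].
  by have := adj_neq xy; rewrite -val_eqE /= h eqxx.
move: x' y' xy' E' lt => {E xy}x {}y xy E lt; subst e.
have xN := ltn_ord x; have yN := ltn_ord y.
move: (xy); rewrite adj_B // /broom_nbr.
case: (ltnP x p) => xp; last by lia.
case: (ltnP y p) => yp; last case: (ltnP y (p + m)) => ym h.
- move=> h; have {h} h : y = x.+1 :> nat by lia.
  right; right; exists y; have yp1 : 0 < y < p by lia.
  split; [lia | by exists x, y; rewrite h |].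
  have [_ /edgesP[a [b [ab Ef]]] [g bigs hg] deg] := M.
  have h1 : p.-1 < p + m + n by lia.
  have h0 : 0 < p + m + n by lia.
  have F := pathdel_B m0 n0 yp1 (esym h) (erefl : y = y :> nat) (erefl : (Ordinal h0 : B m n p) = 0 :> nat)
     (erefl : (Ordinal h1 : B m n p) = p.-1 :> nat).
  exists a, b, (g @: [set z : B m n p | (z < y) || (p <= z < p + m)]), (g (Ordinal h0)), (g (Ordinal h1)).
  subst f; split=> //; last exact: pathdel_iso F.
  rewrite -edge_degreeE // -deg edge_degreeE //.
  have := @dg_del _ _ _ x xy; have := @dg_del _ _ _ y xy.
  by rewrite set21 set22 !dg_B //; do 8?case: ifP; lia.
- left; split; last by apply: (mate_left p2 n0 _ _ M); lia.
  by rewrite inE; apply/existsP; exists x; apply/existsP; exists y; rewrite eqxx; lia.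
right; left; split.
  by rewrite inE; apply/existsP; exists x; apply/existsP; exists y; rewrite eqxx; lia.
have [g [bigs hg gE]] := B_mirror_map m n p0.
have := mate_iso bigs hg M; rewrite imsetU1 imset_set1; apply: mate_left => //.
  by rewrite gE /mirror; case: ifP; lia.
by rewrite gE /mirror; do 2?case: ifP; lia.
Qed.

Lemma mate_card (G H : sgraph) (e : {set G}) (f : {set H}) : mate e f -> #|G| = #|H|.
Proof. by case=> _ _ /iso_card. Qed.

Lemma mate_sum (G H : sgraph) (e : {set G}) (f : {set H}) : mate e f ->
  \sum_(x : G) dg x = \sum_(x : H) dg x.
Proof.
case=> /edgesP[x [y [xy ->]]] /edgesP[x' [y' [xy' ->]]] /(iso_sum id) iso _.
by have := @sum_del _ _ _ id xy; have := @sum_del _ _ _ id xy'; lia.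
Qed.

(** * Recognising a double-broom *)

Lemma dg_gt0 (G : sgraph) (z : G) : 0 < dg z -> exists a, adj z a.
Proof. by rewrite card_gt0 => /set0Pn[a]; rewrite inE; exists a. Qed.

Lemma dg_gt0P (G : sgraph) (z a : G) : adj z a -> 0 < dg z.
Proof. by move=> h; rewrite card_gt0; apply/set0Pn; exists a; rewrite inE. Qed.

Lemma dg_ge2 (G : sgraph) (z a b : G) : adj z a -> adj z b -> a != b -> 1 < dg z.
Proof.
by move=> za zb ab; apply/card_gt1P; exists a, b; rewrite !inE.
Qed.

Lemma dg_ge3 (G : sgraph) (z a b c : G) : adj z a -> adj z b -> adj z c ->
  a != b -> a != c -> b != c -> 2 < dg z.
Proof.
move=> za zb zc ab ac bc; apply/card_gt2P; exists a, b, c.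
by rewrite !inE; split; split; rewrite // eq_sym.
Qed.

Lemma dg1_eq (G : sgraph) (z a b : G) : dg z = 1 -> adj z a -> adj z b -> a = b.
Proof.
by move=> d za zb; apply/eqP; case: eqP => // /eqP /(dg_ge2 za zb); rewrite d.
Qed.

Lemma dg2_eq (G : sgraph) (z a b c : G) : dg z <= 2 -> adj z a -> adj z b -> adj z c ->
  a != b -> c = a \/ c = b.
Proof.
move=> d za zb zc ab; case: (eqVneq c a) => [|ca]; first by left.
case: (eqVneq c b) => [|cb]; first by right.
by have := dg_ge3 za zb zc ab; rewrite eq_sym ca eq_sym cb => /(_ isT isT); lia.
Qed.

Lemma dg_other (G : sgraph) (z a : G) : 1 < dg z -> exists2 b, adj z b & b != a.
Proof.
case/card_gt1P => b [c [+ + bc]]; rewrite !inE => zb zc.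
case: (eqVneq b a) => ba; last by exists b.
by exists c; rewrite // -ba eq_sym.
Qed.

Lemma dg_other2 (G : sgraph) (z a b : G) : 2 < dg z -> exists c, [/\ adj z c, c != a & c != b].
Proof.
move=> d; have : 0 < #|[set y | adj z y] :\ a :\ b|.
  have := cardsD1 a [set y | adj z y]; have := cardsD1 b ([set y | adj z y] :\ a).
  by move: d; rewrite /dg; lia.
rewrite card_gt0 => /set0Pn[c]; rewrite !inE => /and3P[cb ca zc]; by exists c.
Qed.

Definition conn (G : sgraph) : Prop :=
  forall Z : {set G}, adj_closed Z -> forall a b, a \in Z -> b \in Z.

(** No vertex of [r] is a leaf, so [x] is the one non-leaf neighbour that [c] may have, and the [k]
    others are leaves outside [r]. *)
Lemma full_leaves (H : sgraph) (k : nat) (r : seq H) (c x : H) : x \in r -> adj c x ->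
  {in r, forall z, dg z <> 1} -> full c -> dg c = k.+1 ->
  #|[set z | adj c z & z \notin r]| = k /\ forall z, adj c z -> z \notin r -> dg z = 1.
Proof.
move=> xr cx hr fc dc.
have lf z : adj c z -> z \notin r -> dg z = 1.
  move=> cz nz; case: (eqVneq (dg z) 1) => // /eqP dz.
  by move: nz; rewrite (fc _ _ cz cx dz (hr _ xr)) xr.
split=> //; have := cardsD1 x [set z | adj c z]; rewrite inE cx -/(dg c) dc => -[->].
apply: eq_card => z; rewrite !inE andbC; case: (boolP (adj c z)) => cz; rewrite ?andbF ?andbT //=.
case: (eqVneq z x) => [->|zx]; first by rewrite xr.
apply/negP => zr; move/eqP: zx; apply.
exact: fc (hr _ zr) (hr _ xr).
Qed.

(* A shortest path from c to c' together with the leaf neighbours of its ends is closed under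
   adjacency, hence exhausts H. *)
Lemma broom_of_full m n p (H : sgraph) (c c' : H) : 0 < m -> 0 < n -> conn H ->
  #|H| = p + m + n -> \sum_(x : H) dg x <= \sum_(x : B m n p) dg x ->
  c != c' -> dg c = m.+1 -> dg c' = n.+1 -> full c -> full c' ->
  (forall z, z != c -> z != c' -> dg z <= 2) -> graph_iso H (B m n p).
Proof.
move=> m0 n0 cH cardH sumH cc' dc dc' fc fc' dz.
have : connect (@adj H) c c'.
  have cl : adj_closed [set z | connect (@adj H) c z].
    by move=> a b ab; rewrite !inE => /connect_trans; apply; apply: connect1.
  by have := cH _ cl c c'; rewrite !inE; apply; apply: connect0.
case/connectP => s1 p1 l0; move: cc' l0; case/shortenP: p1 => s ps us _ cc' l0.
pose r := c :: s; have nth0 : nth c r 0 = c by [].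
have szr : size r = (size s).+1 by [].
have ur : uniq r := us.
have cr : c \in r by rewrite inE eqxx.
have s0 : 0 < size s by rewrite lt0n size_eq0; apply: contraNneq cc' => E; rewrite l0 E.
have nthl : nth c r (size s) = c' by rewrite l0 (last_nth c).
have step i : i < size s -> adj (nth c r i) (nth c r i.+1) by move=> h; apply: (pathP c ps).
clearbody r; clear us ps; move: (size s) s0 szr nthl step l0 => k s0 szr nthl step _.
have c'r : c' \in r by rewrite -nthl mem_nth // szr.
have hk i : i <= k -> i < size r by rewrite szr ltnS.
have predP i : 0 < i < k -> [/\ i.-1 < k, i.-1.+1 = i, i.-1 <= k, i.+1 <= k & i.-1 != i.+1].
  by move=> h; split; lia.
have int z : z \in r -> z != c -> z != c' -> exists i, [/\ 0 < i < k, z = nth c r i,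
    adj z (nth c r i.-1) & adj z (nth c r i.+1)].
  move=> /(nthP c)[i hi <-] zc zc'.
  have i0 : i != 0 by apply: contraNneq zc => ->; rewrite nth0.
  have il : i != k by apply: contraNneq zc' => ->; rewrite nthl.
  rewrite szr ltnS in hi.
  have hi' : 0 < i < k by rewrite lt0n i0 ltn_neqAle il.
  have [h1 h2 _ _ _] := predP _ hi'.
  exists i; split=> //; last by apply: step; case/andP: hi'.
  by rewrite adj_sym; have := step _ h1; rewrite h2.
have intn i : 0 < i < k -> nth c r i.-1 != nth c r i.+1.
  by move=> /predP[_ _ h1 h2 h3]; rewrite nth_uniq // hk.
have hr : {in r, forall z, dg z <> 1}.
  move=> z zr; case: (eqVneq z c) => [->|zc]; first by move: m0; rewrite dc; case: (m).
  case: (eqVneq z c') => [->|zc']; first by move: n0; rewrite dc'; case: (n).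
  have [i [hi _ h1 h2]] := int _ zr zc zc'.
  by have := dg_ge2 h1 h2 (intn _ hi); case: (dg z) => [|[]].
have intcl z a : z \in r -> z != c -> z != c' -> adj z a -> a \in r.
  move=> zr zc zc' za; have [i [hi _ h1 h2]] := int _ zr zc zc'.
  have [_ _ g1 g2 _] := predP _ hi.
  by have [->|->] := dg2_eq (dz _ zc zc') h1 h2 za (intn _ hi); rewrite mem_nth // hk.
have h1 : adj c (nth c r 1) by rewrite -{1}nth0; apply: step.
have h1' : adj c' (nth c r k.-1).
  by rewrite -nthl adj_sym -[in nth c r k](prednK s0); apply: step; rewrite prednK.
have [cL lL] := full_leaves (mem_nth c (hk _ s0)) h1 hr fc dc.
have [cL' lL'] := full_leaves (mem_nth c (hk _ (leq_pred k))) h1' hr fc' dc'.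
set L := [set z | _ & _] in cL; set L' := [set z | _ & _] in cL'.
(* This is the order of the coding of [B], so that [nth] in [M] is the isomorphism. *)
pose M := r ++ enum L ++ enum L'.
have memM z : (z \in M) = [|| z \in r, z \in L | z \in L'].
  by rewrite !mem_cat !mem_enum.
have uM : uniq M.
  rewrite cat_uniq ur cat_uniq !enum_uniq andbT /=; apply/andP; split; apply/hasPn => z.
    rewrite mem_cat !mem_enum ![z \in L]inE ![z \in L']inE -andb_orl.
    by case/andP.
  rewrite !mem_enum !inE => /andP[c'z zr]; apply/negP => /andP[cz _].
  by move/eqP: cc'; apply; apply: (dg1_eq (lL _ cz zr)); rewrite adj_sym.
have sM : size M = p + m + n.
  rewrite -cardH -(card_uniqP uM); apply: eq_card => z.
  have cl : adj_closed [set z | z \in M].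
    move=> a b ab; rewrite !inE !memM => /or3P[ar|aL|aL'].
    - case: (boolP (b \in r)) => //= br.
      case: (eqVneq a c) => [E|ac]; first by rewrite !inE -E ab br.
      case: (eqVneq a c') => [E|ac']; first by rewrite !inE -E ab br orbT.
      by rewrite (intcl _ _ ar ac ac' ab) in br.
    - move: aL; rewrite inE => /andP[ca nar].
      by rewrite (dg1_eq (lL _ ca nar) ab (_ : adj a c)) ?cr // adj_sym.
    - move: aL'; rewrite inE => /andP[ca nar].
      by rewrite (dg1_eq (lL' _ ca nar) ab (_ : adj a c')) ?c'r // adj_sym.
  by have := cH _ cl c z; rewrite !inE !memM cr => ->.
(* The length of the path is not known beforehand; it follows from the number of vertices. *)
have sr : size r = p by move: sM; rewrite !size_cat -!cardE cL cL'; lia.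
pose f (i : B m n p) : H := nth c M i.
apply: iso_sym; apply: (@iso_of_hom _ _ f) => //.
- by move=> i j /eqP; rewrite nth_uniq ?sM ?ltn_ord // => /eqP/val_inj.
- by rewrite cardH card_ord.
have hom (i j : B m n p) : broom_rel m p i j -> adj (f i) (f j).
  have jN := ltn_ord j.
  rewrite /f /M !nth_cat sr -!cardE cL; case/or3P => /andP[].
  - move=> /eqP <- h; rewrite h (_ : i < p); last by lia.
    by apply: step; lia.
  - move=> /eqP -> h; rewrite (_ : 0 < p); last by lia.
    rewrite (_ : j < p = false); last by lia.
    rewrite (_ : j - p < m); last by lia.
    have : nth c (enum L) (j - p) \in enum L by rewrite mem_nth // -cardE cL; lia.
    by rewrite mem_enum inE nth0 => /andP[].
  - move=> ip h; rewrite (_ : i < p); last by lia.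
    rewrite (_ : j < p = false); last by lia.
    rewrite (_ : j - p < m = false); last by lia.
    have : nth c (enum L') (j - p - m) \in enum L' by rewrite mem_nth // -cardE cL'; lia.
    rewrite mem_enum inE => /andP[+ _]; rewrite -nthl.
    by have -> : k = i by lia.
by move=> i j; rewrite adj_nat_graph => /andP[_ /orP[]] /hom //; rewrite adj_sym.
Qed.

(** [K c] is the class [c], which holds at most one index. The second part says that in the extremal
    case every class is occupied. *)
Lemma pigeonhole (k l : nat) (K : 'I_l -> 'I_k -> Prop) :
  (forall j, exists c, K c j) -> (forall c i j, K c i -> K c j -> i = j) ->
  k <= l /\ (l <= k -> forall c, exists j, K c j).
Proof.
move=> /fin_all_exists[col hcol] inj.
have ci : injective col.
  by move=> i j E; apply: (inj (col i)); rewrite ?hcol // E.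
split; first by have := leq_card col ci; rewrite !card_ord.
move=> lk c; have lk' : #|'I_l| <= #|'I_k| by rewrite !card_ord.
by have [g _ gK] := inj_card_bij ci lk'; exists (g c); have := hcol (g c); rewrite gK.
Qed.

Lemma leq3_cases (k : nat) : 2 < k -> exists i j l : 'I_k, [/\ i <> j, i <> l & j <> l].
Proof.
move=> h; have h0 : 0 < k by lia. have h1 : 1 < k by lia.
by exists (Ordinal h0), (Ordinal h1), (Ordinal h); split; case.
Qed.

Lemma dg_in (H : sgraph) (f : {set H}) z : f \in edges H -> z \in f ->
  dg z = (@dg (del_edge f) z).+1.
Proof. by case/edgesP => x [y [xy ->]] zf; rewrite -(dg_del z xy) zf addn1. Qed.

Lemma dg_notin (H : sgraph) (f : {set H}) z : f \in edges H -> z \notin f ->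
  @dg (del_edge f) z = dg z.
Proof.
by case/edgesP => x [y [xy ->]] /negPf zf; rewrite -(dg_del z xy) zf addn0.
Qed.

Lemma adj_notin (H : sgraph) (f : {set H}) (z a : H) : z \notin f ->
  @adj (del_edge f) z a = adj z a.
Proof.
move=> zf; rewrite adj_del andbC; case: eqP => // E.
by rewrite -E set21 in zf.
Qed.

Lemma adj_closedC (G : sgraph) (S : {set G}) : adj_closed S -> adj_closed (~: S).
Proof.
move=> cS a b ab; rewrite !inE; apply: contraNN => bS.
by apply: cS bS; rewrite adj_sym.
Qed.

Lemma adj_closed_del (H : sgraph) (f Z : {set H}) : adj_closed Z -> @adj_closed (del_edge f) Z.
Proof. by move=> cZ a b /del_sub; exact: cZ. Qed.

Lemma pathdel_mirror m n p i (F : sgraph) (S : {set F}) u w : 0 < i < p -> #|F| = p + m + n ->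
  pathdel m n p i S u w -> pathdel n m p (p - i) (~: S) w u.
Proof.
move=> ip cF [cS clS con uS wS du dw dz fu fw su swap_graph].
split; rewrite ?inE ?negbK ?uS ?wS //.
- by have := cardsC S; rewrite cS cF; lia.
- exact: adj_closedC.
- move=> Z cZ a b aZ; rewrite !inE => /(congr1 negb); rewrite !negbK; exact: con.
- by rewrite dw; congr (_ + _); lia.
- by rewrite du; congr (_ + _); lia.
- by move=> z zw zu; apply: dz.
- by move=> h z; rewrite inE; apply: swap_graph; lia.
- by move=> h z; rewrite inE negbK; apply: su; lia.
Qed.

Lemma path_mate_mirror m n p i (H : sgraph) (f : {set H}) : 0 < i < p -> #|H| = p + m + n ->
  path_mate m n p i f -> path_mate n m p (p - i) f.
Proof.
move=> ip cH [x [y [S [u [w [Ef xy d F]]]]]].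
exists x, y, (~: S), w, u; split=> //; last exact: pathdel_mirror F.
by rewrite d; do 4?case: ifP; lia.
Qed.

(** The isolated vertex [q] of [H - f] must be an end of [f], since otherwise it would be isolated
    in [H]; hence [f] is pendant. *)
Lemma leaf_mate_conn m n p (H : sgraph) (f : {set H}) : conn H -> leaf_mate m n p f ->
  exists z q u w : H, [/\ f = [set q; z], adj q z, @dg (del_edge f) z = m, dg q = 1 &
    @leafdel m n p (del_edge f) q u w].
Proof.
move=> cH [x [y [q [u [w [Ef xy d F]]]]]].
have fE : f \in edges H by apply/edgesP; exists x, y.
have q0 : @dg (del_edge f) q = 0.
  apply/eqP; rewrite cards_eq0; apply/eqP/setP => z; rewrite !inE; apply/negbTE.
  exact: L_q F z.
have qf : q \in f.
  apply: contraT => qf.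
  have cl : adj_closed [set q].
    move=> a b ab /set1P E; move: ab; rewrite {a}E -(adj_notin _ qf).
    by rewrite (negPf (L_q F b)).
  have := cH _ cl q u; rewrite !inE eqxx => /(_ isT) /eqP E.
  by have := L_qu F; rewrite E eqxx.
have dq : dg q = 1 by rewrite (dg_in fE qf) q0.
move: (qf); rewrite {1}Ef => /set2P[E|E].
  exists y, q, u, w; split; rewrite // ?E //.
  by rewrite -d -E q0.
exists x, q, u, w; split; rewrite // ?E // 1?setUC // 1?adj_sym //.
by rewrite -d -E q0 addn0.
Qed.

(** Connectivity forces [f] to join the two components of [H - f]; [x] names its end on the side of
    [u]. *)
Lemma path_mate_conn m n p i (H : sgraph) (f : {set H}) : conn H -> path_mate m n p i f ->
  exists (x y : H) (S : {set H}) (u w : H), [/\ f = [set x; y], adj x y,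
    @dg (del_edge f) x + @dg (del_edge f) y =
      (if i == 1 then m else 1) + (if i.+1 == p then n else 1),
    @pathdel m n p i (del_edge f) S u w & x \in S /\ y \notin S].
Proof.
move=> cH [x [y [S [u [w [Ef xy d F]]]]]].
have [h|h] : (x \in S) = (y \in S) \/ (x \in S) = ~~ (y \in S).
    by case: (x \in S); case: (y \in S); auto.
  have cl : adj_closed S.
    move=> a b ab; case: (boolP ([set a; b] == f)) => [/eqP|] E.
      by move: E; rewrite Ef => /set2_inj[[-> ->]|[-> ->]]; rewrite h.
    by apply: (P_cl F); rewrite adj_del ab.
  by have := cH _ cl u w (P_u F); rewrite (negPf (P_w F)).
case: (boolP (y \in S)) h => yS h.
  exists y, x, S, u, w; split; rewrite // ?h // 1?setUC // 1?adj_sym //.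
  by rewrite addnC d.
by exists x, y, S, u, w; split; rewrite // ?h.
Qed.

(** * Connected graphs, [2 <= m] *)

Definition bigs (H : sgraph) (c c' : H) : Prop :=
  [/\ c != c', 2 < dg c, 2 < dg c' & forall z, z != c -> z != c' -> dg z <= 2].

Definition broomlike m n (H : sgraph) : Prop :=
  exists c c' : H, [/\ bigs c c', dg c = m.+1, dg c' = n.+1, full c & full c'].

Definition separates (H : sgraph) (f : {set H}) (c c' : H) : Prop :=
  exists S : {set H}, [/\ @adj_closed (del_edge f) S, c \in S & c' \notin S].

(* The ways a mate [f] can sit in a connected [H] with exactly two vertices [c], [c'] of degree at
   least 3: away from both; joining [c] to a common neighbour [z]; at a pendant path of three vertices
   hanging from [c]; at a leaf of [c]. *)
Definition mid_kind (H : sgraph) (f : {set H}) (c c' : H) : Prop :=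
  [/\ bigs c c', c \notin f /\ c' \notin f, @full (del_edge f) c, @full (del_edge f) c' & separates f c c'].

Definition com_kind (H : sgraph) (f : {set H}) (c c' z : H) : Prop :=
  [/\ bigs c c', f = [set c; z], adj c z, adj c' z /\ dg z = 2 & separates f c c'].

Definition leg_kind (H : sgraph) (f : {set H}) (c c' x : H) (S : {set H}) : Prop :=
  [/\ bigs c c', f = [set c; x], adj c x, dg x = 2 /\ dg c = 3 &
   [/\ #|S| = 3, x \in S, c \notin S, c' \notin S &
       forall a b, adj a b -> a \in S -> b \notin S -> a = x /\ b = c]].

Definition pen_kind (H : sgraph) (f : {set H}) (c c' q : H) : Prop :=
  [/\ bigs c c', f = [set q; c], adj c q, dg q = 1 /\ dg c = 3 & full c'].

(** Deleting a mate of the first path edge of a broom leaves a star. The cases: [f] leaves it at its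
    centre; [f] joins one of its leaves to the other large vertex, where the edge degree gives
    [a = b + 1]; [f] joins one of its leaves to a vertex of degree [a = 2] in [H - f]. *)
Definition end_kind a b (H : sgraph) (f : {set H}) : Prop :=
  (exists c c' z : H, [/\ com_kind f c c' z, full c, dg c = a.+1 & dg c' = b.+1]) \/
  (exists c c' z : H, [/\ com_kind f c c' z, full c', dg c = a.+1, dg c' = b.+1 & a = b.+1]) \/
  (exists (c c' x : H) (S : {set H}), [/\ leg_kind f c c' x S, a = 2 & dg c' = b.+1]).

Lemma separatesC (H : sgraph) (f : {set H}) (c c' : H) : separates f c c' -> separates f c' c.
Proof.
move=> [S [cS c1 c2]]; exists (~: S); rewrite !inE c1 c2; split=> //.
exact: adj_closedC.
Qed.

Lemma bigsC (H : sgraph) (c c' : H) : bigs c c' -> bigs c' c.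
Proof.
move=> [cc d d' dz]; split=> //; first by rewrite eq_sym.
by move=> z h h'; apply: dz.
Qed.

(** [S] is a star centred at [u]. If [f] leaves it at [u], [H] is broomlike unless [p > 3] and the
    other end is a leaf of [w]. If [f] leaves it at a leaf, the edge degree gives the other end
    degree [m] in [H - f], so that it is [w] or [m = 2]. *)
Lemma path_mate_end m n p (H : sgraph) (f : {set H}) : 1 < m -> 1 < n -> 2 <= p -> conn H ->
  path_mate m n p 1 f -> broomlike m n H \/ 3 < p /\ end_kind m n f.
Proof.
move=> m1 n1 p2 cH /(path_mate_conn cH)[x [y [S [u [w [Ef xy d F [xS yS]]]]]]].
have fE : f \in edges H by apply/edgesP; exists x, y.
have xf : x \in f by rewrite Ef set21.
have yf : y \in f by rewrite Ef set22.
have [dx dy] := (dg_in fE xf, dg_in fE yf).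
have nf z : z != x -> z != y -> z \notin f by move=> h1 h2; rewrite Ef !inE negb_or h1.
have dn z : z != x -> z != y -> @dg (del_edge f) z = dg z by move=> h1 h2; rewrite dg_notin ?nf.
have du : @dg (del_edge f) u = m by rewrite (P_du F) addn0.
have dw := P_dw F; have wS := P_w F; have uS := P_u F.
have inS z : z \in S -> z != y by apply: contraTneq => ->.
have outS z : z \notin S -> z != x by apply: contraNneq => ->.
have uw : u != w by apply: contraTneq uS => ->.
have cl := P_cl F.
have star z : z \in S -> z != u -> @adj (del_edge f) u z /\ @dg (del_edge f) z = 1.
  by move=> zS zu; have /andP[h1 h2] := P_su F isT zS zu; split=> //; apply/eqP.
have edge (a b : H) : @adj H a b -> @adj (del_edge f) a b \/ (a = x /\ b = y) \/ (a = y /\ b = x).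
  rewrite adj_del => ->; case: (eqVneq [set a; b] f) => [|_]; last by left.
  by move=> E; have := set2_inj (etrans E Ef); auto.
have dz := P_dz F.
case: (eqVneq x u) => xu.
  subst x; rewrite eqxx du in d.
  have fu a : adj u a -> dg a <> 1 -> a = y.
    move=> /edge[|[[]|[]]] //; last by move=> E; rewrite E (negPf yS) in uS.
    move=> ua; have au : a != u by rewrite eq_sym; apply: adj_neq ua.
    have aS := cl _ _ ua uS; have [_ h] := star _ aS au.
    by rewrite -dn ?inS.
  have Fu : full u by move=> a b /fu h /fu h' /h -> /h' ->.
  case: (eqVneq 2 p) => p2'.
    left; rewrite p2' eqxx in d.
    have yw : y = w.
      apply/eqP; apply: contraT => yw.
      have h3 : p <= 3 by nlia.
      have /andP[_ /eqP h] := P_sw F h3 yS yw; nlia.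
    subst w; exists u, y; split; rewrite ?dx ?dy ?du //; try nlia.
      split; rewrite ?dx ?dy ?du; try nlia; first by apply: contraTneq uS => ->.
      by move=> z zu zy; rewrite -dn //; have := dz _ zu zy; nlia.
    have fy a : adj y a -> dg a <> 1 -> a = u.
      move=> /edge[|[[]|[]]] //; last by move=> E; rewrite -E (negPf yS) in uS.
      move=> ya; have ay : a != y by rewrite eq_sym; apply: adj_neq ya.
      have aS : a \notin S by apply: contraNN yS => aS; apply: cl aS; rewrite adj_sym.
      have h3 : p <= 3 by nlia.
      have /andP[_ /eqP h] := P_sw F h3 aS ay.
      by rewrite -dn ?outS // h; nlia.
    by move=> a b /fy h /fy h' /h -> /h' ->.
  rewrite (_ : 2 == p = false) in d; last by apply/negbTE.
  have p3 : 2 < p by nlia.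
  rewrite p3 in dw.
  have dy1 : @dg (del_edge f) y = 1 by nlia.
  have yw : y != w by apply: contra_eqN dy1 => /eqP ->; rewrite dw; nlia.
  have dw' : dg w = n.+1 by rewrite -dn ?outS // 1?eq_sym // dw addn1.
  have B : bigs u w.
    split; rewrite ?dx ?du ?dw' //; try nlia.
    move=> z zu zw; case: (eqVneq z y) => [->|zy]; first by nlia.
    by rewrite -dn //; have := dz _ zu zw; nlia.
  have wf : w \notin f by rewrite nf ?outS // eq_sym.
  have wE a : adj w a -> [/\ @adj (del_edge f) w a, a \notin S & a != w].
    rewrite -(adj_notin _ wf) => wa; split; rewrite // 1?eq_sym ?(adj_neq wa) //.
    by apply: contraNN wS => aS; apply: cl aS; rewrite adj_sym.
  case: (boolP (@adj (del_edge f) w y)) => wy; last first.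
    left; exists u, w; split; rewrite ?dx ?du //.
    move=> a b wa wb da db; have [h1 aS _] := wE _ wa; have [h2 bS _] := wE _ wb.
    have ay : a != y by apply: contraTneq h1 => ->.
    have by' : b != y by apply: contraTneq h2 => ->.
    by apply: (P_fw F) => //; rewrite dn ?outS.
  case: (ltnP 3 p) => p4; [right; split=> //; left|left].
    exists u, w, y; split; rewrite ?dx ?du //; split=> //; last by exists S.
    by rewrite -(adj_notin _ wf) wy dy dy1.
  exists u, w; split; rewrite ?dx ?du //.
  have fw a : adj w a -> dg a <> 1 -> a = y.
    move=> /wE[wa aS aw] da; apply/eqP; apply: contra_notT da => ay.
    have /andP[_ /eqP h] := P_sw F p4 aS aw.
    by rewrite -dn ?outS.
  by move=> a b /fw h /fw h' /h -> /h' ->.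
have [ux dx1] := star _ xS xu.
case: (eqVneq 2 p) => p2'.
  exfalso; rewrite p2' !eqxx dx1 in d.
  case: (eqVneq y w) => yw; first by subst y; rewrite dw -p2' in d; nlia.
  have h3 : p <= 3 by nlia.
      by have /andP[_ /eqP h] := P_sw F h3 yS yw; nlia.
rewrite eqxx (_ : 2 == p = false) in d; last by apply/negbTE.
have p3 : 2 < p by nlia.
rewrite p3 in dw.
have dym : @dg (del_edge f) y = m by nlia.
have uf : u \notin f by rewrite nf ?inS // eq_sym.
have du' : dg u = m by rewrite -(dg_notin fE uf).
case: (eqVneq y w) => yw.
  subst y; have mn : m = n.+1 by nlia.
  have B : bigs w u.
    split; rewrite ?dy ?du' ?dym ?(eq_sym w) //; try nlia.
    move=> z zw zu; case: (eqVneq z x) => [->|zx]; first by nlia.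
    by rewrite -dn //; have := dz _ zu zw; nlia.
  have fu : full u.
    have fu a : adj u a -> dg a <> 1 -> a = x.
      rewrite -(adj_notin _ uf) => ua da; apply/eqP; apply: contra_notT da => ax.
      have aS := cl _ _ ua uS.
      have au : a != u by rewrite eq_sym; apply: adj_neq ua.
      by have [_ h] := star _ aS au; rewrite -dn ?inS.
    by move=> a b /fu h /fu h' /h -> /h' ->.
  case: (ltnP 3 p) => p4; [right; split=> //; right; left|left].
    exists w, u, x; split; rewrite ?dy ?dym ?du' //.
    split=> //; [by rewrite Ef setUC | by rewrite adj_sym | | by apply: separatesC; exists S].
    by rewrite -(adj_notin _ uf) ux dx dx1.
  exists w, u; split; rewrite ?dy ?dym ?du' //.
  have fw a : adj w a -> dg a <> 1 -> a = x.
    move=> /edge[|[[]|[]]] //; last by move=> E; rewrite E xS in wS.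
    move=> wa; have aS : a \notin S by apply: contraNN wS => aS; apply: cl aS; rewrite adj_sym.
    have aw : a != w by rewrite eq_sym; apply: adj_neq wa.
    have /andP[_ /eqP h] := P_sw F p4 aS aw.
    by rewrite -dn ?outS.
  by move=> a b /fw h /fw h' /h -> /h' ->.
have yu : y != u by apply: contraNneq yS => ->.
have m2 : m = 2 by have := dz _ yu yw; nlia.
have p4 : 3 < p.
  rewrite ltnNge; apply/negP => p4.
  by have /andP[_ /eqP h] := P_sw F p4 yS yw; nlia.
right; split=> //; right; right.
have dw' : dg w = n.+1 by rewrite -dn ?outS // 1?eq_sym // dw addn1.
exists y, w, x, S; split=> //.
split=> //; [|by rewrite Ef setUC | by rewrite adj_sym | |].
- split; rewrite ?dy ?dw' //; try nlia.
  move=> z zy zw; case: (eqVneq z u) => [->|zu]; first by nlia.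
  case: (eqVneq z x) => [->|zx]; first by nlia.
  by rewrite -dn //; have := dz _ zu zw; nlia.
- by split; nlia.
- split=> //; first by rewrite (P_S F) m2.
  move=> a b /edge[/cl h|[//|[-> ->]]] aS bS; first by rewrite h in bS.
  by rewrite xS in bS.
Qed.

Lemma path_mate_mid m n p i (H : sgraph) (f : {set H}) : 1 < m -> 1 < n -> 1 < i -> i.+1 < p -> conn H ->
  path_mate m n p i f -> broomlike m n H \/
  4 < p /\ exists c c' : H, [/\ mid_kind f c c', dg c = m.+1 & dg c' = n.+1].
Proof.
move=> m1 n1 i1 ip cH /(path_mate_conn cH)[x [y [S [u [w [Ef xy d F [xS yS]]]]]]].
have fE : f \in edges H by apply/edgesP; exists x, y.
have xf : x \in f by rewrite Ef set21.
have yf : y \in f by rewrite Ef set22.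
have [dx dy] := (dg_in fE xf, dg_in fE yf).
have nf z : z != x -> z != y -> z \notin f by move=> h1 h2; rewrite Ef !inE negb_or h1.
have dn z : z != x -> z != y -> @dg (del_edge f) z = dg z by move=> h1 h2; rewrite dg_notin ?nf.
have du := P_du F; have dw := P_dw F; rewrite i1 ip !addn1 in du dw.
have wS := P_w F; have uS := P_u F; have cl := P_cl F; have dz := P_dz F.
have i1' : (i == 1) = false by case: (i) i1 => [|[]].
have ip' : (i.+1 == p) = false by apply/negbTE; rewrite neq_ltn ip.
rewrite i1' ip' in d.
have pos z : 0 < @dg (del_edge f) z.
  case: (eqVneq z u) => [->|zu]; first by nlia.
  by case: (eqVneq z w) => [->|zw]; [nlia | have /andP[] := dz _ zu zw].
(* The edge degree is 2 and no degree vanishes, so [f] joins two leaves of [H - f] and avoids [u]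
   and [w]. *)
have [dx1 dy1] : @dg (del_edge f) x = 1 /\ @dg (del_edge f) y = 1.
  by have := pos x; have := pos y; nlia.
have nfd z : 1 < @dg (del_edge f) z -> z \notin f.
  by move=> h; apply: nf; apply: contraTneq h => ->; nlia.
have [uf wf] : u \notin f /\ w \notin f by split; apply: nfd; nlia.
have [du' dw'] : dg u = m.+1 /\ dg w = n.+1 by rewrite -!(dg_notin fE).
have B : bigs u w.
  split; rewrite ?du' ?dw' //; first by apply: contraTneq uS => ->.
  move=> z zu zw; case: (boolP (z \in f)) => [|zf]; last by rewrite -(dg_notin fE zf); have := dz _ zu zw; nlia.
  by rewrite Ef => /set2P[]->; nlia.
(* For [p <= 4] both components are stars, and joining two of their leaves rebuilds a broom. *)
case: (ltnP 4 p) => p4; [right; split=> // | left].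
  exists u, w; split=> //; split; rewrite ?uf ?wf //; [exact: P_fu F | exact: P_fw F | by exists S].
exists u, w; split=> //.
  have fu a : adj u a -> dg a <> 1 -> a = x.
    rewrite -(adj_notin _ uf) => ua da; apply/eqP; apply: contra_notT da => ax.
    have aS := cl _ _ ua uS.
    have au : a != u by rewrite eq_sym; apply: adj_neq ua.
    have i2 : i <= 2 by nlia.
    have /andP[_ /eqP h] := P_su F i2 aS au.
    by rewrite -dn //; apply: contraTneq aS => ->.
  by move=> a b /fu h /fu h' /h -> /h' ->.
have fw a : adj w a -> dg a <> 1 -> a = y.
  rewrite -(adj_notin _ wf) => wa da; apply/eqP; apply: contra_notT da => ay.
  have aS : a \notin S by apply: contraNN wS => aS; apply: cl aS; rewrite adj_sym.
  have aw : a != w by rewrite eq_sym; apply: adj_neq wa.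
  have i2 : p <= i.+2 by nlia.
  have /andP[_ /eqP h] := P_sw F i2 aS aw.
  by rewrite -dn //; apply: contraNneq aS => ->.
by move=> a b /fw h /fw h' /h -> /h' ->.
Qed.

(** Restoring [qz] adds only the leaf [q], and it could make [z] a new non-leaf only if [z] had
    degree 1 before. *)
Lemma full_pendant (H : sgraph) (q z a : H) : adj q z -> dg q = 1 -> dg z <> 2 -> a != q ->
  @full (del_edge [set q; z]) a -> full a.
Proof.
move=> qz dq dz aq fa.
suff h b : adj a b -> dg b <> 1 ->
    @adj (del_edge [set q; z]) a b /\ @dg (del_edge [set q; z]) b <> 1.
  by move=> b c /h h1 /h h2 /h1[h11 h12] /h2[h21 h22]; apply: fa.
move=> ab db; have bq : b != q by apply: contra_notN db => /eqP ->.
split.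
  rewrite adj_del ab /=; apply/eqP => E.
  by case: (set2_inj E) => -[E1 E2]; [move: aq | move: bq]; rewrite ?E1 ?E2 eqxx.
have := dg_del b qz; rewrite !inE (negPf bq) /=.
by case: eqP => [->|_]; nlia.
Qed.

(** The other end [z] of the pendant edge has degree [m] in [H - f]. If it is [u] or [w], [H] is
    broomlike; otherwise its degree is at most 2, so [m = 2] and it becomes a new vertex of degree
    3. *)
Lemma leaf_mate_pendant m n p (H : sgraph) (f : {set H}) : 1 < m -> 1 < n -> conn H -> leaf_mate m n p f ->
  broomlike m n H \/ m = 2 /\ exists c c' q : H, pen_kind f c c' q /\ dg c' = n.+1.
Proof.
move=> m1 n1 cH /(leaf_mate_conn cH)[z [q [u [w [Ef qz d dq F]]]]].
have fE : f \in edges H by apply/edgesP; exists q, z.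
have zf : z \in f by rewrite Ef set22.
have dz := dg_in fE zf; rewrite d in dz.
have du := L_du F; have dw := L_dw F; have qu := L_qu F; have qw := L_qw F.
have nf a : a != q -> a != z -> a \notin f by move=> h1 h2; rewrite Ef !inE negb_or h1.
have zq : z != q by rewrite eq_sym (adj_neq qz).
have small a : a != u -> a != w -> a != z -> dg a <= 2.
  move=> au aw az; case: (eqVneq a q) => [->|aq]; first by rewrite dq.
  by have := L_dz F aq au aw; rewrite (dg_notin fE (nf _ aq az)); nlia.
have lift a : a != q -> @full (del_edge f) a -> full a.
  by rewrite Ef; apply: full_pendant => //; nlia.
have Fu : full u by apply: lift (L_fu F); rewrite eq_sym.
have Fw : full w by apply: lift (L_fw F); rewrite eq_sym.
have nf' a : q != a -> a != z -> dg a = @dg (del_edge f) a.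
  by move=> aq az; rewrite dg_notin // nf // eq_sym.
case: (eqVneq z u) => zu.
  left; exists u, w; have wz : w != z by rewrite zu eq_sym (L_uw F).
  have [h1 h2] : dg u = m.+1 /\ dg w = n.+1 by rewrite -{1}zu dz nf' // dw.
  split=> //; split; rewrite ?h1 ?h2 //; first exact: L_uw F.
  by move=> a au aw; apply: small; rewrite // zu.
have uz : u != z by rewrite eq_sym.
have hu : dg u = m by rewrite nf'.
case: (eqVneq z w) => zw.
  have mn : m = n.+1 by rewrite -d zw dw.
  left; exists w, u; have h1 : dg w = m.+1 by rewrite -zw.
  split; rewrite ?hu //; split; rewrite ?h1 ?hu //; first by rewrite eq_sym (L_uw F).
    by rewrite mn.
  by move=> a aw au; apply: small; rewrite // zw.
have m2 : m = 2 by have := L_dz F zq zu zw; nlia.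
right; split=> //; exists z, w, q.
have hw : dg w = n.+1 by rewrite nf' // eq_sym.
split=> //; split=> //; [|by rewrite adj_sym | by split; nlia].
split; rewrite ?dz ?hw //; try nlia.
move=> a az aw; case: (eqVneq a u) => [->|au]; first by nlia.
exact: small.
Qed.

Lemma bigs_uniq (H : sgraph) (c c' d d' : H) : bigs c c' -> bigs d d' ->
  (d = c /\ d' = c') \/ (d = c' /\ d' = c).
Proof.
move=> [cc _ _ cz] [dd d3 d3' _].
have h z : 2 < dg z -> z = c \/ z = c'.
  move=> z3; case: (eqVneq z c) => [|zc]; first by left.
  case: (eqVneq z c') => [|zc']; first by right.
  by have := leq_trans z3 (cz _ zc zc').
by case: (h _ d3) (h _ d3') dd => -> [] ->; rewrite ?eqxx //; auto.
Qed.

Lemma dg3_eq (G : sgraph) (z a b c d : G) : dg z = 3 -> adj z a -> adj z b -> adj z c -> adj z d ->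
  a != b -> a != c -> b != c -> [|| d == a, d == b | d == c].
Proof.
move=> dz za zb zc zd ab ac bc; apply: contraT; rewrite !negb_or => /and3P[da db dc].
have : #|[set a; b; c; d]| <= 3.
  rewrite -dz; apply/subset_leq_card/subsetP => y; rewrite !inE.
  by case/orP => [/orP[/orP[]|]|] /eqP ->.
rewrite (setUC _ [set d]) cardsU1 !inE !negb_or da db dc /=.
by rewrite (setUC _ [set c]) cardsU1 !inE !negb_or (eq_sym c a) (eq_sym c b) ac bc /= cards2 ab.
Qed.

(* If f' = {x', y'} separated u from the other end as well, the complement of both sides would be
   closed in H. *)
Lemma separating_edge_uniq (H : sgraph) (u w x y x' y' : H) (S S' : {set H}) : conn H ->
  adj u x -> adj u x' -> u \notin [set x; y] -> u \notin [set x'; y'] ->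
  @adj_closed (del_edge [set x; y]) S -> @adj_closed (del_edge [set x'; y']) S' ->
  u \in S -> u \in S' -> w \notin S -> w \notin S' -> [set x; y] = [set x'; y'].
Proof.
move=> cH ux ux' uf uf' cS cS' uS uS' wS wS'.
apply/eqP; apply: contraT => ff'.
have sub (f Z : {set H}) a b : @adj_closed (del_edge f) Z -> adj a b -> a \in Z -> b \notin Z ->
    [set a; b] = f.
  move=> cZ ab aZ bZ; apply/eqP; apply: contraT => E.
  by rewrite (cZ a b) // in bZ; rewrite adj_del ab.
have xS' : x \in S'.
  by apply: contraT => h; have E := sub _ _ _ _ cS' ux uS' h; rewrite -E set21 in uf'.
have xS : x \in S.
  by apply: contraT => h; have E := sub _ _ _ _ cS ux uS h; rewrite -E set21 in uf.
have x'S' : x' \in S'.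
  by apply: contraT => h; have E := sub _ _ _ _ cS' ux' uS' h; rewrite -E set21 in uf'.
have x'S : x' \in S.
  by apply: contraT => h; have E := sub _ _ _ _ cS ux' uS h; rewrite -E set21 in uf.
have cl : adj_closed (~: S :&: ~: S').
  move=> a b ab; rewrite !inE => /andP[aS aS']; apply/andP; split; apply/negP => h.
    have ba : adj b a by rewrite adj_sym.
    have E := sub _ _ _ _ cS ba h aS.
    have bx : b = x by case: (set2_inj E) => -[E1 E2] //; rewrite E2 xS in aS.
    have bS' : b \in S' by rewrite bx.
    have E' := sub _ _ _ _ cS' ba bS' aS'.
    by move/eqP: ff'; case; rewrite -E E'.
  have ba : adj b a by rewrite adj_sym.
  have E := sub _ _ _ _ cS' ba h aS'.
  have bx : b = x' by case: (set2_inj E) => -[E1 E2] //; rewrite E2 x'S' in aS'.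
  have bS : b \in S by rewrite bx.
  have E' := sub _ _ _ _ cS ba bS aS.
  by move/eqP: ff'; case; rewrite -E -E'.
by have := cH _ cl w u; rewrite !inE wS wS' uS => /(_ isT).
Qed.

Lemma not_full (H : sgraph) (c : H) : ~ full c -> exists a b,
  [/\ adj c a, adj c b, dg a <> 1, dg b <> 1 & a <> b].
Proof.
move=> nf; apply: boolp.contrapT => h; apply: nf => a b ca cb da db.
by apply: boolp.contrapT => ab; apply: h; exists a, b.
Qed.

(** Deleting [f] must turn [a] or [b] into a leaf, for otherwise [u] keeps two non-leaf
    neighbours. *)
Lemma touch (H : sgraph) (f : {set H}) (u a b : H) : f \in edges H -> u \notin f ->
  @full (del_edge f) u -> adj u a -> adj u b -> dg a <> 1 -> dg b <> 1 -> a <> b ->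
  exists x y, [/\ f = [set x; y], adj x y, adj u x, dg x = 2 & x = a \/ x = b].
Proof.
move=> fE uf fu ua mates_bound da db ab.
have h z : adj u z -> dg z <> 1 -> @dg (del_edge f) z = 1 -> exists x y,
    [/\ f = [set x; y], adj x y, adj u x, dg x = 2 & x = z].
  move=> uz dz d1; have zf : z \in f by apply: contra_notT dz => zf; rewrite -(dg_notin fE zf).
  have d2 : dg z = 2 by rewrite (dg_in fE zf) d1.
  case/edgesP: (fE) zf => x [y [xy ->]] /set2P[] E; subst z; first by exists x, y.
  by exists y, x; rewrite setUC adj_sym.
case: (eqVneq (@dg (del_edge f) a) 1) => [d1|/eqP d1].
  by have [x [y [? ? ? ? ?]]] := h _ ua da d1; exists x, y; split=> //; left.
case: (eqVneq (@dg (del_edge f) b) 1) => [d2|/eqP d2].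
  by have [x [y [? ? ? ? ?]]] := h _ mates_bound db d2; exists x, y; split=> //; right.
by case: ab; apply: fu; rewrite ?adj_notin.
Qed.

(** * Which kinds of mates coexist in a connected graph *)

Section Combine.
Variable H : sgraph.
Hypothesis cH : conn H.
Hypothesis ng : forall c c' : H, bigs c c' -> full c -> full c' -> False.

Lemma deficient (c c' : H) : bigs c c' -> exists u w : H, bigs u w /\ exists a b : H,
  [/\ adj u a, adj u b, dg a <> 1, dg b <> 1 & a <> b].
Proof.
move=> B; case: (boolp.pselect (full c)) => [fc|/not_full nf]; last by exists c, c'.
exists c', c; split; first exact: bigsC.
by apply: not_full => fc'; apply: (ng B).
Qed.

Lemma mid_kind_swap (f : {set H}) (c c' d d' : H) : mid_kind f c c' -> bigs d d' -> mid_kind f d d'.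
Proof.
move=> K Bd; have [B [cf c'f] fc fc' sp] := K.
case: (bigs_uniq B Bd) => -[-> ->] //; split=> //; [exact: bigsC | exact: separatesC].
Qed.

(** Both edges must repair the same non-full end, and both separate it from the other end, so
    [separating_edge_uniq] applies. *)
Lemma mid_mid (f f' : {set H}) (c c' d d' : H) : f \in edges H -> f' \in edges H ->
  mid_kind f c c' -> mid_kind f' d d' -> f = f'.
Proof.
move=> fE fE' K K'; have [B _ _ _ _] := K.
have [u [w [Bu [a [b [ua mates_bound da db ab]]]]]] := deficient B.
have {}K := mid_kind_swap K Bu; have {}K' := mid_kind_swap K' Bu.
have [_ [uf _] fu _ [S [cS uS wS]]] := K.
have [_ [uf' _] fu' _ [S' [cS' uS' wS']]] := K'.
have [x [y [Ef xy ux dx _]]] := touch fE uf fu ua mates_bound da db ab.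
have [x' [y' [Ef' xy' ux' dx' _]]] := touch fE' uf' fu' ua mates_bound da db ab.
subst f f'; exact: (separating_edge_uniq cH ux ux' uf uf' cS cS' uS uS' wS wS').
Qed.

(** A mate avoiding both large vertices leaves the route through their common neighbour [z] intact,
    and thus cannot separate them. *)
Lemma mid_com (f f' : {set H}) (c c' d d' z : H) : mid_kind f c c' -> com_kind f' d d' z -> False.
Proof.
move=> K [B _ cz [c'z dz] _]; have [_ [cf c'f] _ _ [S [cS cin c'out]]] := mid_kind_swap K B.
have zS : z \in S by apply: cS cin; rewrite adj_notin.
by move/negP: c'out; apply; apply: cS zS; rewrite adj_sym adj_notin.
Qed.

Lemma com_com (f f' : {set H}) (c c' d d' z z' : H) :
  com_kind f c c' z -> com_kind f' d d' z' -> z = z'.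
Proof.
move=> [B Ef cz [c'z dz] [S [cS cin c'out]]] [B' _ dz' [d'z' _] _].
have [cz' c'z'] : adj c z' /\ adj c' z'.
  by case: (bigs_uniq B B') => -[E1 E2]; subst d d'.
apply/eqP; apply: contraT => zz'.
have cc' : c != c' by case: B.
have h1 : z' \in S.
  apply: cS cin; rewrite adj_del cz' /= Ef; apply/eqP => /set2_inj[[_ E]|[_ E]].
    by rewrite E eqxx in zz'.
  by move: cz'; rewrite E adj_irrefl.
move/negP: c'out; case; apply: cS h1; rewrite adj_del adj_sym c'z' /= Ef.
apply/eqP => /set2_inj[[E1 E2]|[E1 E2]]; first by move: cz'; rewrite E1 adj_irrefl.
by rewrite E2 eqxx in cc'.
Qed.

(** As [c'] is full, [c] is not: two of its three neighbours are non-leaves, which leaves room for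
    one leaf. *)
Lemma pen_full (f : {set H}) (c c' q a : H) : pen_kind f c c' q -> adj c a -> dg a = 1 -> a = q.
Proof.
move=> [B Ef cq [dq dc] fc'] ca da; apply/eqP; apply: contraT => aq.
case: (ng B _ fc') => x y cx cy dx dy.
have xq : x != q by apply: contra_notN dx => /eqP ->.
have xa : x != a by apply: contra_notN dx => /eqP ->.
have yq : y != q by apply: contra_notN dy => /eqP ->.
have ya : y != a by apply: contra_notN dy => /eqP ->.
have := dg3_eq dc ca cq cx cy aq; rewrite eq_sym xa (negPf yq) (negPf ya) eq_sym xq.
by move=> /(_ isT isT)/eqP.
Qed.

Lemma pen_pen (f f' : {set H}) (c c' q d d' q' : H) : pen_kind f c c' q -> pen_kind f' d d' q' -> f = f'.
Proof.
move=> K K'; have [B Ef cq [dq dc] fc'] := K; have [B' Ef' dq' [ddq' dd] fd'] := K'.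
case: (bigs_uniq B B') => -[E1 E2]; subst d d'; last by case: (ng B).
by rewrite Ef Ef' (pen_full K dq' ddq').
Qed.

Lemma pen_com (f f' : {set H}) (c c' q d d' z : H) : pen_kind f c c' q -> com_kind f' d d' z ->
  full d -> d = c' /\ d' = c.
Proof.
move=> [B _ _ _ fc'] [B' _ _ _ _] fd.
by case: (bigs_uniq B B') => -[E1 E2]; subst d d' => //; case: (ng B).
Qed.

Lemma pen_com' (f f' : {set H}) (c c' q d d' z : H) : pen_kind f c c' q -> com_kind f' d d' z ->
  full d' -> dg d = (dg d').+1 -> False.
Proof.
move=> [B _ _ [_ dc] fc'] [B' _ _ _ _] fd'.
case: (bigs_uniq B B') => -[E1 E2] dd; subst d d'; last by case: (ng B).
by have [_ _ h _] := B; nlia.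
Qed.

Lemma pen_com_com (f f' f'' : {set H}) (c c' q d d' z e e' y : H) : pen_kind f c c' q ->
  com_kind f' d d' z -> full d -> com_kind f'' e e' y -> full e -> f' = f''.
Proof.
move=> K K' fd K'' fe; have [E1 E2] := pen_com K K' fd; have [E3 E4] := pen_com K K'' fe.
by have E := com_com K' K''; have [_ -> _ _ _] := K'; have [_ -> _ _ _] := K''; rewrite E E1 E3.
Qed.

(** Were the leg to hang from the full vertex [c'], then [c'], its leaves and the leg would form a
    closed set missing [c]. *)
Lemma pen_leg (f f' : {set H}) (c c' q d d' x : H) (S : {set H}) : pen_kind f c c' q ->
  leg_kind f' d d' x S -> d = c /\ d' = c'.
Proof.
move=> [B _ _ [_ dc] fc'] [B' _ dx [dgx _] [_ xS dS d'S bS]].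
case: (bigs_uniq B B') => -[E1 E2] //; subst d d'; exfalso.
have cl : adj_closed (S :|: [set c'] :|: [set l | adj c' l & dg l == 1]).
  move=> a b ab; rewrite !inE => /orP[/orP[aS|/eqP E]|/andP[c'a /eqP da]].
  - case: (boolP (b \in S)) => //= nbS; by have [_ ->] := bS _ _ ab aS nbS; rewrite eqxx ?orbT.
  - subst a; rewrite ab; case: (eqVneq (dg b) 1) => /= [|/eqP db]; first by rewrite !orbT.
    by rewrite (fc' _ _ ab dx db) ?xS // dgx.
  - by rewrite (dg1_eq da ab (_ : adj a c')) ?eqxx ?orbT // adj_sym.
have := cH cl (a := c') c; rewrite !inE eqxx orbT dc andbF orbF (negPf d'S) => /(_ isT) /=.
by have [/negPf -> _ _ _] := B.
Qed.

(** Two legs and the leaf [q] would use up the three neighbours of [c], cutting [c] off from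
    [c']. *)
Lemma pen_leg_leg (f f' f'' : {set H}) (c c' q d d' x e e' y : H) (S T : {set H}) :
  pen_kind f c c' q -> leg_kind f' d d' x S -> leg_kind f'' e e' y T -> f' = f''.
Proof.
move=> K K' K''; have [E1 E2] := pen_leg K K'; have [E3 E4] := pen_leg K K''; subst d d' e e'.
have [B _ cq [dq dc] _] := K.
have [_ -> cx [dx _] [_ xS cS c'S bS]] := K'; have [_ -> cy [dy _] [_ yT cT c'T bT]] := K''.
apply/eqP; apply: contraT => xy; have {}xy : x != y by apply: contraNneq xy => ->.
have qx : q != x by apply: contraPneq dq => ->; rewrite dx.
have qy : q != y by apply: contraPneq dq => ->; rewrite dy.
have cl : adj_closed (S :|: T :|: [set c; q]).
  move=> a b ab; rewrite !inE => /orP[/orP[aS|aT]|/orP[/eqP E|/eqP E]].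
  - case: (boolP (b \in S)) => //= nbS; by have [_ ->] := bS _ _ ab aS nbS; rewrite eqxx !orbT.
  - case: (boolP (b \in T)) => [|nbT]; first by rewrite orbT.
    by have [_ ->] := bT _ _ ab aT nbT; rewrite eqxx !orbT.
  - subst a; have /or3P[] := dg3_eq dc cq cx cy ab qx qy xy => /eqP ->.
    + by rewrite eqxx !orbT.
    + by rewrite xS.
    + by rewrite yT orbT.
  - by subst a; rewrite (dg1_eq dq ab (_ : adj q c)) ?eqxx ?orbT // adj_sym.
have := cH cl (a := c) c'; rewrite !inE eqxx !orbT (negPf c'S) (negPf c'T) => /(_ isT) /=.
have [cc' _ d3 _] := B; rewrite eq_sym (negPf cc') /= => /eqP E.
by move: d3; rewrite E dq.
Qed.

(** Counts distinct vertices: [c'], [z], [c], [q], the [dg c' - 1] leaves of [c'] and the three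
    vertices of the leg. For [p <= 4] the graph is too small for this. *)
Lemma pen_com_leg (f f' f'' : {set H}) (c c' q d d' z e e' x : H) (S : {set H}) :
  pen_kind f c c' q -> com_kind f' d d' z -> full d -> leg_kind f'' e e' x S -> dg c' + 6 <= #|H|.
Proof.
move=> K K' fd K''; have [E1 E2] := pen_com K K' fd; have [E3 E4] := pen_leg K K''; subst d d' e e'.
have [[cc' _ c'3 _] _ cq [dq dc] fc'] := K; have [_ _ c'z [cz dz] _] := K'.
have [_ _ cx [dx _] [cS xS ncS nc'S bS]] := K''.
have dc' : dg c' = (dg c').-1.+1 by nlia.
have hr : {in [:: z], forall y : H, dg y <> 1} by move=> y; rewrite inE => /eqP ->; rewrite dz.
have [cL lL] := full_leaves (mem_head z [::]) c'z hr fc' dc'.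
set L := [set _ | _ & _] in cL.
have LP y : y \in L -> adj c' y /\ dg y = 1.
  by rewrite inE => /andP[h1 h2]; split=> //; apply: lL.
have ne (a b : H) : dg a != dg b -> a != b by apply: contraNneq => ->.
have qc' : ~~ adj c' q.
  apply/negP => h; move/negP: cc'; case; apply/eqP.
  by apply: (dg1_eq dq); rewrite adj_sym.
have zS : z \notin S.
  apply/negP => h; have zc' : adj z c' by rewrite adj_sym.
  by move/eqP: cc'; case; have [_ ->] := bS _ _ zc' h nc'S.
have qS : q \notin S.
  apply/negP => h; have qc : adj q c by rewrite adj_sym.
  by have [E _] := bS _ _ qc h ncS; move: dx; rewrite -E dq.
have u : uniq ([:: c'; z; c; q] ++ enum L ++ enum S).
  rewrite cat_uniq cat_uniq !enum_uniq andbT /= !inE !negb_or.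
  rewrite (eq_sym c' c) cc' (ne c' z) ?(ne c' q) ?(ne z c) ?(ne z q) ?(ne c q) ?dz ?dc ?dq //=; try nlia.
  apply/andP; split; apply/hasPn => y; rewrite ?mem_cat !mem_enum.
    case/orP => [/LP[h1 h2]|yS].
      rewrite !inE !negb_or; apply/and4P; split; try by apply: ne; rewrite h2 ?dz ?dc; nlia.
      by apply: contraNneq qc' => <-.
    by rewrite !inE !negb_or; apply/and4P; split; apply: contraTneq yS => ->.
  move=> yS; apply/negP => /LP[h1 h2]; move/eqP: cc'; case.
  have yc' : adj y c' by rewrite adj_sym.
  by have [_ ->] := bS _ _ yc' yS nc'S.
have E : size ([:: c'; z; c; q] ++ enum L ++ enum S) = dg c' + 6.
  by rewrite !size_cat -!cardE cL cS /=; nlia.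
rewrite -E -(card_uniqP u); exact: max_card.
Qed.

End Combine.

Definition not_broomlike (H : sgraph) : Prop :=
  forall c c' : H, bigs c c' -> full c -> full c' -> False.

(** * Counting mates in a connected graph when both leaf numbers exceed 1 *)

Section Tree.
Variables (m n p : nat) (H : sgraph).
Hypotheses (m1 : 1 < m) (n1 : 1 < n) (p2 : 2 <= p) (cH : conn H).
Hypothesis niso : ~ graph_iso H (B m n p).

(** The position of [e] is remembered because mates of the two end edges of the path are told apart
    by [e] rather than by [f]. *)
Inductive tree_kind (e : {set B m n p}) (f : {set H}) : Prop :=
| Tmid i c c' of path_edge i e & 1 < i < p & 4 < p & mid_kind f c c'
| Tend1 of path_edge 1 e & 3 < p & end_kind m n f
| Tend2 of path_edge p.-1 e & 3 < p & end_kind n m f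
| Tpen c c' q of m = 2 /\ dg c' = n.+1 \/ n = 2 /\ dg c' = m.+1 & pen_kind f c c' q.

Lemma mate_not_broomlike (e : {set B m n p}) (f : {set H}) : mate e f -> ~ broomlike m n H /\ ~ broomlike n m H.
Proof.
move=> M; have m0 : 0 < m by nlia. have n0 : 0 < n by nlia.
have cd := mate_card M; rewrite card_ord in cd; have sm := mate_sum M.
split=> -[c [c' [[cc _ _ dz] dc dc' fc fc']]]; apply: niso.
  by apply: (@broom_of_full _ _ _ _ c c'); rewrite ?sm.
by apply: (@broom_of_full _ _ _ _ c' c); rewrite // ?sm // 1?eq_sym // => z h1 h2; apply: dz.
Qed.

Lemma not_broomlike_of (e : {set B m n p}) (f : {set H}) (c c' : H) : mate e f -> bigs c c' ->
  dg c = m.+1 /\ dg c' = n.+1 \/ dg c = n.+1 /\ dg c' = m.+1 -> not_broomlike H.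
Proof.
move=> M Bc dd d d' Bd fd fd'; have [ng1 ng2] := mate_not_broomlike M.
case: (bigs_uniq Bc Bd) => -[E1 E2]; subst d d'.
  by case: dd => -[h1 h2]; [apply: ng1; exists c, c' | apply: ng2; exists c, c'].
by case: dd => -[h1 h2]; [apply: ng2; exists c', c | apply: ng1; exists c', c].
Qed.

Lemma end_kind_bigs a b (f : {set H}) : end_kind a b f ->
  exists c c' : H, [/\ bigs c c', dg c = a.+1 & dg c' = b.+1].
Proof.
case=> [[c [c' [z [[h _ _ _ _] _ h1 h2]]]]|[[c [c' [z [[h _ _ _ _] _ h1 h2 _]]]]|]].
- by exists c, c'.
- by exists c, c'.
by move=> [c [c' [x [S [[h _ _ [_ h1] _] -> h2]]]]]; exists c, c'.
Qed.

Lemma tree_mate_kind (e : {set B m n p}) (f : {set H}) : mate e f -> tree_kind e f /\ not_broomlike H.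
Proof.
move=> M; have m0 : 0 < m by nlia. have n0 : 0 < n by nlia.
have [ng1 ng2] := mate_not_broomlike M; have cd := mate_card M; rewrite card_ord in cd.
case: (mate_cases m0 n0 p2 M) => [[_ L]|[[_ L]|[i [ip iP PMi]]]].
- case: (leaf_mate_pendant m1 n1 cH L) => [//|[m2 [c [c' [q [K dc']]]]]].
  split; first by apply: (@Tpen _ _ c c' q) => //; left.
  by have [Bc _ _ [_ dc] _] := K; apply: (not_broomlike_of M Bc); left; rewrite dc m2.
- case: (leaf_mate_pendant n1 m1 cH L) => [//|[m2 [c [c' [q [K dc']]]]]].
  split; first by apply: (@Tpen _ _ c c' q) => //; right.
  by have [Bc _ _ [_ dc] _] := K; apply: (not_broomlike_of M Bc); right; rewrite dc m2.
case: (ltngtP 1 i) => i1; last 2 first.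
- by exfalso; move: ip; nlia.
- subst i; case: (path_mate_end m1 n1 p2 cH PMi) => [//|[p3 K]].
  split; first exact: Tend1.
  by have [c [c' [Bc h1 h2]]] := end_kind_bigs K; apply: (not_broomlike_of M Bc); left.
case: (ltnP i.+1 p) => ip'; last first.
  have Ei : i = p.-1 by move: ip; nlia.
  have := path_mate_mirror ip (esym cd) PMi; rewrite (_ : p - i = 1); last by nlia.
  move=> /(path_mate_end n1 m1 p2 cH) [//|[p3 K]].
  split; first by apply: Tend2; rewrite -?Ei.
  by have [c [c' [Bc h1 h2]]] := end_kind_bigs K; apply: (not_broomlike_of M Bc); right.
case: (path_mate_mid m1 n1 i1 ip' cH PMi) => [//|[p4 [c [c' [K h1 h2]]]]].
split; first by apply: (@Tmid _ _ i c c'); rewrite // i1; case/andP: ip.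
by have [Bc _ _ _ _] := K; apply: (not_broomlike_of M Bc); left.
Qed.

Variables (k : nat) (e : 'I_k -> {set B m n p}) (f : 'I_k -> {set H}).
Hypotheses (ei : injective e) (fi : injective f) (M : forall j, mate (e j) (f j)).

Let fE j : f j \in edges H. Proof. by case: (M j). Qed.

Lemma end_kind_cases a b (g : {set H}) : end_kind a b g ->
  (exists c c' z : H, com_kind g c c' z /\ (full c \/ full c' /\ dg c = (dg c').+1)) \/
  (exists (c c' x : H) (S : {set H}), leg_kind g c c' x S /\ a = 2).
Proof.
case=> [[c [c' [z [h h1 _ _]]]]|[[c [c' [z [h h1 h2 h3 h4]]]]|[c [c' [x [S [h h1 _]]]]]]].
- by left; exists c, c', z; split=> //; left.
- by left; exists c, c', z; split=> //; right; rewrite h2 h3 h4.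
- by right; exists c, c', x, S.
Qed.

(** Legs and pendant mates need [m = 2] or [n = 2]. A [mid_kind] mate excludes all others; without
    one, every mate joins one of the two large vertices to their one common neighbour. *)
Lemma tree_mates_le2 : 2 < m -> 2 < n -> k <= 2.
Proof.
move=> m3 n3; rewrite leqNgt; apply/negP => k3.
have K j : (exists c c', mid_kind (f j) c c') \/ (exists c c' z, com_kind (f j) c c' z).
  have [[i c c' _ _ _ h|_ _ /end_kind_cases h|_ _ /end_kind_cases h|c c' q h _] _] := tree_mate_kind (M j).
  - by left; exists c, c'.
  - case: h => [[c [c' [z [h _]]]]|[c [c' [x [S [_ h]]]]]]; last by nlia.
    by right; exists c, c', z.
  - case: h => [[c [c' [z [h _]]]]|[c [c' [x [S [_ h]]]]]]; last by nlia.
    by right; exists c, c', z.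
  - by case: h; nlia.
have [_ ng] := tree_mate_kind (M (Ordinal k3)).
have [i [j [l [ij il jl]]]] := leq3_cases k3.
have nomid a b : a <> b -> ~ exists c c', mid_kind (f a) c c'.
  move=> ab [c [c' Ka]]; case: (K b) => [[d [d' Kb]]|[d [d' [z Kb]]]].
    by apply: ab; apply: fi; apply: (mid_mid cH ng (fE a) (fE b) Ka Kb).
  exact: (mid_com Ka Kb).
case: (K i) => [|[c [c' [z Ki]]]]; first exact: nomid ij.
case: (K j) => [|[d [d' [y Kj]]]]; first by apply: (nomid j i) => /esym.
case: (K l) => [|[b [b' [x Kl]]]]; first by apply: (nomid l i) => /esym.
have Ey := com_com Ki Kj; have Ex := com_com Ki Kl; subst y x.
have [Bi Ei _ _ _] := Ki; have [Bj Ej _ _ _] := Kj; have [Bl El _ _ _] := Kl.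
case: (bigs_uniq Bi Bj) => -[E1 _]; first by apply: ij; apply: fi; rewrite Ei Ej E1.
case: (bigs_uniq Bi Bl) => -[E2 _]; first by apply: il; apply: fi; rewrite Ei El E2.
by apply: jl; apply: fi; rewrite Ej El E1 E2.
Qed.

(** Without the case [a = b + 1], each [com_kind] mate sits at a full large vertex; two of them
    would make both full. *)
Lemma tree_mates_le1 : 2 < m -> 2 < n -> m <> n.+1 -> n <> m.+1 -> k <= 1.
Proof.
move=> m3 n3 mn nm; rewrite leqNgt; apply/negP => k2.
pose arm_kind j := exists c c', mid_kind (f j) c c'.
pose K2 j := exists c c' z, [/\ com_kind (f j) c c' z, full c & path_edge 1 (e j) /\ dg c = m.+1 \/
  path_edge p.-1 (e j) /\ dg c = n.+1].
have K j : arm_kind j \/ K2 j.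
  have [[i c c' _ _ _ h|h1 _ h|h1 _ h|c c' q h _] _] := tree_mate_kind (M j).
  - by left; exists c, c'.
  - case: h => [[c [c' [z [h h2 h3 _]]]]|[[? [? [? [_ _ _ _ h]]]]|[c [c' [x [S [_ h]]]]]]] //.
      by right; exists c, c', z; split=> //; left.
    by nlia.
  - case: h => [[c [c' [z [h h2 h3 _]]]]|[[? [? [? [_ _ _ _ h]]]]|[c [c' [x [S [_ h]]]]]]] //.
      by right; exists c, c', z; split=> //; right.
    by nlia.
  - by case: h; nlia.
have [_ ng] := tree_mate_kind (M (Ordinal k2)).
have k1 : 0 < k by nlia.
pose i := Ordinal k1; pose j := Ordinal k2.
have ij : i <> j by [].
case: (K i) (K j) => [[c [c' Ki]]|[c [c' [z [Ki fc hi]]]]] [[d [d' Kj]]|[d [d' [y [Kj fd hj]]]]].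
- by apply: ij; apply: fi; apply: (mid_mid cH ng (fE i) (fE j) Ki Kj).
- exact: (mid_com Ki Kj).
- exact: (mid_com Kj Ki).
have Ey := com_com Ki Kj; subst y.
have [Bi Ei _ _ _] := Ki; have [Bj Ej _ _ _] := Kj.
case: (bigs_uniq Bi Bj) => -[E1 E2]; subst d d'; first by apply: ij; apply: fi; rewrite Ei Ej.
exact: (ng _ _ Bi fc fd).
Qed.

(** Four classes: pendant, first path edge, last path edge, middle. The first three together require
    a [com_kind] mate, which excludes the middle class, and [p > 4] by [pen_com_leg]. *)
Lemma tree_mates_m2 : m = 2 -> k <= 3 /\ (p <= 4 -> k <= 2).
Proof.
move=> m2.
pose Ken j := [\/ (exists c c' z, com_kind (f j) c c' z /\ full c),
  (exists c c' z, [/\ com_kind (f j) c c' z, full c' & dg c = (dg c').+1]) |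
  exists c c' x S, leg_kind (f j) c c' x S].
have KK a b j : end_kind a b (f j) -> Ken j.
  case/end_kind_cases => [[c [c' [z [h [h1|[h1 h2]]]]]]|[c [c' [x [S [h _]]]]]].
  - by apply: Or31; exists c, c', z.
  - by apply: Or32; exists c, c', z.
  - by apply: Or33; exists c, c', x, S.
pose K (c : 'I_4) (j : 'I_k) := match val c with
  | 0 => exists c c' q, pen_kind (f j) c c' q /\ (m = 2 /\ dg c' = n.+1 \/ n = 2 /\ dg c' = m.+1)
  | 1 => path_edge 1 (e j) /\ Ken j
  | 2 => path_edge p.-1 (e j) /\ Ken j
  | _ => (exists c c', mid_kind (f j) c c') /\ 4 < p
  end.
case: (posnP k) => [->//|k0].
have [T0 ng] := tree_mate_kind (M (Ordinal k0)).
case: (leqP p 3) => p3.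
  suff k1 : k <= 1 by split=> [|_]; nlia.
  pose K' (c : 'I_1) (j : 'I_k) := exists c c' q, pen_kind (f j) c c' q.
  have [] := @pigeonhole k 1 K' _ _ => //.
    move=> j; exists ord0; have [[i c c' _ _ p4 _|_ p4 _|_ p4 _|c c' q _ h] _] := tree_mate_kind (M j);
    by [nlia | exists c, c', q].
  move=> _ i j [c [c' [q Ki]]] [d [d' [q' Kj]]]; apply: fi.
  exact: (pen_pen ng Ki Kj).
have cls j : exists c, K c j.
  have [[i c c' _ _ p4 h|h1 _ /KK h|h1 _ /KK h|c c' q hd h] _] := tree_mate_kind (M j).
  - by exists (Ordinal (isT : 3 < 4)); split=> //; exists c, c'.
  - by exists (Ordinal (isT : 1 < 4)).
  - by exists (Ordinal (isT : 2 < 4)).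
  - by exists (Ordinal (isT : 0 < 4)); exists c, c', q.
have inj c i j : K c i -> K c j -> i = j.
  case: c => -[|[|[|[]]]] // h; rewrite /K /=.
  - move=> [c [c' [q [Ki _]]]] [d [d' [q' [Kj _]]]]; apply: fi; exact: (pen_pen ng Ki Kj).
  - by move=> [h1 _] [h2 _]; apply: ei; apply: path_edge_inj h1 h2.
  - by move=> [h1 _] [h2 _]; apply: ei; apply: path_edge_inj h1 h2.
  - move=> [[c [c' Ki]] _] [[d [d' Kj]] _]; apply: fi; exact: (mid_mid cH ng (fE i) (fE j) Ki Kj).
have cd := mate_card (M (Ordinal k0)); rewrite card_ord in cd.
have trip i j l c c' q : j <> l -> pen_kind (f i) c c' q -> Ken j -> Ken l ->
    dg c' + 6 <= #|H| /\ exists b d d' z, com_kind (f b) d d' z.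
  move=> jl Ki Kj Kl; case: Kj Kl.
  - move=> [d [d' [z [Kj fd]]]]; case.
    + move=> [b [b' [y [Kl fb]]]]; case: jl; apply: fi.
      exact: (pen_com_com ng Ki Kj fd Kl fb).
    + move=> [b [b' [y [Kl fb E]]]]; case: (pen_com' ng Ki Kl fb E).
    + move=> [b [b' [x [S Kl]]]]; split; last by exists j, d, d', z.
      exact: (pen_com_leg cH ng Ki Kj fd Kl).
  - by move=> [b [b' [y [Kl fb E]]]]; case: (pen_com' ng Ki Kl fb E).
  - move=> [d [d' [x [S Kj]]]]; case.
    + move=> [b [b' [y [Kl fb]]]]; split; last by exists l, b, b', y.
      exact: (pen_com_leg cH ng Ki Kl fb Kj).
    + move=> [b [b' [y [Kl fb E]]]]; case: (pen_com' ng Ki Kl fb E).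
    + move=> [b [b' [y [T Kl]]]]; case: jl; apply: fi.
      exact: (pen_leg_leg cH Ki Kj Kl).
have ends j l : path_edge 1 (e j) -> path_edge p.-1 (e l) -> j <> l.
  move=> [a [b [E1 a1 b1]]] [a' [b' [E2 a2 b2]]] jl; subst l.
  by case: (set2_inj (etrans (esym E1) E2)) => -[E3 E4]; subst a' b'; nlia.
split.
  have [k4 all4] := pigeonhole cls inj.
  rewrite leqNgt; apply/negP => k4'.
  have [i [c [c' [q [Ki _]]]]] := all4 k4' (Ordinal (isT : 0 < 4)).
  have [j [e1 Kj]] := all4 k4' (Ordinal (isT : 1 < 4)).
  have [l [e2 Kl]] := all4 k4' (Ordinal (isT : 2 < 4)).
  have [b [[d [d' Kb]] _]] := all4 k4' (Ordinal (isT : 3 < 4)).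
  have [_ [b' [x [x' [z Kb']]]]] := trip _ _ _ _ _ _ (ends _ _ e1 e2) Ki Kj Kl.
  exact: (mid_com Kb Kb').
move=> p4; pose K3 (c : 'I_3) := K (widen_ord (isT : 3 <= 4) c).
have cls3 j : exists c, K3 c j.
  have [[[|[|[|[|//]]]] h] Kj] := cls j; last by case: Kj => _; nlia.
  - by exists (Ordinal (isT : 0 < 3)).
  - by exists (Ordinal (isT : 1 < 3)).
  - by exists (Ordinal (isT : 2 < 3)).
have [k3 all3] := pigeonhole cls3 (fun c => inj _).
rewrite leqNgt; apply/negP => k3'.
have [i [c [c' [q [Ki hd]]]]] := all3 k3' (Ordinal (isT : 0 < 3)).
have [j [e1 Kj]] := all3 k3' (Ordinal (isT : 1 < 3)).
have [l [e2 Kl]] := all3 k3' (Ordinal (isT : 2 < 3)).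
have [h _] := trip _ _ _ _ _ _ (ends _ _ e1 e2) Ki Kj Kl.
by move: h; rewrite -cd; case: hd => -[h1 ->]; nlia.
Qed.
End Tree.

(** * Connected graphs, [m = 1] *)

Lemma conn_dg (H : sgraph) : conn H -> 1 < #|H| -> forall z : H, 0 < dg z.
Proof.
move=> cH H1 z; rewrite lt0n; apply/negP => /eqP d0.
have cl : adj_closed [set z].
  by move=> a b ab /set1P E; subst a; have := dg_gt0P ab; rewrite d0.
have : #|H| <= #|[set z]|.
  by apply/subset_leq_card/subsetP => b _; apply: (cH _ cl z b); rewrite inE.
by rewrite cards1; nlia.
Qed.

(** The degree sum gives exactly [n + 1] leaves. If all were neighbours of [c] they would be all of
    its neighbours, and [H] would be a star with [n + 2] vertices. *)
Lemma far_leaf n (H : sgraph) (c : H) : conn H -> 0 < n -> dg c = n.+1 ->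
  (forall z, z != c -> dg z <= 2) -> \sum_(x : H) dg x + 2 = 2 * #|H| -> n.+2 < #|H| ->
  exists l, [/\ dg l = 1, l != c & ~~ adj c l].
Proof.
move=> cH n0 dc dz sm big; apply: boolp.contrapT => no.
have H1 : 1 < #|H| by nlia.
have pos := conn_dg cH H1.
pose A := [set z : H | dg z == 1].
have cA : c \notin A by rewrite inE dc; nlia.
have AN : A \subset [set z | adj c z].
  apply/subsetP => z zA; move: (zA); rewrite !inE => /eqP d1; apply: contraT => nz.
  by case: no; exists z; split=> //; apply: contraNneq cA => <-.
have : \sum_(x : H) dg x + #|A| = 2 * #|H| + n.-1.
  rewrite -sum1_card [X in _ + X]big_mkcond -big_split /= (bigD1 c) //= (negPf cA) dc.
  rewrite (eq_bigr (fun => 2)) => [|z zc]; last by rewrite inE; have := pos z; have := dz z zc; case: eqP; nlia.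
  have cc : #|(fun i : H => i != c)| = #|H|.-1 by exact: (cardC1 c).
  by rewrite sum_nat_const cc; move: big; move: #|H| n0 => N; clear; lia.
move=> E; have cA' : #|A| = n.+1 by nlia.
have EA : A = [set z | adj c z].
  by apply/eqP; rewrite eqEcard AN cA' -/(dg c) dc leqnn.
have cl : adj_closed (c |: A).
  move=> a b ab; rewrite !in_setU1 => /orP[/eqP E1|aA].
    by subst a; rewrite EA inE ab orbT.
  have da : dg a = 1 by move: aA; rewrite /A inE => /eqP.
  move: aA; rewrite EA inE => ca.
  by rewrite (dg1_eq da ab (_ : adj a c)) ?eqxx // adj_sym.
have : #|H| <= #|c |: A|.
  by apply/subset_leq_card/subsetP => b _; apply: (cH _ cl c b); rewrite !inE eqxx.
by rewrite cardsU1 cA cA'; nlia.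
Qed.

(** For [m = 1] the other end of the broom has degree 2: it is the neighbour [u] of a leaf far from
    [c], full because that leaf is one of its two neighbours. *)
Lemma broom1_of_full n p (H : sgraph) (c : H) : 0 < n -> 1 < p -> conn H -> #|H| = p + 1 + n ->
  \sum_(x : H) dg x = \sum_(x : B 1 n p) dg x -> dg c = n.+1 -> full c ->
  (forall z, z != c -> dg z <= 2) -> graph_iso H (B 1 n p).
Proof.
move=> n0 p1 cH cd sm dc fc dz.
have H1 : 1 < #|H| by rewrite cd; nlia.
have pos := conn_dg cH H1.
have [l [dl lc ncl]] : exists l, [/\ dg l = 1, l != c & ~~ adj c l].
  apply: (@far_leaf n) => //; last by rewrite cd; nlia.
  by rewrite sm sum_B // cd; nlia.
have [u lu] : exists u, adj l u by apply: dg_gt0; rewrite dl.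
have uc : u != c by apply: contraNneq ncl => <-; rewrite adj_sym.
have ul : adj u l by rewrite adj_sym.
have du : dg u = 2.
  case: (ltngtP (dg u) 2) => //; last by have := dz _ uc; nlia.
  move=> d1; have {}d1 : dg u = 1 by have := pos u; nlia.
  have cl : adj_closed [set u; l].
    move=> a b ab /set2P[] E; subst a.
      by rewrite (dg1_eq d1 ab ul) set22.
    by rewrite (dg1_eq dl ab lu) set21.
  have := cH _ cl u c; rewrite set21 !inE eq_sym (negPf uc) eq_sym (negPf lc) => /(_ isT) //.
have fu : full u.
  move=> a b ua mates_bound da db.
  have al : a != l by apply: contra_notN da => /eqP ->.
  by case: (dg2_eq _ ul ua mates_bound _) => //; rewrite ?du 1?eq_sym // => E; case: db; rewrite E.
apply: (@broom_of_full 1 n p H u c) => //; first by rewrite sm.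
by move=> z _; exact: dz.
Qed.

(** The degree sum provides a leaf, and its neighbour plays the large vertex of [broom1_of_full]
    with [n = 1]. *)
Lemma path_of_conn p (H : sgraph) : 1 < p -> conn H -> #|H| = p + 1 + 1 ->
  \sum_(x : H) dg x = \sum_(x : B 1 1 p) dg x -> (forall z : H, dg z <= 2) ->
  graph_iso H (B 1 1 p).
Proof.
move=> p1 cH cd sm dz.
have H1 : 1 < #|H| by rewrite cd; nlia.
have pos := conn_dg cH H1.
have [l dl] : exists l : H, dg l = 1.
  apply: boolp.contrapT => no.
  have : \sum_(x : H) dg x = \sum_(x : H) 2.
    apply: eq_bigr => z _; case: (eqVneq (dg z) 1) => [h|]; first by case: no; exists z.
    by have := pos z; have := dz z; nlia.
  by rewrite sum_nat_const sm -/#|H| cd; have := @sum_B 1 1 p isT isT p1; nlia.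
have [u lu] : exists u, adj l u by apply: dg_gt0; rewrite dl.
have ul : adj u l by rewrite adj_sym.
have du : dg u = 2.
  case: (ltngtP (dg u) 2) => //; last by have := dz u; nlia.
  move=> d1; have {}d1 : dg u = 1 by have := pos u; nlia.
  have cl : adj_closed [set u; l].
    move=> a b ab /set2P[] E; subst a.
      by rewrite (dg1_eq d1 ab ul) set22.
    by rewrite (dg1_eq dl ab lu) set21.
  have : #|H| <= #|[set u; l]|.
    by apply/subset_leq_card/subsetP => b _; apply: (cH _ cl u b); rewrite set21.
  by rewrite cards2 cd; case: (u != l); nlia.
apply: (@broom1_of_full 1 p H u) => //.
move=> a b ua mates_bound da db.
have al : a != l by apply: contra_notN da => /eqP ->.
by case: (dg2_eq _ ul ua mates_bound _) => //; rewrite ?du 1?eq_sym // => E; case: db; rewrite E.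
Qed.

(** * Connected graphs with a single large vertex *)

Section Spider.
Variables (n p : nat) (H : sgraph).
Hypotheses (n1 : 1 < n) (p1 : 1 < p) (cH : conn H).
Hypothesis niso : ~ graph_iso H (B 1 n p).

Definition arm_kind (f : {set H}) (w : H) : Prop :=
  [/\ dg w = n.+1, w \notin f, @full (del_edge f) w & forall z, z != w -> dg z <= 2].

Definition spider_leg (f : {set H}) (b y : H) (T : {set H}) : Prop :=
  [/\ f = [set b; y], adj b y, dg b = 3 /\ dg y = 2, forall z, z != b -> dg z <= 2 &
   [/\ #|T| = 3, y \in T, b \notin T &
       forall a c, adj a c -> a \in T -> c \notin T -> a = y /\ c = b]].

Definition spider_pen (f : {set H}) (q z : H) : Prop :=
  [/\ f = [set q; z], adj q z, dg q = 1, dg z = 3 & forall a, a != z -> dg a <= 2].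

(** Either [f] avoids the large vertex [w] and makes it full, or [n = 2] and [f] is at the vertex of
    degree 3: a leaf edge, or the edge to a pendant path of three vertices. *)
Inductive spider_kind (e : {set B 1 n p}) (f : {set H}) : Prop :=
| Tk1_arm w of arm_kind f w & (e \in Ledges 1 n p /\ leaf_mate 1 n p f) \/
    exists i, [/\ 0 < i, i.+2 < p, path_edge i e & path_mate 1 n p i f]
| Tk1_pen q z of n = 2 & spider_pen f q z
| Tk1_leg b y T of n = 2 & 3 < p & path_edge p.-1 e & spider_leg f b y T.

Lemma spider_mate_kind (e : {set B 1 n p}) (f : {set H}) : mate e f -> 2 < p /\ spider_kind e f.
Proof.
move=> M; have n0 : 0 < n by nlia.
have cd := mate_card M; rewrite card_ord in cd; have sm := mate_sum M.
have iso (c : H) : dg c = n.+1 -> full c -> (forall z, z != c -> dg z <= 2) -> False.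
  by move=> dc fc dz; apply: niso; exact: (broom1_of_full n0 p1 cH (esym cd) (esym sm) dc fc dz).
have fE : f \in edges H by case: M.
case: (@mate_cases 1 n p H e f isT n0 p1 M) => [[eL L]|[[_ L]|[i [ip iP PMi]]]].
- have [z [q [u [w [Ef qz d dq F]]]]] := leaf_mate_conn cH L.
  have zf : z \in f by rewrite Ef set22.
  have dz : dg z = 2 by rewrite (dg_in fE zf) d.
  have du := L_du F; have dw := L_dw F.
  have wz : w != z by apply: contraPneq dw => ->; rewrite d; nlia.
  have nf a : a != q -> a != z -> a \notin f by move=> h1 h2; rewrite Ef !inE negb_or h1.
  have wf : w \notin f by rewrite nf // eq_sym (L_qw F).
  have dw' : dg w = n.+1 by rewrite -(dg_notin fE wf).
  have small a : a != w -> dg a <= 2.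
    move=> aw; case: (eqVneq a q) => [->|aq]; first by rewrite dq.
    case: (eqVneq a z) => [->|az]; first by rewrite dz.
    rewrite -(dg_notin fE (nf _ aq az)); case: (eqVneq a u) => [->|au]; first by rewrite du.
    by have := L_dz F aq au aw; nlia.
  case: (eqVneq p 2) => p2; last first.
    split; first by nlia.
    by apply: (@Tk1_arm _ _ w); [split=> //; exact: L_fw F | left].
  case: (iso w dw' _ small).
  have h a : adj w a -> dg a <> 1 -> a = z.
    move=> wa da; apply/eqP; apply: contra_notT da => az.
    case: (eqVneq a q) => [->//|aq]; rewrite -(dg_notin fE (nf _ aq az)).
    case: (eqVneq a u) => [->//|au]; apply: (L_p2 F) => //.
    by rewrite eq_sym (adj_neq wa).
  by move=> a b /h h1 /h h2 /h1 -> /h2 ->.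
- have [z [q [u [w [Ef qz d dq F]]]]] := leaf_mate_conn cH L.
  have zf : z \in f by rewrite Ef set22.
  have dz : dg z = n.+1 by rewrite (dg_in fE zf) d.
  have du := L_du F; have dw := L_dw F.
  have nf a : a != q -> a != z -> a \notin f by move=> h1 h2; rewrite Ef !inE negb_or h1.
  have lift a : a != q -> @full (del_edge f) a -> full a.
    by rewrite Ef; apply: full_pendant => //; nlia.
  have [uq wq] : u != q /\ w != q by rewrite !(eq_sym _ q) (L_qu F) (L_qw F).
  have small a : a != z -> a != u -> dg a <= 2.
    move=> az au; case: (eqVneq a q) => [->|aq]; first by rewrite dq.
    rewrite -(dg_notin fE (nf _ aq az)); case: (eqVneq a w) => [->|aw]; first by rewrite dw.
    by have := L_dz F aq au aw; nlia.
  have zq : z != q by rewrite eq_sym (adj_neq qz).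
  case: (eqVneq z u) => zu.
    case: (iso z dz); first by rewrite zu; apply: lift (L_fu F).
    by move=> a az; apply: small; rewrite // -zu.
  have du' : dg u = n by rewrite -(dg_notin fE) ?nf // eq_sym.
  case: (eqVneq z w) => zw.
    have n2 : n = 2 by rewrite -dw -zw d.
    case: (iso z dz); first by rewrite zw; apply: lift (L_fw F).
    by move=> a az; case: (eqVneq a u) => [->|au]; [rewrite du' n2 | apply: small].
  have n2 : n = 2 by have := L_dz F zq zu zw; rewrite d; nlia.
  split.
    rewrite ltnNge; apply/negP => h; have p2 : p = 2 by nlia.
    by have := L_p2 F p2 zq zu zw; rewrite d; nlia.
  apply: (@Tk1_pen _ _ q z) => //; split=> //; first by rewrite dz n2.
  by move=> a az; case: (eqVneq a u) => [->|au]; [rewrite du' n2 | apply: small].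
have [x [y [S [u [w [Ef xy d F [xS yS]]]]]]] := path_mate_conn cH PMi.
have xf : x \in f by rewrite Ef set21.
have yf : y \in f by rewrite Ef set22.
have [dx dy] := (dg_in fE xf, dg_in fE yf).
have nf z : z != x -> z != y -> z \notin f by move=> h1 h2; rewrite Ef !inE negb_or h1.
have dn z : z != x -> z != y -> @dg (del_edge f) z = dg z by move=> h1 h2; rewrite dg_notin ?nf.
have du := P_du F; have dw := P_dw F; have wS := P_w F; have uS := P_u F.
have cl := P_cl F; have dz := P_dz F; have i0 : 0 < i by case/andP: ip.
have ip' : i < p by case/andP: ip.
have uw : u != w by apply: contraTneq uS => ->.
have dz2 z : z != w -> 0 < @dg (del_edge f) z <= 2.
  by move=> zw; case: (eqVneq z u) => [->|zu]; [rewrite du; case: (1 < i) | apply: dz].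
have edge (a b : H) : @adj H a b -> @adj (del_edge f) a b \/ (a = x /\ b = y) \/ (a = y /\ b = x).
  rewrite adj_del => ->; case: (eqVneq [set a; b] f) => [|_]; last by left.
  by move=> E; have := set2_inj (etrans E Ef); auto.
have xw : x != w by apply: contraTneq xS => ->.
have yu : y != u by apply: contraNneq yS => ->.
have outS z : z \notin S -> z != x by apply: contraNneq => ->.
have inS z : z \in S -> z != y by apply: contraTneq => ->.
have if1 (j : nat) : (if j == 1 then 1 else 1) = 1 by case: ifP.
rewrite if1 in d.
case: (ltnP i.+1 p) => ip2.
  rewrite (_ : i.+1 == p = false) in d; last by apply/negbTE; rewrite neq_ltn ip2.
  rewrite ip2 addn1 in dw.
  have yw : y != w by apply: contra_eqN d => /eqP ->; rewrite dw; nlia.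
  have [dx1 dy1] : @dg (del_edge f) x = 1 /\ @dg (del_edge f) y = 1.
    by have := dz2 _ xw; have := dz2 _ yw; nlia.
  have wf : w \notin f by rewrite nf // eq_sym.
  have dw' : dg w = n.+1 by rewrite -(dg_notin fE wf).
  have small z : z != w -> dg z <= 2.
    move=> zw; case: (eqVneq z x) => [->|zx]; first by nlia.
    case: (eqVneq z y) => [->|zy]; first by nlia.
    by rewrite -dn //; have := dz2 _ zw; nlia.
  split; first by nlia.
  case: (ltnP i.+2 p) => ip3.
    by apply: (@Tk1_arm _ _ w); [split=> //; exact: P_fw F | right; exists i].
  case: (iso w dw' _ small).
  have h a : adj w a -> dg a <> 1 -> a = y.
    rewrite -(adj_notin _ wf) => wa da; apply/eqP; apply: contra_notT da => ay.
    have aS : a \notin S by apply: contraNN wS => aS; apply: cl aS; rewrite adj_sym.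
    have aw : a != w by rewrite eq_sym; apply: adj_neq wa.
    have /andP[_ /eqP h] := P_sw F ip3 aS aw.
    by rewrite -dn // outS.
  by move=> a b /h h1 /h h2 /h1 -> /h2 ->.
have ip3 : i.+1 = p by nlia.
rewrite ip3 eqxx in d; rewrite ip3 ltnn addn0 in dw.
have star z : z \notin S -> z != w -> @adj (del_edge f) w z /\ @dg (del_edge f) z = 1.
  move=> zS zw; have ip4 : p <= i.+2 by nlia.
  by have /andP[h1 h2] := P_sw F ip4 zS zw; split=> //; apply/eqP.
case: (eqVneq y w) => yw.
  exfalso; have dx1 : @dg (del_edge f) x = 1 by rewrite yw in d; nlia.
  apply: (iso w); first by rewrite -yw dy yw dw.
    have h a : adj w a -> dg a <> 1 -> a = x.
      move=> /edge[|[[]|[]]] //; last by move=> E; rewrite E xS in wS.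
      move=> wa; have aS : a \notin S by apply: contraNN wS => aS; apply: cl aS; rewrite adj_sym.
      have aw : a != w by rewrite eq_sym; apply: adj_neq wa.
      by have [_ h] := star _ aS aw; rewrite -dn ?outS ?yw.
    by move=> a b /h h1 /h h2 /h1 -> /h2 ->.
  move=> z zw; case: (eqVneq z x) => [->|zx]; first by nlia.
  by rewrite -dn ?yw //; have := dz2 _ zw; nlia.
(* Here [f] ends at a leaf of the right star; the edge degree [n + 1] gives [x] degree [n] in
   [H - f], which forces [n = 2]. *)
have [wy dy1] := star _ yS yw.
have n2 : n = 2 by have := dz2 _ xw; nlia.
have dx2 : @dg (del_edge f) x = 2 by nlia.
have dw2 : dg w = 2 by rewrite -dn ?dw // eq_sym.
have small z : z != x -> dg z <= 2.
  move=> zx; case: (eqVneq z y) => [->|zy]; first by nlia.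
  case: (eqVneq z w) => [->|zw]; first by nlia.
  by rewrite -dn //; have := dz2 _ zw; nlia.
have dx3 : dg x = 3 by nlia.
case: (leqP i 2) => i2.
  exfalso; have xu : x = u.
    apply/eqP; apply: contraT => xu; have /andP[_ /eqP h] := P_su F i2 xS xu; nlia.
  apply: (iso x) => //; first by rewrite n2.
  have h a : adj x a -> dg a <> 1 -> a = y.
    move=> /edge[|[[]|[]]] //; last by move=> E1 E2 _; rewrite E2.
    move=> xa; have aS := cl _ _ xa xS.
    have ax : a != x by rewrite eq_sym; apply: adj_neq xa.
    have au : a != u by rewrite -xu.
    by have /andP[_ /eqP h] := P_su F i2 aS au; rewrite -dn // inS.
  by move=> a b /h h1 /h h2 /h1 -> /h2 ->.
split; first by nlia.
apply: (@Tk1_leg _ _ x y (~: S)) => //; first by nlia.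
  by have -> : p.-1 = i by nlia.
split=> //; first by split; nlia.
split; rewrite ?inE ?negbK //.
  by have := cardsC S; rewrite (P_S F) -cd; nlia.
move=> a c ac; rewrite !inE negbK => aS cS.
case: (edge _ _ ac) => [h|[[E1 E2]|[-> ->]]] //.
  by move: aS; rewrite (cl c a) // adj_sym.
by rewrite E1 xS in aS.
Qed.
End Spider.

Lemma pathdel_closed_size m n p i (F : sgraph) (S Z : {set F}) u w a b : pathdel m n p i S u w ->
  adj_closed Z -> a \in Z -> b \notin Z -> #|Z| = m + i \/ #|Z| = #|F| - (m + i).
Proof.
move=> P cZ aZ bZ.
have sub c d : c \in Z -> (c \in S) = (d \in S) -> d \in Z by move=> cin E; exact: (P_con P cZ cin E).
case: (boolP (a \in S)) => aS; [left|right].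
  have -> : Z = S; last exact: P_S P.
  apply/setP => z; apply/idP/idP => h; last by apply: (sub a) => //; rewrite aS h.
  apply: contraT => zS; case/negP: bZ; case: (boolP (b \in S)) => bS.
    by apply: (sub a); rewrite // aS bS.
  by apply: (sub z); rewrite // (negPf zS) (negPf bS).
have -> : Z = ~: S by [
  apply/setP => z; rewrite inE; apply/idP/idP => h;
    [ apply/negP => zS; case/negP: bZ; case: (boolP (b \in S)) => bS;
       [apply: (sub z); rewrite // zS bS | apply: (sub a); rewrite // (negPf aS) (negPf bS)]
    | apply: (sub a) => //; rewrite (negPf aS) (negPf h) ]].
by rewrite -(P_S P); have := cardsC S; nlia.
Qed.

Section SpiderBound.
Variables (n p : nat) (H : sgraph).
Hypotheses (n1 : 1 < n) (p1 : 1 < p) (cH : conn H).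
Hypothesis niso : ~ graph_iso H (B 1 n p).
Variables (k : nat) (e : 'I_k -> {set B 1 n p}) (f : 'I_k -> {set H}).
Hypotheses (ei : injective e) (fi : injective f) (M : forall j, mate (e j) (f j)).

Let fE j : f j \in edges H. Proof. by case: (M j). Qed.

Definition arm_class (e : {set B 1 n p}) (f : {set H}) : Prop :=
  (e \in Ledges 1 n p /\ leaf_mate 1 n p f) \/
  exists i, [/\ 0 < i, i.+2 < p, path_edge i e & path_mate 1 n p i f].

(** [f] is the second edge at the neighbour [a] of [w]: its deletion makes [a] a leaf. *)
Definition touches (f : {set H}) (w a : H) : Prop :=
  [/\ adj w a, dg a = 2, w \notin f & exists2 y, f = [set a; y] & adj a y].

Lemma touches_uniq (g g' : {set H}) (w a : H) : touches g w a -> touches g' w a -> g = g'.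
Proof.
move=> [wa da wg [y Eg ay]] [_ _ wg' [y' Eg' ay']].
have aw : adj a w by rewrite adj_sym.
have wy : w != y by apply: contraNneq wg => ->; rewrite Eg set22.
have wy' : y' != w by apply: contraNneq wg' => <-; rewrite Eg' set22.
have d2 : dg a <= 2 by rewrite da.
by case: (dg2_eq d2 aw ay ay' wy) => E; [rewrite E eqxx in wy' | rewrite Eg Eg' E].
Qed.

Lemma big_vertex (g : {set H}) (e' : {set B 1 n p}) : mate e' g ->
  exists w : H, dg w = n.+1 /\ forall z, z != w -> dg z <= 2.
Proof.
case/(spider_mate_kind n1 p1 cH niso) => _ [w [h1 _ _ h2] _|q z n2 [_ _ _ h1 h2]|b y T n2 _ _ [_ _ [h1 _] h2 _]].
- by exists w.
- by exists z; rewrite n2.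
- by exists b; rewrite n2.
Qed.

Lemma spider_frame : 0 < k -> exists w a b : H, [/\ dg w = n.+1, forall z, z != w -> dg z <= 2,
  adj w a /\ adj w b, dg a <> 1 /\ dg b <> 1 & a <> b].
Proof.
move=> k0; have m0 := M (Ordinal k0).
have [w [dw dz]] := big_vertex m0.
have cd := mate_card m0; rewrite card_ord in cd; have sm := mate_sum m0.
have [a [b [h1 h2 h3 h4 h5]]] : exists a b,
    [/\ adj w a, adj w b, dg a <> 1, dg b <> 1 & a <> b].
  apply: not_full => fw; apply: niso.
  have n0 : 0 < n by nlia.
  exact: (broom1_of_full n0 p1 cH (esym cd) (esym sm) dw fw dz).
by exists w, a, b.
Qed.

Lemma arm_kind_touches (g : {set H}) (w w' a b : H) : g \in edges H -> dg w = n.+1 ->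
  (forall z, z != w -> dg z <= 2) -> adj w a -> adj w b -> dg a <> 1 -> dg b <> 1 -> a <> b ->
  arm_kind n g w' -> touches g w a \/ touches g w b.
Proof.
move=> gE dw dz wa wb da db ab [dw' wg fw _].
have Ew : w' = w by apply/eqP; apply: contraT => h; have := dz _ h; nlia.
subst w'; have [x [y [Eg xy wx dx h]]] := touch gE wg fw wa wb da db ab.
by case: h => E; subst x; [left | right]; split=> //; exists y.
Qed.

(** Each mate touches one of two fixed non-leaf neighbours of [w]. For [p = 3] no path edge
    satisfies [i.+2 < p], so [e] is the unique left leaf edge. *)
Lemma spider_mates_n_ge3 : 2 < n -> k <= 2 /\ (p = 3 -> k <= 1) /\ (p = 2 -> k = 0).
Proof.
move=> n3; case: (posnP k) => [->//|k0].
have [w [a [b [dw dz [wa wb] [da db] ab]]]] := spider_frame k0.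
have cl j : [/\ 2 < p, touches (f j) w a \/ touches (f j) w b & arm_class (e j) (f j)].
  have [p3 [w' K h|q z n2|b' y T n2]] := spider_mate_kind n1 p1 cH niso (M j); try nlia.
  by split=> //; exact: (arm_kind_touches (fE j) dw dz wa wb da db ab K).
have [p3 _ _] := cl (Ordinal k0).
split; last split; last by nlia.
  pose K (c : 'I_2) j := touches (f j) w (if val c == 0 then a else b).
  have [] := @pigeonhole k 2 K _ _ => //.
    move=> j; have [_ [h|h] _] := cl j.
      by exists (Ordinal (isT : 0 < 2)).
    by exists (Ordinal (isT : 1 < 2)).
  by move=> c i j h1 h2; apply: fi; apply: touches_uniq h1 h2.
move=> p3'; have : #|[set e j | j in 'I_k]| <= #|Ledges 1 n p|.
  apply/subset_leq_card/subsetP => g /imsetP[j _ ->].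
  by have [_ _ [[h _]//|[i [i0 ip _ _]]]] := cl j; nlia.
by rewrite card_imset // card_ord => /leq_trans; apply; exact: card_Ledges.
Qed.

(** Among 8 vertices a leaf edge splits off 1 or 7, the path edge 1 splits off 2 or 6, and the path
    edge 2 splits off 3 or 5. *)
Lemma arm_size (g : {set H}) (e' : {set B 1 n p}) (Z : {set H}) (a b : H) : p = 5 -> n = 2 -> #|H| = 8 ->
  arm_class e' g -> @adj_closed (del_edge g) Z -> a \in Z -> b \notin Z ->
  #|Z| = 2 \/ #|Z| = 6 -> path_edge 1 e'.
Proof.
move=> p5 n2 h8 cls cZ aZ bZ sz; case: cls => [[_ [x [y [q [u [w [_ _ _ F]]]]]]]|].
  have [z zZ zq] : exists2 z, z \in Z & z != q.
    apply: boolp.contrapT => no.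
    have : #|Z| <= #|[set q]|.
      apply/subset_leq_card/subsetP => z zZ; rewrite inE; apply: contraT => zq.
      by case: no; exists z.
    by rewrite cards1; nlia.
  have : #|[set~ q]| <= #|Z|.
    apply/subset_leq_card/subsetP => c; rewrite !inE => cq.
    exact: (L_con F cZ zZ zq cq).
  by rewrite cardsC1 h8; nlia.
move=> [i [i0 ip iP [x [y [S [u [w [_ _ _ P]]]]]]]].
have := pathdel_closed_size P cZ aZ bZ; rewrite (_ : #|del_edge g| = 8) // => h.
have E : i = 1; last by subst i.
by move: h sz i0 ip p5; move: #|Z| => N; nlia.
Qed.

(** The mate touching [a] splits off the two outer vertices of the leg; the one touching [b] splits
    off the leg with [w], [q], [b], six vertices. Both would then pair with the path edge 1. *)
Lemma leg_arms (g : {set H}) (w q a b : H) (T : {set H}) i j : p = 5 -> n = 2 ->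
  dg w = 3 -> adj w q -> dg q = 1 -> adj w b -> dg b <> 1 -> a <> b ->
  spider_leg g w a T -> touches (f i) w a -> touches (f j) w b ->
  arm_class (e i) (f i) -> arm_class (e j) (f j) -> False.
Proof.
move=> p5 n2 dw wq dq wb db ab [_ wa [_ da] dz [cT aT wT bT]].
move=> [_ _ wfi [y Ei ay]] [_ db2 wfj [y' Ej by']] ci cj.
have cd : #|H| = 8 by rewrite -(mate_card (M i)) card_ord p5 n2.
have aq : q != a by apply: contraPneq dq => ->; rewrite da.
have qb : q != b by apply: contra_notN db => /eqP <-.
have {ab} ab : a != b by apply/eqP.
have Nw c : adj w c -> [|| c == q, c == a | c == b] by move=> wc; apply: (dg3_eq dw).
have bnT : b \notin T.
  apply/negP => h; have bw : adj b w by rewrite adj_sym.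
  by have [E _] := bT _ _ bw h wT; rewrite E eqxx in ab.
have qnT : q \notin T.
  apply/negP => h; have qw : adj q w by rewrite adj_sym.
  by have [E _] := bT _ _ qw h wT; rewrite E eqxx in aq.
have yT : y \in T.
  apply: contraT => yT; have [_ E] := bT _ _ ay aT yT.
  by rewrite Ei E set22 in wfi.
have ya : y != a by rewrite eq_sym (adj_neq ay).
have Pi : path_edge 1 (e i).
  apply: (@arm_size (f i) (e i) (T :\ a) y a p5 n2 cd ci).
  - move=> c d; rewrite adj_del !inE => /andP[cd' nf] /andP[ca cT'].
    have dT : d \in T by apply: contraT => dT; have [E _] := bT _ _ cd' cT' dT; rewrite E eqxx in ca.
    rewrite dT andbT; apply: contraNneq nf => E; subst d; rewrite Ei.
    have ac : adj a c by rewrite adj_sym.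
    have aw : adj a w by rewrite adj_sym.
    have wy : w != y by apply: contraNneq wT => ->.
    have da2 : dg a <= 2 by rewrite da.
    case: (dg2_eq da2 aw ay ac wy) => E; last by rewrite E setUC.
    by rewrite -E cT' in wT.
  - by rewrite !inE ya yT.
  - by rewrite !inE eqxx.
  - by left; have := cardsD1 a T; rewrite aT cT; nlia.
have wneb : w != b by apply: adj_neq.
have wneq : w != q by apply: adj_neq.
have sZ : #|T :|: [set w; q; b]| = 6.
  rewrite cardsU (_ : T :&: _ = set0).
    rewrite cards0 subn0 cT (setUC [set w; q]) cardsU1 !inE negb_or (eq_sym b w) wneb (eq_sym b q) qb.
    by rewrite cards2 wneq.
  apply/setP => z; rewrite !inE; apply/negP => /andP[zT /orP[/orP[]|] /eqP E]; subst z.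
  - by rewrite zT in wT.
  - by rewrite zT in qnT.
  - by rewrite zT in bnT.
have [c cZ] : exists c, c \notin T :|: [set w; q; b].
  apply: boolp.contrapT => no.
  have : #|H| <= #|T :|: [set w; q; b]|.
    apply/subset_leq_card/subsetP => c _; apply: contraT => h; by case: no; exists c.
  by rewrite sZ cd.
have Pj : path_edge 1 (e j).
  apply: (@arm_size (f j) (e j) (T :|: [set w; q; b]) w c p5 n2 cd cj) => //.
  - move=> s d; rewrite adj_del !inE => /andP[sd nf] /orP[sT|/orP[/orP[]|] /eqP E]; try subst s.
    + case: (boolP (d \in T)) => //= dT; have [_ ->] := bT _ _ sd sT dT; by rewrite eqxx.
    + by case/or3P: (Nw _ sd) => /eqP ->; rewrite ?aT ?eqxx ?orbT.
    + have qw : adj q w by rewrite adj_sym.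
      by rewrite (dg1_eq dq sd qw) eqxx !orbT.
    + have bw : adj b w by rewrite adj_sym.
      have wy' : w != y' by apply: contraNneq wfj => ->; rewrite Ej set22.
      have db2' : dg b <= 2 by rewrite db2.
      case: (dg2_eq db2' bw by' sd wy') => E; first by rewrite E eqxx !orbT.
      by rewrite E -Ej eqxx in nf.
  - by rewrite !inE eqxx orbT.
  - by right.
have ij : i = j by apply: ei; apply: path_edge_inj Pi Pj.
subst j; case: (set2_inj (etrans (esym Ei) Ej)) => -[E1 E2].
  by rewrite E1 eqxx in ab.
by rewrite -E2 yT in bnT.
Qed.

Lemma spider_mates_n2 : n = 2 -> [/\ k <= 4, p = 5 -> k <= 3, p = 3 -> k <= 2 & p = 2 -> k = 0].
Proof.
move=> n2; case: (posnP k) => [->//|k0].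
have [w [a [b [dw dz [wa wb] [da db] ab]]]] := spider_frame k0; rewrite n2 in dw.
have big z : dg z = 3 -> z = w.
  by move=> d3; apply/eqP; apply: contraT => h; have := dz _ h; nlia.
pose arm a j := touches (f j) w a /\ arm_class (e j) (f j).
pose pen j := exists2 q, spider_pen (f j) q w & adj w q /\ dg q = 1.
pose leg j := path_edge p.-1 (e j) /\ 3 < p /\ exists y T, spider_leg (f j) w y T.
have cl j : 2 < p /\ ((arm a j \/ arm b j) \/ pen j \/ leg j).
  have [p3 [w' K h|q z _ K|c y T _ p4 h K]] := spider_mate_kind n1 p1 cH niso (M j); split=> //.
  - have dw' : dg w = n.+1 by rewrite n2.
    by case: (arm_kind_touches (fE j) dw' dz wa wb da db ab K) => ?; left; [left|right].
  - have [_ qz dq /big E _] := K; subst z.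
    by right; left; exists q => //; rewrite adj_sym.
  - have [_ _ [/big E _] _ _] := K; subst c.
    by right; right; split=> //; split=> //; exists y, T.
have [p3 _] := cl (Ordinal k0).
have pen_inj i j : pen i -> pen j -> i = j.
  move=> [q [Eq _ _ _ _] [wq dq]] [q' [Eq' _ _ _ _] [wq' dq']]; apply: fi; rewrite Eq Eq'.
  have nq c : dg c <> 1 -> q != c by move=> dc; apply: contra_notN dc => /eqP <-.
  have nq' c : dg c <> 1 -> q' == c = false.
    by move=> dc; apply/negbTE; apply: contra_notN dc => /eqP <-.
  have ab' : a != b by apply/eqP.
  have := dg3_eq dw wq wa wb wq' (nq _ da) (nq _ db) ab'; rewrite (nq' _ da) (nq' _ db) !orbF.
  by move=> /eqP ->.
pose K (c : 'I_4) (j : 'I_k) := match val c with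
  | 0 => pen j | 1 => leg j | 2 => arm a j | _ => arm b j end.
have cls j : exists c, K c j.
  have [_ [[h|h]|[h|h]]] := cl j.
  - by exists (Ordinal (isT : 2 < 4)).
  - by exists (Ordinal (isT : 3 < 4)).
  - by exists (Ordinal (isT : 0 < 4)).
  - by exists (Ordinal (isT : 1 < 4)).
have inj c i j : K c i -> K c j -> i = j.
  case: c => -[|[|[|[]]]] // h; rewrite /K /=.
  - exact: pen_inj.
  - by move=> [h1 _] [h2 _]; apply: ei; apply: path_edge_inj h1 h2.
  - by move=> [h1 _] [h2 _]; apply: fi; apply: touches_uniq h1 h2.
  - by move=> [h1 _] [h2 _]; apply: fi; apply: touches_uniq h1 h2.
have [k4 all4] := pigeonhole cls inj.
split=> //; last by nlia.
  move=> p5; rewrite leqNgt; apply/negP => k4'.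
  have [i0 [q _ [wq dq]]] := all4 k4' (Ordinal (isT : 0 < 4)).
  have [i1 [_ [_ [y [T L]]]]] := all4 k4' (Ordinal (isT : 1 < 4)).
  have [i2 [t2 c2]] := all4 k4' (Ordinal (isT : 2 < 4)).
  have [i3 [t3 c3]] := all4 k4' (Ordinal (isT : 3 < 4)).
  have [_ wy [_ dy] _ _] := L.
  have nq c : dg c <> 1 -> q != c by move=> dc; apply: contra_notN dc => /eqP <-.
  have ab' : a != b by apply/eqP.
  have := dg3_eq dw wq wa wb wy (nq _ da) (nq _ db) ab'; rewrite eq_sym (negPf (nq y _)) /=.
    case/orP => /eqP E; subst y.
      exact: (leg_arms p5 n2 dw wq dq wb db ab L t2 t3 c2 c3).
    by apply: (leg_arms p5 n2 dw wq dq wa da _ L t3 t2 c3 c2) => /esym.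
  by rewrite dy.
move=> p3'; pose K' (c : 'I_2) (j : 'I_k) := if val c == 0 then pen j else e j \in Ledges 1 n p.
have [] := @pigeonhole k 2 K' _ _ => //.
  move=> j; have [_ [h|[h|[_ [p4 _]]]]] := cl j; last by nlia.
    exists (Ordinal (isT : 1 < 2)); rewrite /K' /=.
    have {h} : arm_class (e j) (f j) by case: h => -[].
    by case=> [[]//|[i [i0 ip _ _]]]; nlia.
  by exists (Ordinal (isT : 0 < 2)).
move=> c i j; rewrite /K'; case: ifP => _; first exact: pen_inj.
move=> h1 h2; apply: ei; have := card_Ledges 1 n p => /card_le1_eqP; exact.
Qed.
End SpiderBound.

(** * Graphs with an isolated vertex *)

(** The degrees of the ends add up to [m], the degree of [u], and both are positive, so neither end
    is [u]. The ends are ordered so that only [x] can be [w]. *)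
Record isolated_mate m n p (H : sgraph) (q : H) (f : {set H}) (x y u w : H) : Prop := {
  I_f : f = [set x; y];
  I_xy : adj x y;
  I_d : @dg (del_edge f) x + @dg (del_edge f) y = m;
  I_F : @leafdel m n p (del_edge f) q u w;
  I_xu : x != u; I_yu : y != u; I_yw : y != w; I_xq : x != q; I_yq : y != q;
  I_dy : 1 <= @dg (del_edge f) y <= 2;
  I_dx : x = w \/ 1 <= @dg (del_edge f) x <= 2 }.

Record mate_ends m n p (H : sgraph) (q : H) (f : {set H}) (x y u w : H) : Prop := {
  S_f : f = [set x; y];
  S_xy : adj x y;
  S_F : @leafdel m n p (del_edge f) q u w;
  S_xq : x != q; S_yq : y != q }.

Section Orient.
Variables (m n p : nat) (H : sgraph) (q : H).
Hypotheses (m0 : 0 < m) (n0 : 0 < n) (p2 : 2 <= p) (iq : forall z, ~~ adj q z).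

Lemma dg_isolated : dg q = 0.
Proof. by apply/eqP; rewrite cards_eq0; apply/eqP/setP => z; rewrite !inE (negPf (iq z)). Qed.

Lemma leaf_mate_isolated (f : {set H}) : leaf_mate m n p f -> exists x y u w, isolated_mate m n p q f x y u w.
Proof.
move=> [x [y [q' [u [w [Ef xy d F]]]]]].
have E : q' = q.
  apply/eqP; rewrite eq_sym; apply: contraT => nq; have [uw qu qw _ _ du dw dz _ _ _ _ _ _ _] := F.
  have d0 : @dg (del_edge f) q = 0.
    apply/eqP; rewrite cards_eq0; apply/eqP/setP => z; rewrite !inE adj_del.
    by rewrite (negPf (iq z)).
  case: (eqVneq q u) => [E|nu]; first by move: du; rewrite -E d0; nlia.
  case: (eqVneq q w) => [E|nw]; first by move: dw; rewrite -E d0; nlia.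
  by have := dz _ nq nu nw; rewrite d0.
subst q'.
have nq (a b : H) : adj a b -> a != q /\ b != q.
  by move=> ab; split; apply: contraTneq ab => ->; rewrite // adj_sym.
have [xq yq] := nq _ _ xy.
have [uw qu qw Lq con du dw dz _ _ _ _ _ _ _] := F.
have pos (z : H) : z != q -> 0 < @dg (del_edge f) z.
  move=> zq; case: (eqVneq z u) => [->|zu]; first by rewrite du.
  case: (eqVneq z w) => [->|zw]; first by rewrite dw.
  by have := dz _ zq zu zw; nlia.
have xu : x != u by apply: contra_eqN d => /eqP ->; rewrite du; have := pos _ yq; nlia.
have yu : y != u by apply: contra_eqN d => /eqP ->; rewrite du; have := pos _ xq; nlia.
case: (eqVneq y w) => [yw|yw].
  have xw : x != w by rewrite -yw; apply: adj_neq xy.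
  exists y, x, u, w; split; rewrite // 1?addnC 1?adj_sym 1?setUC //; try exact: dz.
  by left.
exists x, y, u, w; split; rewrite //; first exact: dz.
by case: (eqVneq x w) => xw; [left | right; exact: dz].
Qed.

Section OneMatch.
Variables (f : {set H}) (x y u w : H).
Hypothesis K : isolated_mate m n p q f x y u w.

Lemma IM_edge : f \in edges H.
Proof. by apply/edgesP; exists x, y; rewrite (I_f K) (I_xy K). Qed.

Lemma IM_dn (z : H) : z != x -> z != y -> @dg (del_edge f) z = dg z.
Proof. by move=> zx zy; apply: dg_notin; [exact: IM_edge | rewrite (I_f K) !inE negb_or zx]. Qed.

Lemma IM_dx : dg x = (@dg (del_edge f) x).+1.
Proof. by apply: dg_in; [exact: IM_edge | rewrite (I_f K) set21]. Qed.

Lemma IM_dy : dg y = (@dg (del_edge f) y).+1.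
Proof. by apply: dg_in; [exact: IM_edge | rewrite (I_f K) set22]. Qed.

Lemma IM_du : dg u = m.
Proof. by rewrite -(L_du (I_F K)) IM_dn // eq_sym; [exact: I_xu K | exact: I_yu K]. Qed.

Lemma IM_dw : dg w = n.+1 + (x == w).
Proof.
have dw := L_dw (I_F K); case: eqP => [E|/eqP xw].
  by rewrite -E IM_dx E dw addn1.
by rewrite addn0 -dw IM_dn // eq_sym //; exact: I_yw K.
Qed.

Lemma IM_dz (z : H) : z != x -> z != y -> z != u -> z != w -> dg z <= 2.
Proof.
move=> zx zy zu zw; rewrite -IM_dn //; case: (eqVneq z q) => [->|zq].
  rewrite (_ : @dg (del_edge f) q = 0) //; apply/eqP; rewrite cards_eq0; apply/eqP/setP => a.
  by rewrite !inE adj_del (negPf (iq a)).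
by have := L_dz (I_F K) zq zu zw; nlia.
Qed.

(** In [H - f] the end [y] has degree 1 or 2, and [x] has degree 1 or 2, or [n + 1] if it is [w]. *)
Lemma IM_param : m = 2 \/ m = 3 \/ m = 4 \/ m = n.+2 \/ m = n + 3.
Proof.
have d := I_d K; have dy := I_dy K; case: (I_dx K) => [E|dx]; last by nlia.
by have dw := L_dw (I_F K); rewrite -E in dw; nlia.
Qed.

Lemma IM_p2 : p = 2 -> m = 2 \/ m = n.+2.
Proof.
move=> pE; have d := I_d K; have L := L_p2 (I_F K) pE.
have dy := L _ (I_yq K) (I_yu K) (I_yw K).
case: (eqVneq x w) => [E|xw]; last by have := L _ (I_xq K) (I_xu K) xw; nlia.
by have dw := L_dw (I_F K); rewrite -E in dw; nlia.
Qed.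

(** For [p = 3] a vertex of degree 2 is the middle one, already adjacent to [w]; so it cannot be
    joined to [w], nor to another such vertex. *)
Lemma IM_p3 : p = 3 -> m <= 3 \/ m = n.+2.
Proof.
move=> pE; have d := I_d K; have dy := I_dy K; have L := L_p3 (I_F K) pE.
have Ly d2 := L _ (I_yq K) (I_yu K) (I_yw K) d2.
case: (eqVneq x w) => [E|xw].
  have dw := L_dw (I_F K); rewrite -E in dw; right.
  case: (eqVneq (@dg (del_edge f) y) 2) => [d2|]; last by nlia.
  by have /andP[_] := Ly d2; rewrite -E adj_del (I_f K) eqxx andbF.
case: (I_dx K) => [E|dx]; first by rewrite E eqxx in xw.
left; rewrite leqNgt; apply/negP => m4.
have dy2 : @dg (del_edge f) y = 2 by nlia.
have dx2 : @dg (del_edge f) x = 2 by nlia.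
have /andP[h1 _] := Ly dy2; have /andP[h2 _] := L _ (I_xq K) (I_xu K) xw dx2.
have E : y = x by apply: (L_fu (I_F K)); rewrite ?dy2 ?dx2.
by have := adj_neq (I_xy K); rewrite E eqxx.
Qed.

End OneMatch.

Lemma isolated_mate_ends (f : {set H}) (x y u w : H) : isolated_mate m n p q f x y u w ->
  mate_ends m n p q f x y u w /\ mate_ends m n p q f y x u w.
Proof. by case=> Ef xy _ F _ _ _ xq yq _ _; split; split; rewrite // 1?setUC 1?adj_sym. Qed.

Lemma SM_adj (f : {set H}) (x y u w a b : H) : mate_ends m n p q f x y u w -> adj a b ->
  @adj (del_edge f) a b \/ (a = x /\ b = y) \/ (a = y /\ b = x).
Proof.
move=> K ab; rewrite adj_del ab; case: (eqVneq [set a; b] f) => [|_]; last by left.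
by rewrite (S_f K) => /set2_inj; right.
Qed.

(* Away from [q], [H] has a unique cycle and every mate lies on it, while only two of its edges meet [y]. *)
Lemma no_three_mates_at_vertex (f g h : {set H}) (y x1 x2 x3 u1 w1 u2 w2 u3 w3 : H) :
  mate_ends m n p q f x1 y u1 w1 -> mate_ends m n p q g x2 y u2 w2 -> mate_ends m n p q h x3 y u3 w3 ->
  f <> g -> f <> h -> g <> h -> False.
Proof.
move=> Kf Kg Kh fg fh gh.
have [Ef Eg Eh] := And3 (S_f Kf) (S_f Kg) (S_f Kh).
have x21 : x2 != x1 by apply: contra_notN fg => /eqP E; rewrite Ef Eg E.
have x31 : x3 != x1 by apply: contra_notN fh => /eqP E; rewrite Ef Eh E.
have x23 : x2 != x3 by apply: contra_notN gh => /eqP E; rewrite Eg Eh E.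
have edge (x : H) : adj x y -> x != x1 -> @adj (del_edge f) x y.
  move=> xy xx; rewrite adj_del xy Ef; apply: contraNneq xx => /set2_inj[[->]//|[E1 E2]].
  by rewrite E1 -E2.
have bridge (g' : {set H}) x u w : mate_ends m n p q g' x y u w -> x != x1 -> exists S : {set H},
    [/\ x \in S, y \notin S, x1 \in S &
    forall a b, @adj (del_edge f) a b -> a \in S -> b \notin S -> a = x /\ b = y].
  move=> Kg' xx1; have [S [xS yS bS]] := L_br (S_F Kf) (edge _ (S_xy Kg') xx1).
  exists S; split=> //; apply: contraT => x1S.
  have := L_con (S_F Kg') (Z := S) _ xS (S_xq Kg') (S_yq Kg'); rewrite (negPf yS) => -> //.
  move=> a b ab aS; apply: contraT => bnS; have ab' := del_sub ab.
  case: (SM_adj Kf ab') => [h1|[[E1 E2]|[E1 E2]]].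
  - have [E1 E2] := bS _ _ h1 aS bnS.
    by move: ab; rewrite adj_del E1 E2 (S_f Kg') eqxx andbF.
  - by rewrite E1 (negPf x1S) in aS.
  - by rewrite E1 (negPf yS) in aS.
have [S [x2S yS x1S bS]] := bridge _ _ _ _ Kg x21.
have [T [x3T yT x1T bT]] := bridge _ _ _ _ Kh x31.
suff cl : @adj_closed (del_edge f) (S :&: T).
  have xI : x1 \in S :&: T by rewrite inE x1S.
  have := L_con (S_F Kf) cl xI (S_xq Kf) (S_yq Kf).
  by rewrite inE (negPf yS).
move=> a b ab; rewrite !inE => /andP[aS aT].
case: (boolP (b \in S)) => bS'; case: (boolP (b \in T)) => bT' //.
- have [E1 E2] := bT _ _ ab aT bT'; subst a b; by rewrite bS' in yS.
- have [E1 E2] := bS _ _ ab aS bS'; subst a b; by rewrite bT' in yT.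
- have [E1 _] := bT _ _ ab aT bT'; have [E3 _] := bS _ _ ab aS bS'.
  by rewrite -E1 E3 eqxx in x23.
Qed.

Variables (k : nat) (f : 'I_k -> {set H}).
Hypotheses (fi : injective f) (M : forall j, leaf_mate m n p (f j)).

(** Here [f] joins two leaves of [H - f], at least one of them attached to [w], so [f] touches a
    neighbour of [w], and [w] is the only large vertex. *)
Lemma isolated_mates_m2 : m = 2 -> 1 < n -> k <= 2.
Proof.
move=> mE n1.
have cl j : exists x y u w, [/\ isolated_mate m n p q (f j) x y u w, x != w & touches (f j) w x].
  have [x [y [u [w K]]]] := leaf_mate_isolated (M j); have F := I_F K.
  have d := I_d K; have dy := I_dy K; have dw := L_dw F; have du := L_du F.
  have xw : x != w by apply: contra_eqN d => /eqP ->; rewrite dw; nlia.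
  case: (I_dx K) => [E|dx]; first by rewrite E eqxx in xw.
  have dx1 : @dg (del_edge (f j)) x = 1 by nlia.
  have dy1 : @dg (del_edge (f j)) y = 1 by nlia.
  have m1 : 1 < m by nlia.
  have wf : w \notin f j by rewrite (I_f K) !inE negb_or !(eq_sym w) xw (I_yw K).
  have wadj (z : H) : @adj (del_edge (f j)) w z -> adj w z by apply: del_sub.
  have DX : dg x = 2 by rewrite (IM_dx K) dx1.
  have DY : dg y = 2 by rewrite (IM_dy K) dy1.
  have := L_att F m1 dx1; have := L_att F m1 dy1.
  case: (boolP (@adj (del_edge (f j)) w y)) => [wy _ _|nwy].
    exists y, x, u, w; split.
    - have [] := K; split; rewrite // 1?addnC 1?adj_sym 1?setUC //; last by right.
    - exact: I_yw K.
    split; rewrite ?(wadj _ wy) //; exists x; rewrite 1?(I_f K) 1?setUC // adj_sym.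
    exact: I_xy K.
  rewrite orbF => uy.
  case: (boolP (@adj (del_edge (f j)) w x)) => [wx _|nwx].
    exists x, y, u, w; split=> //; split; rewrite ?(wadj _ wx) //; exists y; first exact: I_f K.
    exact: I_xy K.
  rewrite orbF => ux; exfalso.
  have xy := adj_neq (I_xy K).
  (* If both leaves hang from [u], which has degree 2, they form with it a component missing [w]. *)
  have cZ : @adj_closed (del_edge (f j)) [set u; x; y].
    move=> a b ab; rewrite !inE => /orP[/orP[]|] /eqP E; subst a.
    - have d2 : @dg (del_edge (f j)) u <= 2 by rewrite du mE.
      by case: (dg2_eq d2 ux uy ab xy) => ->; rewrite eqxx !orbT.
    - by rewrite (dg1_eq dx1 ab (etrans (adj_sym _ _) ux)) eqxx.
    - by rewrite (dg1_eq dy1 ab (etrans (adj_sym _ _) uy)) eqxx.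
  have qw : w != q by rewrite eq_sym; exact: L_qw F.
  have uq : u != q by rewrite eq_sym; exact: L_qu F.
  have := L_con F cZ (a := u) (b := w) _ uq qw; rewrite !inE eqxx => /(_ isT).
  by rewrite !(eq_sym w) (negPf (L_uw F)) (negPf xw) (negPf (I_yw K)).
have big j x y u w : isolated_mate m n p q (f j) x y u w -> x != w -> dg w = n.+1 /\
    forall z, z != w -> dg z <= 2.
  move=> K xw; have F := I_F K; have dw := IM_dw K; rewrite (negPf xw) addn0 in dw.
  have d := I_d K; have dy := I_dy K.
  split=> // z zw; case: (eqVneq z x) => [->|zx].
    by rewrite (IM_dx K); nlia.
  case: (eqVneq z y) => [->|zy].
    rewrite (IM_dy K); case: (I_dx K) => [E|]; last by nlia.
    by rewrite E eqxx in xw.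
  case: (eqVneq z u) => [->|zu]; first by rewrite (IM_du K) mE.
  exact: (IM_dz K).
case: (posnP k) => [->//|k0].
have [x0 [y0 [u0 [W [K0 x0W T0]]]]] := cl (Ordinal k0).
have [dW dz] := big _ _ _ _ _ K0 x0W.
have {}cl j : exists x, touches (f j) W x /\ @full (del_edge (f j)) W.
  have [x [y [u [w [K xw T]]]]] := cl j; have [dw _] := big _ _ _ _ _ K xw.
  have E : w = W by apply/eqP; apply: contraT => h; have := dz _ h; nlia.
  by subst w; exists x; split=> //; exact: (L_fw (I_F K)).
have fE j : f j \in edges H by have [x [y [u [w K]]]] := leaf_mate_isolated (M j); exact: (IM_edge K).
case: (boolp.pselect (full W)) => [fW|/not_full[a [b [wa wb da db ab]]]].
  suff : k <= 1 by nlia.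
  have := @pigeonhole k 1 (fun _ j => True) _ _; case=> //.
    by move=> j; exists ord0.
  move=> _ i j _ _; apply: fi.
  have [x [[h1 h2 h3 h4] _]] := cl i; have [x' [[h1' h2' h3' h4'] _]] := cl j.
  have E : x = x' by apply: fW; rewrite ?h2 ?h2'.
  by subst x'; apply: (@touches_uniq H _ _ W x); split.
pose KK (c : 'I_2) j := touches (f j) W (if val c == 0 then a else b).
have [] // := @pigeonhole k 2 KK _ _.
  move=> j; have [x [[_ _ wf _] fw]] := cl j.
  have [x' [y' [Ef xy' wx' dx' h]]] := touch (fE j) wf fw wa wb da db ab.
  have T : touches (f j) W x' by split=> //; exists y'.
  case: h => E; subst x'.
    by exists (Ordinal (isT : 0 < 2)).
  by exists (Ordinal (isT : 1 < 2)).
by move=> c i j h1 h2; apply: fi; apply: touches_uniq h1 h2.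
Qed.

Lemma full_leaf (F : sgraph) (z x : F) : full z -> 2 < dg z ->
  exists a, [/\ adj z a, a != x & dg a = 1].
Proof.
move=> fz d; have d2 : 1 < dg z by nlia.
have [a za ax] := dg_other x d2.
case: (eqVneq (dg a) 1) => [da|/eqP da]; first by exists a.
have [b [zb bx ba]] := dg_other2 x a d; exists b; split=> //.
by apply: boolp.contrapT => db; rewrite (fz b a zb za db da) eqxx in ba.
Qed.

Record mate3 (f : {set H}) (x y u w : H) : Prop := {
  T_S : mate_ends m n p q f x y u w;
  T_x : @dg (del_edge f) x = 1; T_y : @dg (del_edge f) y = 2;
  T_xu : x != u; T_yu : y != u; T_xw : x != w; T_yw : 1 < n -> y != w }.

Lemma mate3_of j : m = 3 -> exists x y u w, mate3 (f j) x y u w.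
Proof.
move=> mE; have [x [y [u [w K]]]] := leaf_mate_isolated (M j); have [S1 S2] := isolated_mate_ends K.
have d := I_d K; have dy := I_dy K; have [xu yu yw] := And3 (I_xu K) (I_yu K) (I_yw K).
case: (eqVneq x w) => xw.
  have dw := L_dw (I_F K); rewrite -xw in dw.
  by exists y, x, u, w; split=> //; nlia.
case: (I_dx K) => [E|dx]; first by rewrite E eqxx in xw.
have : (@dg (del_edge (f j)) x = 1 /\ @dg (del_edge (f j)) y = 2) \/
  (@dg (del_edge (f j)) x = 2 /\ @dg (del_edge (f j)) y = 1) by nlia.
by case=> -[d1 d2]; [exists x, y, u, w | exists y, x, u, w].
Qed.

Section TMfacts.
Variables (g : {set H}) (x y u w : H).
Hypotheses (mE : m = 3) (K : mate3 g x y u w).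
Let F := S_F (T_S K).

Lemma TM_E : g \in edges H.
Proof. by apply/edgesP; exists x, y; rewrite (S_f (T_S K)) (S_xy (T_S K)). Qed.

Lemma TM_dn (z : H) : z != x -> z != y -> @dg (del_edge g) z = dg z.
Proof. by move=> zx zy; apply: dg_notin; [exact: TM_E | rewrite (S_f (T_S K)) !inE negb_or zx]. Qed.

Lemma TM_dx : dg x = 2.
Proof. by rewrite (dg_in TM_E) ?(T_x K) // (S_f (T_S K)) set21. Qed.

Lemma TM_dy : dg y = 3.
Proof. by rewrite (dg_in TM_E) ?(T_y K) // (S_f (T_S K)) set22. Qed.

Lemma TM_du : dg u = 3.
Proof. by rewrite -TM_dn 1?eq_sym ?(T_xu K) ?(T_yu K) // (L_du F). Qed.

Lemma TM_big (z : H) : 2 < dg z -> [\/ z = y, z = u | z = w].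
Proof.
move=> d; case: (eqVneq z y) => zy; first by constructor 1.
case: (eqVneq z u) => zu; first by constructor 2.
case: (eqVneq z w) => zw; first by constructor 3.
case: (eqVneq z x) => zx; first by move: d; rewrite zx TM_dx.
have zq : z != q by apply: contraTneq d => ->; rewrite dg_isolated.
by have := L_dz F zq zu zw; rewrite TM_dn //; nlia.
Qed.

Lemma TM_leaf (a : H) : adj y a -> dg a = 1 -> y = w.
Proof.
move=> ya da; have ax : a != x by apply: contra_eqN da => /eqP ->; rewrite TM_dx.
have ay : a != y by rewrite eq_sym; apply: adj_neq.
have m1 : 1 < m by rewrite mE.
have da' : @dg (del_edge g) a = 1 by rewrite TM_dn.
have ay' : adj a y by rewrite adj_sym.
case/orP: (L_att F m1 da') => /del_sub h; rewrite adj_sym in h.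
  by have := T_yu K; rewrite (dg1_eq da ay' h) eqxx.
exact: (dg1_eq da ay' h).
Qed.

Lemma TM_full (z : H) : @full (del_edge g) z -> 2 < @dg (del_edge g) z ->
  exists a : H, adj z a /\ dg a = 1.
Proof.
move=> fz d; have [a [za ax da]] := @full_leaf (del_edge g) z x fz d.
exists a; split; first exact: (del_sub za).
rewrite -TM_dn //; apply: contra_eqN da => /eqP ->; by rewrite (T_y K).
Qed.
End TMfacts.

(** The vertex [y'] has degree 3, and it has no leaf unless it is [w']. For [n > 1] both [u] and [w]
    carry leaves, so [y' = y]. For [n = 1] the roles of [y] and [u] may be exchanged; then [x] and
    [x'] are both common neighbours, and [L_pn3] identifies them. *)
Lemma mate3_pair (g h : {set H}) (x y u w x' y' u' w' : H) : m = 3 -> (n = 1 -> p <> 3) ->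
  mate3 g x y u w -> mate3 h x' y' u' w' -> y' = y \/ [/\ n = 1, y' = u & x' = x].
Proof.
move=> mE np K K'; have F := S_F (T_S K); have F' := S_F (T_S K').
have d3 : 2 < dg y' by rewrite (TM_dy K').
have du3 : 2 < @dg (del_edge g) u by rewrite (L_du F) mE.
have du3' : 2 < @dg (del_edge h) u' by rewrite (L_du F') mE.
have [a [ua da]] := TM_full K (L_fu F) du3.
have [b [mates_bound db]] := TM_full K' (L_fu F') du3'.
case: (ltngtP n 1) => [|n1|n1]; first by nlia.
  left; have yw' := T_yw K' n1.
  have dw3 : 2 < @dg (del_edge g) w by rewrite (L_dw F); nlia.
  have [c [wc dc]] := TM_full K (L_fw F) dw3.
  case: (TM_big mE K d3) => E //.
    by rewrite -E in ua; rewrite (TM_leaf mE K' ua da) eqxx in yw'.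
  by rewrite -E in wc; rewrite (TM_leaf mE K' wc dc) eqxx in yw'.
have {}np := np n1.
have wy z u0 w0 g0 x0 y0 : mate3 g0 x0 y0 u0 w0 -> z = w0 -> 2 < dg z -> z = y0.
  move=> K0 -> d; apply/eqP; apply: contraTT d => wy0.
  have xw := T_xw K0; rewrite -(TM_dn K0) ?(L_dw (S_F (T_S K0))) ?n1 //; by rewrite eq_sym.
case: (TM_big mE K d3) => E; [by left | | by left; apply: (wy _ _ _ _ _ _ K)].
right; split=> //.
have Eu : u' = y.
  have d : 2 < dg u' by rewrite (TM_du mE K').
  case: (TM_big mE K d) => // E'; last exact: (wy _ _ _ _ _ _ K).
  by have := T_yu K'; rewrite E E' eqxx.
rewrite Eu in mates_bound; have yw := TM_leaf mE K mates_bound db.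
have yw' : y' = w' by rewrite -E in ua; exact: (TM_leaf mE K' ua da).
have m1 : 1 < m by rewrite mE.
have att (g0 : {set H}) (x0 y0 u0 w0 : H) : mate3 g0 x0 y0 u0 w0 -> y0 = w0 -> adj u0 x0.
  move=> K0 E0; case/orP: (L_att (S_F (T_S K0)) m1 (T_x K0)) => [/del_sub //|].
  by rewrite -E0 adj_del (S_f (T_S K0)) setUC eqxx andbF.
have ux := att _ _ _ _ _ K yw; have yx' := att _ _ _ _ _ K' yw'; rewrite Eu in yx'.
apply/eqP; apply: contraT => xx'.
have y'x' : adj u x' by rewrite -E adj_sym; exact: (S_xy (T_S K')).
have Ef := S_f (T_S K); case/negP: (L_pn3 F np x').
have xy := adj_neq (S_xy (T_S K)).
rewrite !adj_del y'x' -yw yx' Ef /=; apply/andP; split; apply/eqP => /set2_inj[[h1 h2]|[h1 h2]].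
- by have := T_xu K; rewrite h1 eqxx.
- by have := T_yu K; rewrite h1 eqxx.
- by rewrite h1 eqxx in xy.
- by rewrite h2 eqxx in xx'.
Qed.

Lemma mate3_eq (g h : {set H}) (x y u w u' w' : H) : mate3 g x y u w -> mate3 h x y u' w' -> g = h.
Proof. by move=> K K'; rewrite (S_f (T_S K)) (S_f (T_S K')). Qed.

Lemma isolated_mates_m3 : m = 3 -> (n = 1 -> p <> 3) -> k <= 2.
Proof.
move=> mE np; rewrite leqNgt; apply/negP => /leq3_cases[i [j [l [ij il jl]]]].
have [x [y [u [w K]]]] := mate3_of i mE; have [x' [y' [u' [w' K']]]] := mate3_of j mE.
have [x'' [y'' [u'' [w'' K'']]]] := mate3_of l mE.
have yu := T_yu K.
case: (mate3_pair mE np K K') => [E1|[n1 E1 E2]].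
  case: (mate3_pair mE np K K'') => [E3|[n1 E3 E4]].
    subst y' y''; apply: (no_three_mates_at_vertex (T_S K) (T_S K') (T_S K'')) => /fi //.
  case: (mate3_pair mE np K' K'') => [E5|[_ E5 E6]].
    by rewrite -E1 -E5 E3 eqxx in yu.
  by apply: ij; apply: fi; subst; apply: (mate3_eq K K').
case: (mate3_pair mE np K K'') => [E3|[_ E3 E4]].
  case: (mate3_pair mE np K' K'') => [E5|[_ E5 E6]].
    by rewrite -E3 E5 E1 eqxx in yu.
  by apply: il; apply: fi; subst; apply: (mate3_eq K K'').
by apply: jl; apply: fi; subst; apply: (mate3_eq K' K'').
Qed.

(** Here [y] is the middle of the path, with neighbours [u], [w] and [x] in [H]; only [x] has degree
    2. *)
Lemma isolated_mates_m3_p3 : m = 3 -> 1 < n -> p = 3 -> k <= 1.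
Proof.
move=> mE n1 pE; have := @pigeonhole k 1 (fun _ j => True) _ _; case=> //.
  by move=> j; exists ord0.
move=> _ i j _ _; apply: fi.
have [x [y [u [w K]]]] := mate3_of i mE; have [x' [y' [u' [w' K']]]] := mate3_of j mE.
have np : n = 1 -> p <> 3 by nlia.
case: (mate3_pair mE np K K') => [E|[]]; last by nlia.
subst y'; suff E : x' = x by subst x'; apply: (mate3_eq K K').
apply/eqP; apply: contraT => xx; have F := S_F (T_S K); have S := T_S K.
have /andP[uy wy] := L_p3 F pE (S_yq S) (T_yu K) (T_yw K n1) (T_y K).
have yx : @adj (del_edge (f i)) y x'.
  rewrite adj_del adj_sym (S_xy (T_S K')) /= (S_f S); apply: contraNneq xx.
  by move=> /set2_inj[[E1 E2]|[_ ->]] //; rewrite E2 E1.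
have d2 : @dg (del_edge (f i)) y <= 2 by rewrite (T_y K).
rewrite adj_sym in uy; rewrite adj_sym in wy.
have dx' := TM_dx K'.
case: (dg2_eq d2 uy wy yx (L_uw F)) => E.
  by rewrite E (TM_du mE K) in dx'.
by rewrite E -(TM_dn K) ?(L_dw F) 1?eq_sym ?(T_xw K) ?(T_yw K n1) // in dx'; nlia.
Qed.

(** [f] is the set of vertices of [H] with degree strictly between 2 and [m]. *)
Lemma isolated_mates_m_ge4 : 3 < m -> m <> n.+2 -> k <= 1.
Proof.
move=> m4 mn; have := @pigeonhole k 1 (fun _ j => True) _ _; case=> //.
  by move=> j; exists ord0.
move=> _ i j _ _; apply: fi.
have ends x y u w l : isolated_mate m n p q (f l) x y u w -> [/\ dg y = 3, 2 < dg x < m &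
    x != w -> m = 4 /\ dg x = 3].
  move=> K; have d := I_d K; have dy := I_dy K; have dx := I_dx K; have dw := L_dw (I_F K).
  rewrite (IM_dx K) (IM_dy K); case: (eqVneq x w) => [E|xw].
    by rewrite -E in dw; split=> //; nlia.
  case: dx => [E|dx]; first by rewrite E eqxx in xw.
  by split; nlia.
have [x [y [u [w K]]]] := leaf_mate_isolated (M i); have [x' [y' [u' [w' K']]]] := leaf_mate_isolated (M j).
have [dy dx xw] := ends _ _ _ _ _ K; have [dy' dx' xw'] := ends _ _ _ _ _ K'.
have sub z : z \in f j -> z \in f i.
  move=> zj; have [dz dz4] : 2 < dg z < m /\ (m = 4 -> dg z = 3).
    by move: zj; rewrite (I_f K') => /set2P[] ->; split=> //; nlia.
  rewrite (I_f K) !inE; apply: contraT; rewrite negb_or => /andP[zx zy].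
  have du := IM_du K; case: (eqVneq z u) => [E|zu]; first by rewrite E du in dz; nlia.
  case: (eqVneq z w) => [E|zw]; last by have := IM_dz K zx zy zu zw; nlia.
  have xw0 : x != w by rewrite -E eq_sym.
  have [mE _] := xw xw0; have := IM_dw K; rewrite (negPf xw0) addn0 -E => dz'; have := dz4 mE.
  by nlia.
apply/eqP; rewrite eq_sym eqEcard; apply/andP; split; first by apply/subsetP.
by rewrite (I_f K) (I_f K') !cards2 (adj_neq (I_xy K)) (adj_neq (I_xy K')).
Qed.

(** Typically [w] is joined to a leaf of [u]: both then have degree [m], and every mate joins one of
    them to a common neighbour, of which there are at most two, and only one if [p <> 3]. The other
    case, [n = 2], has three vertices [x], [y], [w] of degree 3, and mates are pairs of these. *)
Lemma isolated_mates_common : 3 < m -> m = n.+2 -> k <= 4 /\ (p <> 3 -> k <= 2).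
Proof.
move=> m4 mn.
have cl j : exists x y u w, isolated_mate m n p q (f j) x y u w /\
    ([/\ x = w, dg u = m, dg w = m, dg y = 2 & adj u y] \/
     [/\ x != w, n = 2, dg w = 3, dg x = 3 & dg y = 3]).
  have [x [y [u [w K]]]] := leaf_mate_isolated (M j); exists x, y, u, w; split=> //.
  have d := I_d K; have dy := I_dy K; have dx := I_dx K; have F := I_F K; have dw := L_dw F.
  have DW := IM_dw K; have DU := IM_du K; have m1 : 1 < m by nlia.
  case: (eqVneq x w) => [E|xw].
    rewrite -E in dw; have dy1 : @dg (del_edge (f j)) y = 1 by nlia.
    left; rewrite E eqxx in DW; split=> //; first by nlia.
      by rewrite (IM_dy K) dy1.
    case/orP: (L_att F m1 dy1) => [/del_sub //|].
    by rewrite adj_del (I_f K) -E eqxx andbF.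
  case: dx => [E|dx]; first by rewrite E eqxx in xw.
  by right; rewrite (negPf xw) in DW; rewrite (IM_dx K) (IM_dy K); split=> //; nlia.
case: (boolp.pselect (exists j x y u w, isolated_mate m n p q (f j) x y u w /\
    [/\ x != w, n = 2, dg w = 3, dg x = 3 & dg y = 3])) => [|noG].
  move=> [i [x [y [u [w [K [xw n2 dw dx dy]]]]]]].
  suff : k <= 2 by split; nlia.
  have DU := IM_du K.
  have inS j z : z \in f j -> [\/ z = x, z = y | z = w].
    move=> zf; have dz : dg z = 3.
      have [x' [y' [u' [w' [K' h]]]]] := cl j; case: h => [[E du' dw' _ _]|[_ _ _ h1 h2]].
        have nu : (u' != w') by apply: L_uw (I_F K').
        have big c : 3 < dg c -> c = u.
          move=> dc; case: (eqVneq c x) => [E'|cx]; first by rewrite E' dx in dc.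
          case: (eqVneq c y) => [E'|cy]; first by rewrite E' dy in dc.
          case: (eqVneq c w) => [E'|cw]; first by rewrite E' dw in dc.
          by apply/eqP; apply: contraT => cu; have := IM_dz K cx cy cu cw; nlia.
        have Eu : u' = u by apply: big; rewrite du'.
        have Ew : w' = u by apply: big; rewrite dw'.
        by rewrite Eu Ew eqxx in nu.
      by move: zf; rewrite (I_f K') => /set2P[] ->.
    case: (eqVneq z x) => [->|zx]; first by constructor 1.
    case: (eqVneq z y) => [->|zy]; first by constructor 2.
    case: (eqVneq z w) => [->|zw]; first by constructor 3.
    case: (eqVneq z u) => [E|zu]; first by rewrite E DU in dz; nlia.
    by have := IM_dz K zx zy zu zw; nlia.
  have cls j : f j = f i \/ f j = [set w; x] \/ f j = [set w; y].
    have [x' [y' [u' [w' K']]]] := leaf_mate_isolated (M j); have xy' := adj_neq (I_xy K').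
    have hx : x' \in f j by rewrite (I_f K') set21.
    have hy : y' \in f j by rewrite (I_f K') set22.
    rewrite (I_f K') (I_f K).
    move: xy'; case: (inS _ _ hx) => ->; case: (inS _ _ hy) => ->; rewrite ?eqxx // => _;
      first [by left | by left; rewrite setUC | by right; left | by right; left; rewrite setUC
      | by right; right | by right; right; rewrite setUC].
  have adjw j z : f j = [set w; z] -> adj w z.
    move=> E; have [x' [y' [u' [w' K']]]] := leaf_mate_isolated (M j); have := I_xy K'.
    have := I_f K'; rewrite E => /esym/set2_inj[[-> ->]|[-> ->]] //.
    by rewrite adj_sym.
  rewrite leqNgt; apply/negP => k3.
  pose KK (c : 'I_3) j := f j = nth (f i) [:: f i; [set w; x]; [set w; y]] c.
  have [] := @pigeonhole k 3 KK _ _.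
  - move=> j; case: (cls j) => [|[|]] E; [exists (Ordinal (isT : 0 < 3))
      | exists (Ordinal (isT : 1 < 3)) | exists (Ordinal (isT : 2 < 3))]; exact: E.
  - by move=> c a b h1 h2; apply: fi; rewrite h1 h2.
  move=> _ /(_ k3) all; have [a Ea] := all (Ordinal (isT : 1 < 3)).
  have [b Eb] := all (Ordinal (isT : 2 < 3)).
  have wx := adjw _ _ Ea; have wy := adjw _ _ Eb.
  have wf : w \notin f i by rewrite (I_f K) !inE negb_or !(eq_sym w) xw (I_yw K).
  (* All three pairs cannot be mates: [w] would have the two non-leaf neighbours [x] and [y] in
     [H - f i], where it is full. *)
  have := IM_dx K; have := IM_dy K; rewrite dx dy => -[dy'] [dx'].
  have := adj_neq (I_xy K); apply/negP; rewrite negbK; apply/eqP.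
  by apply: (L_fw (I_F K)); rewrite ?adj_notin // -?dx' -?dy'.
have {}cl j : exists y u w, [/\ isolated_mate m n p q (f j) w y u w, dg u = m, dg w = m, dg y = 2 & adj u y].
  have [x [y [u [w [K [[E h1 h2 h3 h4]|h]]]]]] := cl j; last by case: noG; exists j, x, y, u, w.
  by subst x; exists y, u, w.
case: (posnP k) => [->//|k0].
have [y [u [w [K du dw dy uy]]]] := cl (Ordinal k0).
have big c : dg c = m -> c = u \/ c = w.
  move=> dc; case: (eqVneq c w) => [E|cw]; first by right.
  have cy : c != y by apply: contra_eqN dc => /eqP ->; rewrite dy; nlia.
  left; apply/eqP; apply: contraT => cu; have := IM_dz K cw cy cu cw; nlia.
pose KK (z c : H) j := f j = [set c; z].
have norm j : exists z, [/\ dg z = 2, adj u z, adj w z & f j = [set u; z] \/ f j = [set w; z]].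
  have [y' [u' [w' [K' du' dw' dy' uy']]]] := cl j; exists y'.
  have wy' := I_xy K'; have nu := L_uw (I_F K'); have Ef := I_f K'.
  case: (big _ du') => E1; case: (big _ dw') => E2; subst u' w'; split=> //; auto.
    by rewrite eqxx in nu.
  by rewrite eqxx in nu.
have F := I_F K; have wy := I_xy K.
have inF (c z : H) : (c = u \/ c = w) -> z != y -> dg z = 2 -> adj c z -> @adj (del_edge (f (Ordinal k0))) c z.
  move=> hc zy dz cz; rewrite adj_del cz (I_f K); apply/eqP => /set2_inj[[_ E]|[_ E]].
    by rewrite E eqxx in zy.
  by rewrite E dw in dz; nlia.
have same a b z : dg z = 2 -> (f a = [set u; z] /\ f b = [set u; z]) \/
    (f a = [set w; z] /\ f b = [set w; z]) -> a = b.
  by move=> _ [[h1 h2]|[h1 h2]]; apply: fi; rewrite h1 h2.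
have pt z : z != y -> dg z = 2 -> @dg (del_edge (f (Ordinal k0))) z = 2.
  move=> zy dz; rewrite (IM_dn K) //; apply: contra_eqN dz => /eqP ->; rewrite dw; nlia.
split.
  pose K4 (c : 'I_4) j := exists z, [/\ dg z = 2, adj u z, (z == y) = (c < 2) &
    f j = [set (if odd c then u else w); z]].
  have [] // := @pigeonhole k 4 K4 _ _.
    move=> j; have [z [dz uz wz]] := norm j; case: (boolP (z == y)) => zy [] E.
    - by exists (Ordinal (isT : 1 < 4)), z.
    - by exists (Ordinal (isT : 0 < 4)), z.
    - by exists (Ordinal (isT : 3 < 4)), z; rewrite (negPf zy).
    - by exists (Ordinal (isT : 2 < 4)), z; rewrite (negPf zy).
  move=> c a b [z [dz uz zy Ea]] [z' [dz' uz' zy' Eb]]; apply: fi; rewrite Ea Eb.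
  congr [set _; _]; case: (boolP (c < 2)) => c2; rewrite ?c2 ?(negPf c2) in zy zy'.
    by rewrite (eqP zy) (eqP zy').
  move/negbT: zy => zy; move/negbT: zy' => zy'.
  by apply: (L_fu F); rewrite ?pt //; apply: inF => //; left.
move=> p3.
pose K2 (c : 'I_2) j := f j = [set (if val c == 0 then u else w); y].
have [] // := @pigeonhole k 2 K2 _ _; last first.
  by move=> c a b Ea Eb; apply: fi; rewrite Ea Eb.
move=> j; have [z [dz uz wz]] := norm j.
have -> : z = y.
  apply/eqP; apply: contraT => zy; case/negP: (L_pn3 F p3 z).
  by rewrite !inF //; [right | left].
by case=> E; [exists (Ordinal (isT : 0 < 2)) | exists (Ordinal (isT : 1 < 2))].
Qed.

Lemma isolated_mates_m1 : m = 1 -> k = 0.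
Proof.
move=> mE; case: (posnP k) => // k0; have [x [y [u [w K]]]] := leaf_mate_isolated (M (Ordinal k0)).
by have := IM_param K; nlia.
Qed.
End Orient.

(** * Disconnected graphs and the upper bounds *)

(** A mate of left type gives [H] a vertex of degree above [n]; a mate of right type bounds all
    degrees by [n]. *)
Lemma leaf_mates_not_mixed m n p (H : sgraph) (q : H) (f g : {set H}) : 1 < p -> 0 < m -> m < n -> 2 < n ->
  (forall z, ~~ adj q z) -> leaf_mate m n p f -> leaf_mate n m p g -> False.
Proof.
move=> p2 m0 mn n3 iq L R; have n0 : 0 < n by nlia.
have [x [y [u [w K]]]] := leaf_mate_isolated m0 n0 p2 iq L; have [x' [y' [u' [w' K']]]] := leaf_mate_isolated n0 m0 p2 iq R.
have dw := IM_dw K; suff : forall z : H, dg z <= n by move/(_ w); rewrite dw; nlia.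
move=> z; have d := I_d K'; have dy := I_dy K'; have dw' := IM_dw K'.
case: (eqVneq z y') => [->|zy]; first by rewrite (IM_dy K'); nlia.
case: (eqVneq z u') => [->|zu]; first by rewrite (IM_du K').
case: (eqVneq z w') => [->|zw].
  rewrite dw'; case: (eqVneq x' w') => [E|_]; last by nlia.
  by have := L_dw (I_F K'); rewrite -E; nlia.
case: (eqVneq z x') => [E|zx]; last by have := IM_dz n0 m0 p2 iq K' zx zy zu zw; nlia.
case: (I_dx K') => [E'|dx]; first by rewrite E E' eqxx in zw.
by rewrite E (IM_dx K'); nlia.
Qed.

Lemma path_mate_no_isolated m n p i (H : sgraph) (q : H) (f : {set H}) : 0 < m -> 0 < n ->
  (forall z, ~~ adj q z) -> path_mate m n p i f -> False.
Proof.
move=> m0 n0 iq [x [y [S [u [w [_ _ _ F]]]]]].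
have d0 : @dg (del_edge f) q = 0.
  by apply/eqP; rewrite cards_eq0; apply/eqP/setP => z; rewrite !inE adj_del (negPf (iq z)).
case: (eqVneq q u) => [E|qu]; first by have := P_du F; rewrite -E d0; nlia.
case: (eqVneq q w) => [E|qw]; first by have := P_dw F; rewrite -E d0; nlia.
by have := P_dz F qu qw; rewrite d0.
Qed.

(** Hence in a disconnected [H] without isolated vertices only path edges have mates. *)
Lemma leaf_mate_connected m n p (H : sgraph) (f : {set H}) :
  (forall q : H, exists z, adj q z) -> leaf_mate m n p f -> conn H.
Proof.
move=> ni [x [y [q [u [w [Ef xy _ F]]]]]] Z cZ a b aZ.
have [z qz] := ni q; have zq : z != q by rewrite eq_sym; apply: adj_neq.
have cF := adj_closed_del (f := f) cZ.
have [c cin cq] : exists2 c, c \in Z & c != q.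
  case: (eqVneq a q) => [E|]; last by exists a.
  by exists z => //; apply: cZ qz _; rewrite -E.
case: (eqVneq b q) => [->|bq]; last exact: (L_con F cF cin cq bq).
by apply: (cZ z); rewrite 1?adj_sym //; exact: (L_con F cF cin cq zq).
Qed.

Section Upper.
Variables (m n p : nat) (H : sgraph).
Hypotheses (m0 : 0 < m) (mn : m <= n) (p2 : 2 <= p).
Variables (k : nat) (e : 'I_k -> {set B m n p}) (f : 'I_k -> {set H}).
Hypotheses (ei : injective e) (fi : injective f) (M : forall j, mate (e j) (f j)).

Let n0 : 0 < n. Proof. by nlia. Qed.

Section Isolated.
Variable q : H.
Hypothesis iq : forall z, ~~ adj q z.

Lemma isolated_orientation : (1 < m /\ forall j, leaf_mate m n p (f j)) \/
  forall j, leaf_mate n m p (f j) /\ (m < n -> e j \in Redges m n p).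
Proof.
have cl j : leaf_mate m n p (f j) \/ leaf_mate n m p (f j) /\ (m < n -> e j \in Redges m n p).
  case: (mate_cases m0 n0 p2 (M j)) => [[_ L]|[[R L]|[i [_ _ P]]]]; [by left | by right |].
  by case: (path_mate_no_isolated m0 n0 iq P).
have m1L j : m = 1 -> leaf_mate m n p (f j) -> False.
  by move=> m1 L; have [x [y [u [w K]]]] := leaf_mate_isolated m0 n0 p2 iq L; have := IM_param m0 n0 p2 K; nlia.
case: (ltngtP m 1) => [|m1|m1]; first by nlia.
  case: (eqVneq m n) => [E|mn'].
    by left; split=> // j; case: (cl j) => [//|[+ _]]; rewrite E.
  have mn1 : m < n by nlia.
  have n3 : 2 < n by nlia.
  case: (boolp.pselect (exists j, leaf_mate m n p (f j))) => [[i L]|no]; [left|right].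
    by split=> // j; case: (cl j) => // -[R _]; case: (leaf_mates_not_mixed p2 m0 mn1 n3 iq L R).
  by move=> j; case: (cl j) => // L; case: no; exists j.
by right=> j; case: (cl j) => // L; case: (m1L j m1 L).
Qed.

Lemma iso_R : (forall j, leaf_mate n m p (f j) /\ (m < n -> e j \in Redges m n p)) -> m < n -> k <= n.
Proof.
move=> R mn'; rewrite -[k]card_ord -(card_imset _ ei).
apply: leq_trans (card_Redges m n p); apply/subset_leq_card/subsetP => g /imsetP[j _ ->].
by case: (R j) => _; apply.
Qed.

Lemma isolated_mates_bound : [/\ k <= 4, m = 1 -> n = 3 -> p = 3 -> k <= 3 & n <> m.+2 \/ p <> 3 -> k <= 2].
Proof.
case: isolated_orientation => [[m1 L]|R].
  suff : k <= 2 by split; nlia.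
  case: (ltngtP m 3) => h.
  - by apply: (isolated_mates_m2 m0 n0 p2 iq fi L); nlia.
  - have nm : m <> n.+2 by nlia.
    by have := isolated_mates_m_ge4 m0 n0 p2 iq fi L h nm; nlia.
  - by apply: (isolated_mates_m3 m0 n0 p2 iq fi L); nlia.
have L j : leaf_mate n m p (f j) by case: (R j).
case: (ltngtP n 3) => h.
- suff : k <= 2 by split; nlia.
  case: (ltngtP m n) => E; [by have := iso_R R E; nlia | by nlia |].
  case: (ltngtP n 2) => h2; [| by nlia | by apply: (isolated_mates_m2 n0 m0 p2 iq fi L); nlia].
  by rewrite (isolated_mates_m1 n0 m0 p2 iq L); nlia.
- case: (eqVneq n m.+2) => [E|/eqP E].
    by have [h1 h2] := isolated_mates_common n0 m0 p2 iq fi L h E; split=> //; [nlia | case=> // /h2].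
  by have := isolated_mates_m_ge4 n0 m0 p2 iq fi L h E; split; nlia.
- case: (boolp.pselect (m = 1 /\ p = 3)) => [[m1 p3]|np].
    have lt : m < n by nlia.
    by have := iso_R R lt; split; nlia.
  suff : k <= 2 by split; nlia.
  by apply: (isolated_mates_m3 n0 m0 p2 iq fi L); nlia.
Qed.

Lemma isolated_mates_le1 : (p = 3 -> m = 3 -> n <> 5 -> k <= 1) /\ (3 < m -> n <> m.+2 -> k <= 1).
Proof.
case: isolated_orientation => [[m1 L]|R]; split.
- by move=> p3 m3 _; apply: (isolated_mates_m3_p3 m0 n0 p2 iq fi L); nlia.
- by move=> m4 nm; apply: (isolated_mates_m_ge4 m0 n0 p2 iq fi L); nlia.
- move=> p3 m3 n5; have L j : leaf_mate n m p (f j) by case: (R j).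
  case: (ltngtP n 3) => h; first by nlia.
    by apply: (isolated_mates_m_ge4 n0 m0 p2 iq fi L); nlia.
  by apply: (isolated_mates_m3_p3 n0 m0 p2 iq fi L); nlia.
- move=> m4 nm; have L j : leaf_mate n m p (f j) by case: (R j).
  by apply: (isolated_mates_m_ge4 n0 m0 p2 iq fi L); nlia.
Qed.

Lemma isolated_mates_none : (p = 2 -> m <> 2 -> n <> 2 -> n <> m.+2 -> k = 0) /\
  (p = 3 -> n <> m.+2 -> 3 < m \/ m = 1 /\ 3 < n -> k = 0).
Proof.
case: (posnP k) => // k0; pose j := Ordinal k0.
have [[x [y [u [w K]]]]|[m1 [x [y [u [w K]]]]]] :
    (exists x y u w, isolated_mate n m p q (f j) x y u w) \/
    (1 < m /\ exists x y u w, isolated_mate m n p q (f j) x y u w).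
- case: isolated_orientation => [[m1 L]|R]; [right; split=> //|left]; first exact: (leaf_mate_isolated m0 n0 p2 iq (L j)).
  by case: (R j) => L _; exact: (leaf_mate_isolated n0 m0 p2 iq L).
- by have h2 := IM_p2 n0 m0 p2 K; have h3 := IM_p3 n0 m0 p2 K; split=> pE; [have := h2 pE | have := h3 pE]; nlia.
- by have h2 := IM_p2 m0 n0 p2 K; have h3 := IM_p3 m0 n0 p2 K; split=> pE; [have := h2 pE | have := h3 pE]; nlia.
Qed.
End Isolated.

Section Disconnected.
Hypotheses (ni : forall q : H, exists z, adj q z) (nc : ~ conn H).

Lemma disconnected_mate_path j : exists i, [/\ 0 < i < p, path_edge i (e j) & path_mate m n p i (f j)].
Proof.
case: (mate_cases m0 n0 p2 (M j)) => [[_ L]|[[_ L]|//]]; case: nc; exact: (leaf_mate_connected ni L).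
Qed.

Lemma disconnected_closed_set : exists A a b, [/\ @adj_closed H A, a \in A & b \notin A].
Proof.
apply: boolp.contrapT => no; apply: nc => Z cZ a b aZ.
by apply: boolp.contrapT => /negP bZ; apply: no; exists Z, a, b.
Qed.

(** A fixed proper closed set of [H] is one of the two components of every [H - f]; its size leaves
    two values for [i]. *)
Lemma disconnected_mates_le2 : k <= 2.
Proof.
have [A [a [b [cA aA bA]]]] := disconnected_closed_set.
pose K (c : 'I_2) j := exists i, [/\ 0 < i < p, path_edge i (e j) &
  #|A| = if val c == 0 then m + i else p + m + n - (m + i)].
have [] // := @pigeonhole k 2 K _ _.
  move=> j; have [i [ip iP [x [y [S [u [w [_ _ _ F]]]]]]]] := disconnected_mate_path j.
  have cd : #|H| = p + m + n by rewrite -(mate_card (M j)) card_ord.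
  case: (pathdel_closed_size F (adj_closed_del (f := f j) cA) aA bA) => E.
    by exists (Ordinal (isT : 0 < 2)), i.
  by exists (Ordinal (isT : 1 < 2)), i; split=> //; rewrite E -cd.
move=> c j l [i [ip iP E]] [i' [ip' iP' E']]; apply: ei.
have Ei : i = i' by case: (val c == 0) E E'; move: #|A| => N; nlia.
by subst i'; exact: (path_edge_inj iP iP').
Qed.

(* Each match splits [H] the same way, so the deleted edge lies inside one side of the split. *)
Lemma disconnected_mate_side j : exists i x y (S : {set H}) (u w : H), [/\ 0 < i < p, path_edge i (e j),
  f j = [set x; y] /\ adj x y, (x \in S) = (y \in S) &
  [/\ @dg (del_edge (f j)) x + @dg (del_edge (f j)) y =
      (if i == 1 then m else 1) + (if i.+1 == p then n else 1),
      @pathdel m n p i (del_edge (f j)) S u w & @adj_closed H S]].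
Proof.
have [A [a [b [cA aA bA]]]] := disconnected_closed_set.
have [i [ip iP [x [y [S [u [w [Ef xy d F]]]]]]]] := disconnected_mate_path j.
have side c d' : (c \in S) = (d' \in S) -> (c \in A) = (d' \in A).
  move=> E; apply/idP/idP => h.
    exact: (P_con F (adj_closed_del (f := f j) cA) h E).
  by apply: (P_con F (adj_closed_del (f := f j) cA) h).
have xyA : (x \in A) = (y \in A).
  by apply/idP/idP => h; apply: cA h => //; rewrite adj_sym.
have xyS : (x \in S) = (y \in S).
  apply/eqP; apply: contraNT bA => xyS.
  have [c [cS Ec]] : exists c, (a \in S) = (c \in S) /\ (c = x \/ c = y).
    by case: (a \in S) xyS; case: (boolP (x \in S)) => h1; case: (boolP (y \in S)) => h2 // _;
      [exists x | exists y | exists y | exists x]; rewrite ?h1 ?(negPf h1) ?h2 ?(negPf h2); auto.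
  have xA : x \in A by move: aA; rewrite (side _ _ cS); case: Ec => ->; rewrite ?xyA.
  case: (boolP (b \in S)) => bS.
    case: (boolP (x \in S)) => xS; first by rewrite (side b x) // bS xS.
    rewrite (side b y) -?xyA // bS; move: xyS; rewrite (negPf xS); by case: (y \in S).
  case: (boolP (x \in S)) => xS; last by rewrite (side b x) // (negPf bS) (negPf xS).
  rewrite (side b y) -?xyA // (negPf bS); move: xyS; rewrite xS; by case: (y \in S).
exists i, x, y, S, u, w; split=> //; split=> // c d' cd.
case: (eqVneq [set c; d'] (f j)) => [|ne].
  by rewrite Ef => /set2_inj[[-> ->]|[-> ->]]; rewrite xyS.
by apply: (P_cl F); rewrite adj_del cd.
Qed.

(** When [S] is a star in [H - f], an additional edge inside it joins two of its leaves, so the edge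
    degree is 2. *)
Lemma star_side i x y (S : {set H}) u w j : f j = [set x; y] -> adj x y -> x \in S -> y \in S ->
  @pathdel m n p i (del_edge (f j)) S u w -> i <= 2 ->
  [/\ @dg (del_edge (f j)) x = 1, @dg (del_edge (f j)) y = 1 & 1 < m + (1 < i)].
Proof.
move=> Ef xy xS yS F i2; have st := P_su F i2.
have xu : x != u.
  apply/eqP => E; have yu : y != u by rewrite -E eq_sym adj_neq.
  by have /andP[] := st _ yS yu; rewrite -E adj_del Ef eqxx andbF.
have yu : y != u.
  apply/eqP => E; have /andP[] := st _ xS xu.
  by rewrite -E adj_del Ef setUC eqxx andbF.
have /andP[ux /eqP dx] := st _ xS xu; have /andP[uy /eqP dy] := st _ yS yu.
by split; [exact: dx | exact: dy | rewrite -(P_du F); exact: (dg_ge2 ux uy (adj_neq xy))].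
Qed.

Lemma star_side' i x y (S : {set H}) u w j : f j = [set x; y] -> adj x y -> x \notin S -> y \notin S ->
  @pathdel m n p i (del_edge (f j)) S u w -> p <= i.+2 ->
  [/\ @dg (del_edge (f j)) x = 1, @dg (del_edge (f j)) y = 1 & 1 < n + (i.+1 < p)].
Proof.
move=> Ef xy xS yS F i2; have st := P_sw F i2.
have xw : x != w.
  apply/eqP => E; have yw : y != w by rewrite -E eq_sym adj_neq.
  by have /andP[] := st _ yS yw; rewrite -E adj_del Ef eqxx andbF.
have yw : y != w.
  apply/eqP => E; have /andP[] := st _ xS xw.
  by rewrite -E adj_del Ef setUC eqxx andbF.
have /andP[wx /eqP dx] := st _ xS xw; have /andP[wy /eqP dy] := st _ yS yw.
by split; [exact: dx | exact: dy | rewrite -(P_dw F); exact: (dg_ge2 wx wy (adj_neq xy))].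
Qed.

Lemma disconnected_mates_small_p : (p = 2 -> k = 0) /\ (p = 3 -> (1 < m -> k = 0) /\ (1 < n -> k <= 1)).
Proof.
have h2 (j : 'I_k) : p <> 2.
  move=> pE; have [i [x [y [S [u [w [ip iP [Ef xy] xyS [d F cS]]]]]]]] := disconnected_mate_side j.
  have i1 : i = 1 by nlia.
  case: (boolP (x \in S)) => xS; have yS := xS; rewrite xyS in yS.
    have i2 : i <= 2 by nlia.
    have [h1 h2 h3] := star_side Ef xy xS yS F i2.
    by move: d h3; rewrite h1 h2 i1 pE /=; nlia.
  have i2 : p <= i.+2 by nlia.
  have [h1 h2 h3] := star_side' Ef xy xS yS F i2.
  by move: d h3; rewrite h1 h2 i1 pE /=; nlia.
have h3 (j : 'I_k) i : p = 3 -> 0 < i < p -> path_edge i (e j) -> i = 1 /\ m = 1 \/ i = 2 /\ n = 1.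
  move=> pE ip0 iP0; have [i' [x [y [S [u [w [ip iP [Ef xy] xyS [d F cS]]]]]]]] := disconnected_mate_side j.
  have E : i' = i.
    case: iP iP0 => a [b [E1 a1 b1]] [a' [b' [E2 a2 b2]]].
    by move: E2; rewrite E1 => /set2_inj[[E3 E4]|[E3 E4]]; subst a b; nlia.
  subst i'; have i12 : i = 1 \/ i = 2 by nlia.
  case: (boolP (x \in S)) => xS; have yS := xS; rewrite xyS in yS.
    have i2 : i <= 2 by nlia.
    have [h1 h4 h5] := star_side Ef xy xS yS F i2; move: d h5; rewrite h1 h4 pE.
    by case: i12 => -> /=; nlia.
  have i2 : p <= i.+2 by nlia.
  have [h1 h4 h5] := star_side' Ef xy xS yS F i2; move: d h5; rewrite h1 h4 pE.
  by case: i12 => -> /=; nlia.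
case: (posnP k) => [->//|k0]; have hk2 := h2 (Ordinal k0); split=> // pE.
have cl j : n = 1 \/ (m = 1 /\ path_edge 1 (e j)).
  have [i [ip iP _]] := disconnected_mate_path j; case: (h3 j i pE ip iP) => [[E mE]|[_ nE]]; last by left.
  by right; split=> //; subst i.
split=> h; first by case: (cl (Ordinal k0)) => [|[E _]]; nlia.
have := @pigeonhole k 1 (fun _ j => path_edge 1 (e j)) _ _; case=> //.
  by move=> j; exists ord0; case: (cl j) => [|[_]]; first by nlia.
by move=> _ i j h4 h5; apply: ei; exact: path_edge_inj h4 h5.
Qed.

(** The degree sums exclude the end edges of the path. For [m < n] the vertex of degree [m + 1] is
    then determined by [H], and the size of its component gives [i]; for [n = m] and [p = 4] only
    [i = 2] is left. *)
Lemma disconnected_mates_le1 : 3 < m -> 3 < p -> n <> m.+1 -> n <> m.+2 -> (n = m -> p = 4) -> k <= 1.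
Proof.
move=> m4 p4 n1 n2 np.
have cl j : exists i x y (S : {set H}) (u w : H), [/\ 1 < i < p.-1, path_edge i (e j),
    f j = [set x; y] /\ adj x y, dg u = m.+1 /\ dg w = n.+1 &
  [/\ forall z : H, z != u -> z != w -> dg z <= 2, @pathdel m n p i (del_edge (f j)) S u w & @adj_closed H S]].
  have [i [x [y [S [u [w [ip iP [Ef xy] xyS [d F cS]]]]]]]] := disconnected_mate_side j.
  have dz (z : H) : z <> u -> z <> w -> 1 <= @dg (del_edge (f j)) z <= 2.
    by move=> /eqP zu /eqP zw; exact: (P_dz F zu zw).
  have du := P_du F; have dw := P_dw F; have uS := P_u F; have wS := P_w F.
  have pos (z : H) : 0 < @dg (del_edge (f j)) z.
    case: (eqVneq z u) => [->|/eqP zu]; first by nlia.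
    case: (eqVneq z w) => [->|/eqP zw]; first by nlia.
    by have := dz _ zu zw; nlia.
  have px := pos x; have py := pos y.
  have i1 : i <> 1.
    move=> E; subst i; rewrite eqxx (_ : (2 == p) = false) in d; last by apply/eqP; nlia.
    case: (boolP (x \in S)) => xS; have yS := xS; rewrite xyS in yS.
      have [h1 h2 h3] := star_side Ef xy xS yS F isT; move: d h3; rewrite h1 h2 /=; nlia.
    have xu : x <> u by move=> E; rewrite E uS in xS.
    have yu : y <> u by move=> E; rewrite E uS in yS.
    case: (eqVneq x w) => [E|/eqP xw]; first by move: d; rewrite E dw /=; nlia.
    case: (eqVneq y w) => [E|/eqP yw]; first by move: d; rewrite E dw /=; nlia.
    by move: d; have := dz _ xu xw; have := dz _ yu yw; nlia.
  have i2 : i.+1 <> p.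
    move=> E; case: (boolP (x \in S)) => xS; have yS := xS; rewrite xyS in yS.
      have xw : x <> w by move=> E'; rewrite -E' xS in wS.
      have yw : y <> w by move=> E'; rewrite -E' yS in wS.
      rewrite E eqxx (_ : (i == 1) = false) in d; last by apply/eqP.
      case: (eqVneq x u) => [Ex|/eqP xu].
        have yu : y <> u by rewrite -Ex => /esym/eqP; apply/negP; exact: adj_neq.
        by have := dz _ yu yw; move: d; rewrite Ex du; nlia.
      case: (eqVneq y u) => [Ey|/eqP yu].
        by have := dz _ xu xw; move: d; rewrite Ey du; nlia.
      by have := dz _ xu xw; have := dz _ yu yw; nlia.
    have ip' : p <= i.+2 by nlia.
    have [h1 h2 _] := star_side' Ef xy xS yS F ip'; move: d; rewrite h1 h2 E eqxx; case: (_ == _); nlia.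
  have [dx1 dy1] : @dg (del_edge (f j)) x = 1 /\ @dg (del_edge (f j)) y = 1.
    by move: d; rewrite (_ : (i == 1) = false) 1?(_ : (i.+1 == p) = false); [nlia | apply/eqP..].
  have nxy (c : H) : 2 < @dg (del_edge (f j)) c -> c \notin f j.
    move=> d2; apply/negP => cf; have : c \in [set x; y] by rewrite -Ef.
    by case/set2P => E; rewrite E ?dx1 ?dy1 in d2.
  have fE : f j \in edges H by apply/edgesP; exists x, y.
  have iplus : 1 < i by nlia.
  have iplus' : i.+1 < p by nlia.
  exists i, x, y, S, u, w; split; [by rewrite iplus /=; nlia | by [] | by [] | |].
    have nu : u \notin f j by apply: nxy; rewrite du; nlia.
    have nw : w \notin f j by apply: nxy; rewrite dw; nlia.
    by rewrite -(dg_notin fE nu) -(dg_notin fE nw) du dw iplus iplus' !addn1.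
  split=> // z /eqP zu /eqP zw; case: (boolP (z \in f j)) => zf; last first.
    by rewrite -(dg_notin fE) //; have := dz _ zu zw; nlia.
  rewrite (dg_in fE) //; have : z \in [set x; y] by rewrite -Ef.
  by case/set2P => ->; rewrite ?dx1 ?dy1.
have := @pigeonhole k 1 (fun _ j => True) _ _; case=> //.
  by move=> j; exists ord0.
move=> _ j l _ _; apply: ei.
have [i [x [y [S [u [w [ip iP _ [du dw] [dz F cS]]]]]]]] := cl j.
have [i' [x' [y' [S' [u' [w' [ip' iP' _ [du' dw'] [_ F' cS']]]]]]]] := cl l.
suff E : i = i' by subst i'; exact: path_edge_inj iP iP'.
case: (eqVneq n m) => [/np p4'|nm]; first by nlia.
have E : u' = u.
  case: (eqVneq u' u) => // uu; case: (eqVneq u' w) => [E|uw]; first by rewrite E dw in du'; nlia.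
  by have := dz _ uu uw; nlia.
have SS : S = S'.
  apply/setP => z; apply/idP/idP => zS.
    by apply: (P_con F (adj_closed_del (f := f j) cS') (a := u)); rewrite ?(P_u F) ?zS // -E (P_u F').
  by apply: (P_con F' (adj_closed_del (f := f l) cS) (a := u')); rewrite ?(P_u F') ?zS // E (P_u F).
by have := P_S F'; rewrite -SS (P_S F); nlia.
Qed.
End Disconnected.
End Upper.

(** The clauses correspond to the values 5, 4, 3, 2, 1, each diminished by one; [family_rest] leads
    to the list of the fourth. *)
Definition mates_bound (m n p k : nat) : Prop :=
  k <= 4 /\
  ((m = 1 /\ n = 2 /\ p = 5) \/ (m = 1 /\ n = 3 /\ p = 3) \/ (m = 2 /\ 5 <= p) -> k <= 3) /\
  (family3 m n p -> k <= 2) /\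
  ((m = 1 /\ 4 <= n /\ p = 3) \/ (m = 3 /\ n <> 5 /\ p = 3) \/
     (4 <= m /\ 4 <= p /\ n <> m.+1 /\ n <> m.+2 /\ (n <> m \/ p = 4)) -> k <= 1) /\
  ((p = 2 /\ m <> 2 /\ n <> 2 /\ n <> m.+2) \/ (p = 3 /\ 4 <= m /\ n <> m.+2) -> k = 0).

Lemma path_small p (H : sgraph) (e : {set B 1 1 p}) (f : {set H}) : 1 < p -> conn H -> mate e f ->
  forall z : H, dg z <= 2.
Proof.
move=> p2 cH M z; have fE : f \in edges H by case: M.
have l1 : 0 < 1 by [].
have Lcase : leaf_mate 1 1 p f -> dg z <= 2.
  move=> /(leaf_mate_conn cH)[c [q [u [w [Ef qc d dq F]]]]].
  case: (eqVneq z q) => [->|zq]; first by rewrite dq.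
  case: (eqVneq z c) => [->|zc]; first by rewrite (dg_in fE) ?d // Ef set22.
  rewrite -(dg_notin fE); last by rewrite Ef !inE negb_or zq.
  case: (eqVneq z u) => [->|zu]; first by rewrite (L_du F).
  case: (eqVneq z w) => [->|zw]; first by rewrite (L_dw F).
  by have := L_dz F zq zu zw; nlia.
case: (mate_cases l1 l1 p2 M) => [[_ /Lcase //]|[[_ /Lcase //]|[i [ip iP [x [y [S [u [w [Ef xy d F]]]]]]]]]].
have dF (c : H) : 0 < @dg (del_edge f) c <= 2.
  case: (eqVneq c u) => [->|cu]; first by rewrite (P_du F); case: (1 < i).
  case: (eqVneq c w) => [->|cw]; first by rewrite (P_dw F); case: (i.+1 < p).
  exact: (P_dz F cu cw).
have hx := dF x; have hy := dF y; have hz := dF z.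
have {}d : @dg (del_edge f) x + @dg (del_edge f) y = 2 by move: d; do 2?case: ifP.
case: (boolP (z \in f)) => zf; last by rewrite -(dg_notin fE) //; nlia.
rewrite (dg_in fE) //; have : z \in [set x; y] by rewrite -Ef.
by case/set2P => ->; nlia.
Qed.

Section UpperBound.
Variables (m n p : nat) (H : sgraph).
Hypotheses (m0 : 0 < m) (mn : m <= n) (p2 : 2 <= p) (niso : ~ graph_iso H (B m n p)).
Variables (k : nat) (e : 'I_k -> {set B m n p}) (f : 'I_k -> {set H}).
Hypotheses (ei : injective e) (fi : injective f) (M : forall j, mate (e j) (f j)).

Lemma tree_mates_none : conn H -> 2 < m -> p <= 3 -> k = 0.
Proof.
move=> cH m3 p3; case: (posnP k) => // k0; have m1 : 1 < m by nlia. have n1 : 1 < n by nlia.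
by case: (tree_mate_kind m1 n1 p2 cH niso (M (Ordinal k0))) => -[]; nlia.
Qed.

Lemma mates_bound_isolated (q : H) : (forall z, ~~ adj q z) -> mates_bound m n p k.
Proof.
move=> iq; have [h4 h3 h2] := isolated_mates_bound m0 mn p2 ei fi M iq.
have [h1 h1'] := isolated_mates_le1 m0 mn p2 fi M iq; have [h0 h0'] := isolated_mates_none m0 mn p2 M iq.
split=> //; split; last split; last split.
- case=> [[mE [nE pE]]|[[mE [nE pE]]|[mE pE]]]; last 1 first.
  + have c : n <> m.+2 \/ p <> 3 by nlia.
    by have := h2 c; nlia.
  + have c : n <> m.+2 \/ p <> 3 by nlia.
    by have := h2 c; nlia.
  + exact: h3.
- by rewrite /family3 => F; apply: h2; nlia.
- case=> [[mE [nE pE]]|[[mE [nE pE]]|[mE [pE [n1 [n2 np]]]]]].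
  + rewrite h0' //; [nlia | by right].
  + by apply: h1.
  + by apply: h1'.
- case=> [[pE [m2 [n2 nm]]]|[pE [m4 nm]]]; first exact: h0.
  by apply: h0' => //; left.
Qed.

Lemma mates_bound_disconnected : (forall q : H, exists z, adj q z) -> ~ conn H -> mates_bound m n p k.
Proof.
move=> ni nc; have h2 := disconnected_mates_le2 m0 mn p2 ei M ni nc.
have [h0 h1] := disconnected_mates_small_p m0 mn p2 ei M ni nc.
have h := disconnected_mates_le1 m0 mn p2 ei M ni nc.
split; [nlia | split; [nlia | split=> //; split]].
- case=> [[mE [nE pE]]|[[mE [nE pE]]|[mE [pE [n1 [n2 np]]]]]].
  + by apply: (h1 pE).2; nlia.
  + by apply: (h1 pE).2; nlia.
  + by apply: h => //; nlia.
- case=> [[pE _]|[pE [m4 nm]]]; first by rewrite h0.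
  by apply: (h1 pE).1; nlia.
Qed.
End UpperBound.

Lemma mates_bound_connected m n p (H : sgraph) k (e : 'I_k -> {set B m n p}) (f : 'I_k -> {set H}) :
  0 < m -> m <= n -> 1 < p -> ~ graph_iso H (B m n p) -> injective e -> injective f ->
  (forall j, mate (e j) (f j)) -> conn H -> mates_bound m n p k.
Proof.
move=> m0 mn p2 niso ei fi M cH; rewrite /mates_bound /family3.
have [m3|[mE|m1]] : 2 < m \/ m = 2 \/ m < 2 by nlia.
- have m1 : 1 < m by nlia. have n1 : 1 < n by nlia. have n3 : 2 < n by nlia.
  have h2 := tree_mates_le2 m1 n1 p2 cH niso fi M m3 n3.
  have h1 := tree_mates_le1 m1 n1 p2 cH niso fi M m3 n3.
  have h0 := tree_mates_none m0 mn p2 niso M cH m3.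
  have [p3|p3] : p <= 3 \/ 3 < p by nlia.
     by have := h0 p3; do !split; nlia.
  have [E|E] : n = m.+1 \/ n <> m.+1 by nlia.
    by do !split; nlia.
  have mn1 : m <> n.+1 by nlia.
  by have := h1 mn1 E; do !split; nlia.
- have m1 : 1 < m by nlia. have n1 : 1 < n by nlia.
  have [h3 h2] := tree_mates_m2 m1 n1 p2 cH niso ei fi M mE.
  have [p4|p4] : p <= 4 \/ 4 < p by nlia.
    by have := h2 p4; do !split; nlia.
  by do !split; nlia.
have mE : m = 1 by nlia.
subst m; have [n1|[n3|nE]] : n < 2 \/ 2 < n \/ n = 2 by nlia.
- have nE : n = 1 by nlia.
  subst n; suff : k = 0 by do !split; nlia.
  case: (posnP k) => // k0; have M0 := M (Ordinal k0); case: niso.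
  have cd := mate_card M0; rewrite card_ord in cd.
  exact: (path_of_conn p2 cH (esym cd) (esym (mate_sum M0)) (path_small p2 cH M0)).
- have n1 : 1 < n by nlia.
  have [h2 [h1 h0]] := spider_mates_n_ge3 n1 p2 cH niso ei fi M n3.
  have [pE|[pE|pE]] : 3 < p \/ p = 3 \/ p < 3 by nlia.
  + by do !split; nlia.
  + by have := h1 pE; do !split; nlia.
  have pE' : p = 2 by nlia.
  by have := h0 pE'; do !split; nlia.
have n1 : 1 < n by nlia.
have [h4 h3 h2 h0] := spider_mates_n2 n1 p2 cH niso ei fi M nE.
have [pE|p5] : p = 5 \/ p <> 5 by nlia.
  by have := h3 pE; do !split; nlia.
have [pE|p3] : p = 3 \/ p <> 3 by nlia.
  by have := h2 pE; do !split; nlia.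
have [pE|p2'] : p = 2 \/ p <> 2 by nlia.
  by have := h0 pE; do !split; nlia.
by do !split; nlia.
Qed.

Lemma common_bound m n p (H : sgraph) k : 0 < m -> m <= n -> 1 < p -> common k (B m n p) H ->
  ~ graph_iso H (B m n p) -> mates_bound m n p k.
Proof.
move=> m0 mn p2 [e [f [ei fi M]]] niso.
case: (boolp.pselect (conn H)) => [cH|nc]; first exact: (mates_bound_connected m0 mn p2 niso ei fi M cH).
case: (boolp.pselect (exists q : H, forall z, ~~ adj q z)) => [[q iq]|no].
  exact: (mates_bound_isolated m0 mn p2 ei fi M iq).
apply: (mates_bound_disconnected m0 mn p2 ei M _ nc) => q; apply: boolp.contrapT => h; apply: no.
by exists q => z; apply/negP => qz; apply: h; exists z.
Qed.

(** * Adversaries obtained by moving one edge *)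

(** Restoring an edge raises the sum of squared degrees by twice its edge degree plus 2. *)
Lemma mate_sum_sqr (G H : sgraph) (e : {set G}) (f : {set H}) : mate e f ->
  \sum_(x : G) dg x ^ 2 = \sum_(x : H) dg x ^ 2.
Proof.
case=> /edgesP[x [y [xy ->]]] /edgesP[x' [y' [xy' ->]]] /(iso_sum (fun d => d ^ 2)) iso.
rewrite !edge_degreeE //.
have := @sum_del _ _ _ (fun d => d ^ 2) xy; have := @sum_del _ _ _ (fun d => d ^ 2) xy'.
rewrite /= iso; move: (\sum_(z : G) _) (\sum_(z : H) _) (\sum_(z : del_edge _) _) => *; nia.
Qed.

Lemma mate_of_iso (G H : sgraph) (e0 e : {set G}) (f0 f : {set H}) : mate e0 f0 ->
  e \in edges G -> f \in edges H -> graph_iso (del_edge e) (del_edge f) -> mate e f.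
Proof.
move=> M eE fE iso; split=> //; have := mate_sum_sqr M.
case/edgesP: eE iso => x [y [xy ->]]; case/edgesP: fE => x' [y' [xy' ->]].
move=> /(iso_sum (fun d => d ^ 2)) iso; rewrite !edge_degreeE //.
have := @sum_del _ _ _ (fun d => d ^ 2) xy; have := @sum_del _ _ _ (fun d => d ^ 2) xy'.
rewrite /= iso; move: (\sum_(z : G) _) (\sum_(z : H) _) (\sum_(z : del_edge _) _) => *; nia.
Qed.

Lemma sum_del_eq (G H : sgraph) (a b : G) (c d : H) : adj a b -> adj c d ->
  \sum_(x : G) dg x = \sum_(x : H) dg x ->
  \sum_(x : del_edge [set c; d]) dg x = \sum_(x : del_edge [set a; b]) dg x.
Proof. by move=> ab cd E; have := @sum_del _ _ _ id ab; have := @sum_del _ _ _ id cd; lia. Qed.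

Definition pair (x y a b : nat) : bool := (x == a) && (y == b) || (x == b) && (y == a).

Section Swap.
Variables (m n p a b c d : nat).

Definition swap_rel (x y : nat) : bool := broom_rel m p x y && ~~ pair x y a b || (x == c) && (y == d).

Definition swap_graph : sgraph := nat_graph (p + m + n) swap_rel.

Definition edge_set N (R : rel nat) (x y : nat) : {set nat_graph N R} := [set z : nat_graph N R | (z == x :> nat) || (z == y :> nat)].

Lemma edge_setE N (R : rel nat) (x y : nat_graph N R) : [set x; y] = edge_set N R x y.
Proof. by apply/setP => z; rewrite !inE -!val_eqE. Qed.

Definition degB (x : nat) : nat :=
  if x < p then (if x == 0 then m.+1 else if x.+1 == p then n.+1 else 2) else 1.

Let N := p + m + n.

(* [x] and [y] are adjacent after deleting the edge [(u, v)] from [swap_graph]. *)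
Definition swap_del (u v x y : nat) : bool := (swap_rel x y || swap_rel y x) && ~~ pair x y u v.

(** The last equation says that [ab] and [cd] have the same edge degree over their common card,
    freed of subtractions. *)
Definition swap_ok : bool :=
  [&& 1 < p, a < N, b < N, c < N, d < N, broom_rel m p a b, ~~ broom_rel m p c d, ~~ broom_rel m p d c, c != d &
   degB a + degB b + ((c == a) || (c == b)) + ((d == a) || (d == b)) == degB c + degB d + 2].

Hypothesis ok : swap_ok.

Lemma ed_lt x y : broom_rel m p x y -> x < y.
Proof. by case/andP: ok => p2 _; rewrite /broom_rel; lia. Qed.

Lemma pairC x y u v : pair x y u v = pair y x u v.
Proof. by rewrite /pair orbC; congr (_ || _); rewrite andbC. Qed.

Lemma sw_delE : ~~ broom_rel m p c d -> ~~ broom_rel m p d c -> forall x y,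
  swap_del c d x y = (broom_rel m p x y || broom_rel m p y x) && ~~ pair x y a b.
Proof.
move=> nE nE' x y; rewrite /swap_del /swap_rel (pairC y x); case: (boolP (pair x y c d)) => [|np].
  by rewrite andbF => /orP[]/andP[/eqP -> /eqP ->]; rewrite (negPf nE) (negPf nE').
have -> : (x == c) && (y == d) = false by apply: contraNF np => h; rewrite /pair h.
have -> : (y == c) && (x == d) = false.
  by apply: contraNF np; rewrite /pair andbC => ->; rewrite orbT.
by rewrite !orbF andbT -andb_orl.
Qed.

Lemma mate_swap : @mate (B m n p) swap_graph (edge_set N (broom_rel m p) a b) (edge_set N swap_rel c d).
Proof.
case/and5P: (ok) => p2 aN bN cN /and5P[dN Eab nE nE' /andP[cd deg]].
pose A : B m n p := Ordinal aN; pose A' : B m n p := Ordinal bN.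
pose C : B m n p := Ordinal cN; pose C' : B m n p := Ordinal dN.
have ab : adj A A' by rewrite adj_nat_graph /= Eab andbT; have := ed_lt Eab; lia.
have cd' : @adj swap_graph C C' by rewrite adj_nat_graph /= cd /swap_rel !eqxx orbT.
rewrite -[edge_set _ _ a b](edge_setE (A : nat_graph _ _) A') -[edge_set _ _ c d](edge_setE (C : swap_graph) C').
have hh (x y : del_edge [set A; A']) : @adj (@del_edge swap_graph [set C; C']) x y = adj x y.
  have h := sw_delE nE nE' x y; rewrite /swap_del in h.
  by rewrite !nat_graph_del /= -!/(pair _ _ _ _) h.
have bid : bijective (id : del_edge [set A; A'] -> @del_edge swap_graph [set C; C']) by exists id.
split; [by apply/edgesP; exists A, A' | by apply/edgesP; exists C, C' | by exists id |].
have dg' (z : B m n p) : @dg (@del_edge swap_graph [set C; C']) z = @dg (del_edge [set A; A']) z.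
  exact: (dg_iso bid hh).
have dF (z : B m n p) : @dg (del_edge [set A; A']) z + ((z == a :> nat) || (z == b :> nat)) = degB z.
  by have := @dg_del _ _ _ z ab; rewrite (dg_B _ p2) !inE -!val_eqE /degB.
rewrite !edge_degreeE // -/swap_graph (dg' C) (dg' C').
have := dF A; have := dF A'; have := dF C; have := dF C'; rewrite /= !eqxx /= ?orbT.
move: (@dg _ C) (@dg _ C') (@dg _ A) (@dg _ A') => ? ? ? ?; clear dF dg' bid hh; nlia.
Qed.


Definition edgeN (u v u' v' : nat) : bool :=
  [&& u < N, v < N, u' < N, v' < N, u' != v', broom_rel m p u v & swap_rel u' v' || swap_rel v' u'].

(** By [iso_of_hom] an injective homomorphism suffices, so only edges are tested: path, left leaves,
    right leaves. *)
Definition hom_ok (u v u' v' : nat) (phi : nat -> nat) : Prop :=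
  [/\ forall x, x < N -> phi x < N,
      forall x y, x < N -> y < N -> phi x = phi y -> x = y,
      forall i, i.+1 < p -> ~~ pair i i.+1 u v -> swap_del u' v' (phi i) (phi i.+1),
      forall l, p <= l < p + m -> ~~ pair 0 l u v -> swap_del u' v' (phi 0) (phi l) &
      forall r, p + m <= r < N -> ~~ pair p.-1 r u v -> swap_del u' v' (phi p.-1) (phi r)].

Lemma mate_of_hom u v u' v' phi : edgeN u v u' v' -> hom_ok u v u' v' phi ->
  @mate (B m n p) swap_graph (edge_set N (broom_rel m p) u v) (edge_set N swap_rel u' v').
Proof.
case/and5P=> uN vN uN' vN' /and3P[uv' E E'] [lt inj h1 h2 h3].
pose A : B m n p := Ordinal uN; pose A' : B m n p := Ordinal vN.
pose C : swap_graph := Ordinal uN'; pose C' : swap_graph := Ordinal vN'.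
have ab : adj A A' by rewrite adj_nat_graph /= E andbT; have := ed_lt E; lia.
have cd' : @adj swap_graph C C' by rewrite adj_nat_graph /= uv' E'.
rewrite -[edge_set _ _ u v](edge_setE (A : nat_graph _ _) A') -[edge_set _ _ u' v'](edge_setE C C').
apply: (mate_of_iso mate_swap); [by apply/edgesP; exists A, A' | by apply/edgesP; exists C, C' |].
have hom (x y : B m n p) : broom_rel m p x y -> ~~ pair x y u v -> swap_del u' v' (phi x) (phi y).
  have yN := ltn_ord y; rewrite {1}/broom_rel => /or3P[]/andP[/eqP e1 e2].
  - by rewrite -e1 in e2 *; apply: h1.
  - by rewrite e1; apply: h2.
  - by have -> : x = p.-1 :> nat; [lia | apply: h3; rewrite e2].
apply: (@iso_of_hom (del_edge [set A; A']) (@del_edge swap_graph [set C; C'])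
  (fun x : B m n p => Ordinal (lt x (ltn_ord x)) : swap_graph)).
- by move=> x y [] /inj E2; apply: val_inj; apply: E2.
- by [].
- move=> x y; rewrite !nat_graph_del /= -!/(pair _ _ _ _) => /and3P[xy xyE np].
  apply/andP; split; first by apply: contraNneq xy => /inj ->.
  case/orP: xyE => h; first exact: hom.
  have := hom _ _ h; rewrite pairC => /(_ np); by rewrite /swap_del orbC pairC.
by apply: eq_leq; exact: (sum_del_eq ab cd' (mate_sum mate_swap)).
Qed.
End Swap.

Definition quad := (nat * nat * nat * nat)%type.

Definition apart (s t : quad) : bool :=
  let: (a, b, c, d) := s in let: (a', b', c', d') := t in ~~ pair a b a' b' && ~~ pair c d c' d'.

Lemma edge_set_inj N R x y x' y' : x < N -> y < N -> x' < N -> y' < N ->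
  edge_set N R x y = edge_set N R x' y' -> pair x y x' y'.
Proof.
move=> xN yN xN' yN'.
rewrite -[edge_set _ _ x y](@edge_setE N R (Ordinal xN) (Ordinal yN)) -[edge_set _ _ x' y'](@edge_setE N R (Ordinal xN') (Ordinal yN')).
by case/set2_inj => -[[->] [->]]; rewrite /pair !eqxx ?orbT.
Qed.

Lemma common_quads N R R' (s : seq quad) :
  {in s, forall t, let: (a, b, c, d) := t in [/\ a < N, b < N, c < N & d < N] /\
     @mate (nat_graph N R) (nat_graph N R') (edge_set N R a b) (edge_set N R' c d)} ->
  pairwise apart s -> common (size s) (nat_graph N R) (nat_graph N R').
Proof.
move=> h /(pairwiseP (0, 0, 0, 0)) ap.
pose t (i : 'I_(size s)) := nth (0, 0, 0, 0) s i.
have ts i : t i \in s by apply: mem_nth.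
exists (fun i => edge_set N R (t i).1.1.1 (t i).1.1.2), (fun i => edge_set N R' (t i).1.2 (t i).2).
have tri (g : 'I_(size s) -> 'I_(size s) -> Prop) : (forall i j, g i j -> g j i) ->
    (forall i j, apart (t i) (t j) -> ~ g i j) -> forall i j, g i j -> i = j.
  move=> gC far i j gij; apply/eqP; apply: contraT; rewrite -val_eqE /= neq_ltn.
  case/orP => lt; [case: (far i j) => // | case: (far j i); last exact: gC];
    by apply: ap; rewrite ?inE.
split.
- apply: (tri (fun i j => edge_set N R (t i).1.1.1 (t i).1.1.2 = edge_set N R (t j).1.1.1 (t j).1.1.2)) => //.
  move=> i j; move: (h _ (ts i)) (h _ (ts j)).
  case: (t i) (t j) => [[[a b] c] d] [[[a' b'] c'] d'] /= [[? ? _ _] _] [[? ? _ _] _] /andP[np _] E.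
  by move: np; rewrite (edge_set_inj _ _ _ _ E).
- apply: (tri (fun i j => edge_set N R' (t i).1.2 (t i).2 = edge_set N R' (t j).1.2 (t j).2)) => //.
  move=> i j; move: (h _ (ts i)) (h _ (ts j)).
  case: (t i) (t j) => [[[a b] c] d] [[[a' b'] c'] d'] /= [[_ _ ? ?] _] [[_ _ ? ?] _] /andP[_ np] E.
  by move: np; rewrite (edge_set_inj _ _ _ _ E).
by move=> i; have := h _ (ts i); case: (t i) => [[[a b] c] d] [].
Qed.

Definition adversary (m n p k : nat) : Prop :=
  exists H, common k (B m n p) H /\ ~ graph_iso H (B m n p).

Lemma adversary_mirror m n p k : 0 < p -> adversary n m p k -> adversary m n p k.
Proof.
move=> p0 [H [cH nH]]; exists H; split; first exact: common_iso (B_mirror n m p0) cH.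
by move=> iso; apply: nH; exact: iso_trans iso (B_mirror m n p0).
Qed.

Lemma adversary_sw m n p a b c d (s : seq quad) : swap_ok m n p a b c d ->
  {in s, forall t, let: (u, v, u', v') := t in edgeN m n p a b c d u v u' v' /\
     exists phi, hom_ok m n p a b c d u v u' v' phi} ->
  pairwise apart ((a, b, c, d) :: s) -> ~ graph_iso (swap_graph m n p a b c d) (B m n p) ->
  adversary m n p (size s).+1.
Proof.
move=> ok hs ap ni; exists (swap_graph m n p a b c d); split=> //.
apply: (@common_quads _ _ _ ((a, b, c, d) :: s)) ap => t; rewrite inE => /orP[/eqP ->|/hs].
  split; last exact: (@mate_swap m n p a b c d ok).
  by move: ok => /and5P[_ aN bN cN /andP[dN _]].
case: t => [[[u v] u'] v'] [E [phi h]]; split; last exact: (@mate_of_hom m n p a b c d ok u v u' v' phi E h).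
by move: E => /and5P[? ? ? ? _].
Qed.

Lemma B_far m n p (z : B m n p) : 0 < m -> 0 < n -> 1 < p -> exists a b, [/\ adj z a, adj a b & b <> z].
Proof.
move=> m0 n0 p2; have zN := ltn_ord z; have p0 : 0 < p by lia.
suff [a [b [aN bN [za ab bz]]]] : exists a b, [/\ a < p + m + n, b < p + m + n &
    [/\ broom_nbr m p z a, broom_nbr m p a b & b != z]].
  exists (Ordinal aN), (Ordinal bN); rewrite !adj_B //=; split=> // E.
  by rewrite -E /= eqxx in bz.
have [h|[h|[h|[h|[h|h]]]]] : z.+2 < p \/ z.+2 = p \/ (z.+1 = p /\ 2 < p) \/ (z.+1 = p /\ p = 2) \/
   p <= z < p + m \/ p + m <= z by lia.
- exists z.+1, z.+2; rewrite /broom_nbr; split; try lia; split; do ?case: ifP; lia.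
- exists z.+1, (p + m); rewrite /broom_nbr; split; try lia; split; do ?case: ifP; lia.
- exists z.-1, z.-2; rewrite /broom_nbr; split; try lia; split; do ?case: ifP; lia.
- exists 0, p; rewrite /broom_nbr; split; try lia; split; do ?case: ifP; lia.
- exists 0, 1; rewrite /broom_nbr; split; try lia; split; do ?case: ifP; lia.
- exists p.-1, p.-2; rewrite /broom_nbr; split; try lia; split; do ?case: ifP; lia.
Qed.

(** The hypothesis on [z] means an isolated vertex or the centre of a star component, impossible in
    a broom. *)
Lemma near_niso m n p (H : sgraph) (z : H) : 0 < m -> 0 < n -> 1 < p ->
  (forall a b, adj z a -> adj a b -> b = z) -> ~ graph_iso H (B m n p).
Proof.
move=> m0 n0 p2 hz [f [g fK gK] hf]; have [a [b [za ab]]] := B_far (f z) m0 n0 p2.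
apply; rewrite -(gK b); congr f; apply: (hz (g a)); by rewrite -hf ?gK.
Qed.

Lemma B_arms m n p (z a b c a' b' : B m n p) : 1 < p -> adj z a -> adj z b -> adj z c ->
  a != b -> a != c -> b != c -> adj a a' -> a' != z -> adj b b' -> b' != z -> False.
Proof.
move=> p2; have p0 : 0 < p by lia.
rewrite !adj_B // -!val_eqE /=; move: (nat_of_ord z) (nat_of_ord a) (nat_of_ord b) (nat_of_ord c)
  (nat_of_ord a') (nat_of_ord b') => {}z {}a {}b {}c {}a' {}b'.
have leaf x y : broom_nbr m p z x -> broom_nbr m p x y -> y != z -> x < p.
  by rewrite /broom_nbr; do ?case: ifP; lia.
move=> za zb zc ab ac bc aa' a'z bb' b'z.
have ap := leaf _ _ za aa' a'z; have bp := leaf _ _ zb bb' b'z.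
move: za zb zc {leaf aa' bb'}; rewrite /broom_nbr ap bp; do ?case: ifP; lia.
Qed.

(** In a broom no vertex of degree at least 3 has two non-leaf neighbours. *)
Lemma arms_niso m n p (H : sgraph) (z a b c a' b' : H) : 1 < p -> adj z a -> adj z b -> adj z c ->
  a != b -> a != c -> b != c -> adj a a' -> a' != z -> adj b b' -> b' != z ->
  ~ graph_iso H (B m n p).
Proof.
move=> p2 za zb zc ab ac bc aa' a'z bb' b'z [f [g fK gK] hf]; have fi := can_inj fK.
apply: (@B_arms m n p (f z) (f a) (f b) (f c) (f a') (f b')); rewrite ?hf ?(inj_eq fi) //.
Qed.

Section SwapNiso.
Variables (m n p a b c d : nat).
Let N := p + m + n.
Definition swap_adj (x y : nat) : bool :=
  (x != y) && (swap_rel m p a b c d x y || swap_rel m p a b c d y x).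

Lemma sw_near z : 0 < m -> 0 < n -> 1 < p -> z < N ->
  (forall x y, x < N -> y < N -> swap_adj z x -> swap_adj x y -> y = z) ->
  ~ graph_iso (swap_graph m n p a b c d) (B m n p).
Proof.
move=> m0 n0 p2 zN h; apply: (@near_niso m n p (swap_graph m n p a b c d) (Ordinal zN)) => // x y zx xy.
by apply: val_inj; apply: (h x y); rewrite ?ltn_ord.
Qed.

Lemma sw_arms z x1 x2 x3 y1 y2 : 1 < p -> all (fun x => x < N) [:: z; x1; x2; x3; y1; y2] ->
  [&& swap_adj z x1, swap_adj z x2, swap_adj z x3, swap_adj x1 y1 & swap_adj x2 y2] ->
  [&& x1 != x2, x1 != x3, x2 != x3, y1 != z & y2 != z] ->
  ~ graph_iso (swap_graph m n p a b c d) (B m n p).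
Proof.
move=> p2 /and5P[zN h1 h2 h3 /and3P[h4 h5 _]] /and5P[a1 a2 a3 a4 a5] /and5P[e1 e2 e3 e4 e5].
by apply: (@arms_niso m n p (swap_graph m n p a b c d) (Ordinal zN) (Ordinal h1) (Ordinal h2) (Ordinal h3)
  (Ordinal h4) (Ordinal h5)).
Qed.
End SwapNiso.

Section SwapDel.
Variables (m p a b c d u v x y : nat).
Hypothesis nuv : ~~ pair x y u v.

Lemma del_old : broom_rel m p x y -> ~~ pair x y a b -> swap_del m p a b c d u v x y.
Proof. by move=> h nab; rewrite /swap_del /swap_rel h nab nuv. Qed.

Lemma del_path : x.+1 = y /\ y < p -> ~~ pair x y a b -> swap_del m p a b c d u v x y.
Proof. by case=> E lt; apply: del_old; rewrite /broom_rel E eqxx lt. Qed.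

Lemma del_left : x = 0 /\ p <= y < p + m -> ~~ pair x y a b -> swap_del m p a b c d u v x y.
Proof. by case=> E lt; apply: del_old; rewrite /broom_rel E lt eqxx orbT. Qed.

Lemma del_right : x.+1 = p /\ p + m <= y -> ~~ pair x y a b -> swap_del m p a b c d u v x y.
Proof. by case=> E lt; apply: del_old; rewrite /broom_rel E lt eqxx !orbT. Qed.

Lemma del_new : x = c /\ y = d -> swap_del m p a b c d u v x y.
Proof. by case=> E1 E2; rewrite /swap_del /swap_rel nuv E1 E2 !eqxx orbT. Qed.
End SwapDel.

Lemma sw_delC m p a b c d u v x y : swap_del m p a b c d u v y x -> swap_del m p a b c d u v x y.
Proof. by rewrite /swap_del orbC (pairC y x). Qed.

Ltac blia := rewrite /pair; lia.
Ltac del_dir := first [apply: del_path; [blia | lia | blia] | apply: del_left; [blia | lia | blia]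
  | apply: del_right; [blia | lia | blia] | apply: del_new; [blia | lia]].
Ltac del := first [del_dir | apply: sw_delC; del_dir].
Ltac prune := repeat match goal with |- context [if ?b then _ else _] =>
  lazymatch b with context [if _ then _ else _] => fail | _ => case: (boolP b) => ? end; try (exfalso; lia) end.
Ltac homs := split; [move=> x xN; prune; lia | move=> x y xN yN; prune; lia
  | move=> i ip; rewrite /pair => ne; prune; del | move=> i ip; rewrite /pair => ne; prune; del
  | move=> i ip; rewrite /pair => ne; prune; del].
Ltac tests := prune; rewrite /swap_ok /edgeN /swap_rel /pair /broom_rel /degB; do ?case: ifP; lia.

(** The adversary is a cycle with the other right leaves at [p.-1], and the isolated vertex [p]. The
    reflection of the cycle fixing [p.-1] exchanges the two mates. *)
Lemma adversary_pinch n p : 0 < n -> 2 < p -> adversary 2 n p 2.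
Proof.
move=> n0 p2; apply: (@adversary_sw 2 n p 0 p p.+1 p.+2 [:: (0, p.+1, p.-2, p.-2.-1)]).
- tests.
- move=> t; rewrite inE => /eqP -> {t}; split; first by tests.
  exists (fun x => if x.+4 <= p then p - x.+4 else if x.+3 == p then p.+1 else if x.+2 == p then p.+2
    else if x == p then p - 3 else if x == p.+1 then p else if x == p.+2 then p.-2 else x).
  homs.
- by cbn [pairwise all apart]; rewrite /apart /pair; lia.
- apply: (@sw_near _ _ _ _ _ _ _ p); try lia.
  by move=> x y xN yN; rewrite /swap_adj /swap_rel /pair /broom_rel; lia.
Qed.

Ltac aparts := cbn [pairwise all apart]; rewrite /apart /pair; lia.
Ltac nears z := apply: (@sw_near _ _ _ _ _ _ _ z); [lia | lia | lia | lia |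
  by move=> x y xN yN; rewrite /swap_adj /swap_rel /pair /broom_rel; lia].
Ltac arms z x1 x2 x3 y1 y2 := apply: (@sw_arms _ _ _ _ _ _ _ z x1 x2 x3 y1 y2);
  [lia | rewrite /=; lia | apply/and5P; split; rewrite /swap_adj /swap_rel /pair /broom_rel; lia | apply/and5P; split; lia].

Lemma adversary_zero m n p : 0 < p -> adversary m n p 0.
Proof.
move=> p0; exists (nat_graph 0 (fun _ _ => false)); split.
  by exists (fun=> set0), (fun=> set0); split; case.
by move/iso_card; rewrite !card_ord; lia.
Qed.

(** Same adversary; for [p = 2] the reflected edge is the one from [0] to the leaf [p.+1]. *)
Lemma adversary_pinch2 n p : 0 < n -> p = 2 -> adversary 2 n p 2.
Proof.
move=> n0 p2; apply: (@adversary_sw 2 n p 0 p p.+1 p.+2 [:: (0, p.+1, 0, p.+1)]).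
- tests.
- move=> t; rewrite inE => /eqP -> {t}; split; first by tests.
  exists (fun x => if x == 0 then p.+2 else if x == p then p.+1 else if x == p.+2 then 0 else
    if x == p.+1 then p else x).
  homs.
- aparts.
- nears p.
Qed.

Section Twins.
Variables m p : nat.
Hypotheses (m0 : 0 < m) (p2 : 1 < p).

(** The right leaf [(p + m).+1] is joined to [0] as well, while [p + m] becomes isolated: both ends
    now have degree [m + 2] and [m] leaves, and the symmetry exchanging them gives the second
    mate. *)
Lemma twin2 : hom_ok m m.+2 p p.-1 (p + m) 0 (p + m).+1 p.-1 (p + m).+1 p.-1 (p + m).+1
  (fun x => if x < p then p.-1 - x else if x < p + m then x + m.+2 else if x == p + m then x.+1 else
     if x == (p + m).+1 then x.-1 else x - m.+2).
Proof. homs. Qed.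

(** For [p = 3] the middle vertex is a second common neighbour, so all four edges of the 4-cycle are
    mates; using all of them takes four right leaves, whence [1 < m] in [twin4]. *)
Lemma twin3 : p = 3 -> hom_ok m m.+2 p p.-1 (p + m) 0 (p + m).+1 p.-1 (p + m).+2 0 1
  (fun x => if x == 1 then (p + m).+1 else if x == (p + m).+1 then 1 else if x == (p + m).+2 then p + m
     else if x == p + m then (p + m).+2 else x).
Proof. move=> p3; homs. Qed.

Lemma twin4 : p = 3 -> 1 < m -> hom_ok m m.+2 p p.-1 (p + m) 0 (p + m).+1 p.-1 (p + m).+3 p.-1 1
  (fun x => if x < p then (if x == 1 then (p + m).+1 else p.-1 - x) else if x < p + m then x + m.+2 else
     if x == p + m then 1 else if x < (p + m).+3 then x - m.+1 else
     if x == (p + m).+3 then p + m else x - m.+2).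
Proof. move=> p3 m1; homs. Qed.
End Twins.

Lemma twin_ok m p : 0 < m -> 1 < p -> swap_ok m m.+2 p p.-1 (p + m) 0 (p + m).+1.
Proof. move=> m0 p2; tests. Qed.

Lemma twin_niso m p : 0 < m -> 1 < p -> ~ graph_iso (swap_graph m m.+2 p p.-1 (p + m) 0 (p + m).+1) (B m m.+2 p).
Proof. move=> m0 p2; nears (p + m). Qed.

Lemma adversary_twin2 m p : 0 < m -> 1 < p -> adversary m m.+2 p 2.
Proof.
move=> m0 p2.
apply: (@adversary_sw _ _ _ p.-1 (p + m) 0 (p + m).+1 [:: (p.-1, (p + m).+1, p.-1, (p + m).+1)]).
- exact: twin_ok.
- move=> t; rewrite inE => /eqP -> {t}; split; first by tests.
  by eexists; apply: twin2.
- aparts.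
- exact: twin_niso.
Qed.

Lemma adversary_twin3 m : 0 < m -> adversary m m.+2 3 3.
Proof.
move=> m0; apply: (@adversary_sw _ _ 3 2 (3 + m) 0 (3 + m).+1
  [:: (2, (3 + m).+1, 2, (3 + m).+1); (2, (3 + m).+2, 0, 1)]).
- exact: twin_ok.
- move=> t; rewrite !inE => /orP[] /eqP -> {t}; split; try by tests.
    by eexists; apply: (@twin2 m 3).
  by eexists; apply: (@twin3 m 3).
- aparts.
- exact: (@twin_niso m 3).
Qed.

Lemma adversary_twin4 m : 1 < m -> adversary m m.+2 3 4.
Proof.
move=> m1; have m0 : 0 < m by lia.
apply: (@adversary_sw _ _ 3 2 (3 + m) 0 (3 + m).+1
  [:: (2, (3 + m).+1, 2, (3 + m).+1); (2, (3 + m).+2, 0, 1); (2, (3 + m).+3, 2, 1)]).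
- exact: twin_ok.
- move=> t; rewrite !inE => /or3P[] /eqP -> {t}; split; try by tests.
  + by eexists; apply: (@twin2 m 3).
  + by eexists; apply: (@twin3 m 3).
  + by eexists; apply: (@twin4 m 3).
- aparts.
- exact: (@twin_niso m 3).
Qed.

Section Legs.
Variables n p : nat.
Hypotheses (n0 : 0 < n) (p4 : 3 < p).

(** In the adversary the vertex [2] carries the leaf [1] and the pendant path [p], [0], [p.+1]. *)
Lemma leg_ok : swap_ok 2 n p 0 1 2 p.
Proof. tests. Qed.

Lemma leg2 : hom_ok 2 n p 0 1 2 p 0 p 2 1 (fun x => if x == 1 then p else if x == p then 1 else x).
Proof. homs. Qed.

Definition leg_map (x : nat) : nat := if x == 0 then 2 else if x == p then 1 else
  if x == p.+1 then 3 else if x == 1 then p else if x == 2 then 0 else if x == 3 then p.+1 else x.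

Lemma leg3 : 4 < p -> hom_ok 2 n p 0 1 2 p 3 4 3 4 leg_map.
Proof. rewrite /leg_map => p5; homs. Qed.

Lemma leg3' : p = 4 -> n = 1 -> hom_ok 2 n p 0 1 2 p 3 p.+2 3 p.+2 leg_map.
Proof. rewrite /leg_map => pE nE; homs. Qed.

(** For [n = 1] the last path edge of the broom splits off a single edge, as does cutting the
    pendant path at [p], [0]. *)
Lemma leg4 : n = 1 -> hom_ok 2 n p 0 1 2 p p.-2 p.-1 p 0 (fun x =>
  if x == 0 then 2 else if x == p then 1 else if x == p.+1 then p else if x == p.-2 then p.+2 else
  if x == p.-1 then 0 else if x == p.+2 then p.+1 else x.+2).
Proof. move=> n1; homs. Qed.

Lemma leg_niso : ~ graph_iso (swap_graph 2 n p 0 1 2 p) (B 2 n p).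
Proof.
case: (ltnP 4 p) => p5; first arms 2 p 3 1 0 4.
arms 2 p 3 1 0 p.+2.
Qed.
End Legs.

Lemma adversary_legs n p : 0 < n -> 4 < p -> adversary 2 n p 3.
Proof.
move=> n0 p5; have p4 : 3 < p by lia.
apply: (@adversary_sw 2 n p 0 1 2 p [:: (0, p, 2, 1); (3, 4, 3, 4)]).
- exact: leg_ok.
- move=> t; rewrite !inE => /orP[] /eqP -> {t}; split; try by tests.
    by eexists; apply: leg2.
  by eexists; apply: leg3.
- aparts.
- exact: leg_niso.
Qed.

(** For [p = 5] the edges [(3, 4)] and [(p.-2, p.-1)] coincide, and one pair is lost. *)
Lemma adversary_legs4 p : 3 < p -> p <> 5 -> adversary 2 1 p 4.
Proof.
move=> p4 p5; have n0 : 0 < 1 by [].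
have [pE|pE] : p = 4 \/ 4 < p by lia.
  apply: (@adversary_sw 2 1 p 0 1 2 p [:: (0, p, 2, 1); (3, p.+2, 3, p.+2); (p.-2, p.-1, p, 0)]).
  - exact: leg_ok.
  - move=> t; rewrite !inE => /or3P[] /eqP -> {t}; split; try by tests.
    + by eexists; apply: leg2.
    + by eexists; apply: leg3'.
    + by eexists; apply: leg4.
  - aparts.
  - exact: leg_niso.
apply: (@adversary_sw 2 1 p 0 1 2 p [:: (0, p, 2, 1); (3, 4, 3, 4); (p.-2, p.-1, p, 0)]).
- exact: leg_ok.
- move=> t; rewrite !inE => /or3P[] /eqP -> {t}; split; try by tests.
  + by eexists; apply: leg2.
  + by eexists; apply: leg3.
  + by eexists; apply: leg4.
- aparts.
- exact: leg_niso.
Qed.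

(** A cycle and a disjoint edge: cutting the cycle anywhere gives the card of either path edge next
    to an end of the broom's path. *)
Lemma adversary_cycle p : 2 < p -> adversary 1 1 p 2.
Proof.
move=> p3; apply: (@adversary_sw 1 1 p 0 1 1 p.+1 [:: (p.-2, p.-1, p.-1, p.+1)]).
- tests.
- move=> t; rewrite inE => /eqP -> {t}; split; first by tests.
  exists (fun x => if x == p then p.+1 else if x == p.+1 then p else if x == p.-1 then 0 else x.+1).
  homs.
- aparts.
- nears 0.
Qed.

(** The left leaf is moved to the end of a right leaf, giving [p.-1] a second arm, of length 2. *)
Lemma spider_ok n p : 2 < n -> 2 < p -> swap_ok 1 n p 0 p p.+1 p.
Proof. move=> n3 p3; tests. Qed.

Lemma spider_niso n p : 2 < n -> 2 < p -> ~ graph_iso (swap_graph 1 n p 0 p p.+1 p) (B 1 n p).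
Proof. move=> n3 p3; arms p.-1 p.+1 p.-2 p.+2 p p.-2.-1. Qed.

Lemma adversary_spider1 n p : 2 < n -> 2 < p -> adversary 1 n p 1.
Proof.
move=> n3 p3; apply: (@adversary_sw 1 n p 0 p p.+1 p [::]) => //; [exact: spider_ok | exact: spider_niso].
Qed.

Lemma adversary_spider2 n p : 2 < n -> 3 < p -> adversary 1 n p 2.
Proof.
move=> n3 p4; have p3 : 2 < p by lia.
apply: (@adversary_sw 1 n p 0 p p.+1 p [:: (p - 4, p - 3, p.-2, p - 3)]).
- exact: spider_ok.
- move=> t; rewrite inE => /eqP -> {t}; split; first by tests.
  exists (fun x => if x == p.-2 then p.+1 else if x == p - 3 then p else if x == p.+1 then p.-2 else
    if x == p then 0 else if x < p - 3 then x.+1 else x).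
  homs.
- aparts.
- exact: spider_niso.
Qed.

(** The 4-cycle [0], [1], [2], [p.+1] has a symmetry exchanging [1] and [p.+1], hence two mates. *)
Lemma adversary_square n p : 0 < n -> 3 < p -> adversary 3 n p 2.
Proof.
move=> n0 p4; apply: (@adversary_sw 3 n p 0 p p.+1 2 [:: (0, p.+1, 1, 2)]).
- tests.
- move=> t; rewrite inE => /eqP -> {t}; split; first by tests.
  exists (fun x => if x == p then 1 else if x == 1 then p.+1 else if x == p.+1 then p else x).
  homs.
- aparts.
- nears p.
Qed.

Lemma adversary_triangle n p : 0 < n -> p = 3 -> adversary 3 n p 1.
Proof.
move=> n0 p3; apply: (@adversary_sw 3 n p 0 p p.+1 1 [::]) => //; [tests | nears p].
Qed.

(** A star at [0] and a cycle through [p.-1] with its other leaves. Reflecting the cycle gives the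
    second mate; [p > 4] keeps the path edges [(1, 2)] and [(p - 3, p.-2)] distinct. *)
Lemma adversary_star m p : 0 < m -> 4 < p -> adversary m m p 2.
Proof.
move=> m0 p5; apply: (@adversary_sw m m p 1 2 2 (p + m) [:: (p - 3, p.-2, p.-2, p - 3)]).
- tests.
- move=> t; rewrite inE => /eqP -> {t}; split; first by tests.
  exists (fun x => if x == p.-1 then 0 else if p + m <= x then x - m else if x == p.-2 then 1 else
    if x == 0 then p.-1 else if x == p then p.-2 else if p < x then x + m else
    if x == 1 then p + m else x).
  homs.
- aparts.
- nears 0.
Qed.

(** The left star is hung from a right leaf instead of the path, whose remaining vertices dangle
    from [p.-1]. *)
Lemma shift_ok m n p : 0 < m -> 1 < n -> 3 < p -> swap_ok m n p 0 1 0 (p + m).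
Proof. move=> m0 n2 p4; tests. Qed.

Lemma shift_niso m n p : 0 < m -> 1 < n -> 3 < p -> ~ graph_iso (swap_graph m n p 0 1 0 (p + m)) (B m n p).
Proof. move=> m0 n2 p4; arms p.-1 p.-2 (p + m) (p + m).+1 (p - 3) 0. Qed.

Lemma adversary_shift1 m n p : 0 < m -> 1 < n -> 3 < p -> adversary m n p 1.
Proof.
move=> m0 n2 p4.
apply: (@adversary_sw m n p 0 1 0 (p + m) [::]) => //; [exact: shift_ok | exact: shift_niso].
Qed.

(** Cutting at [p.-1] splits off a star with [m + 1] leaves, just as the last path edge of the broom
    does when [n = m + 1]. *)
Lemma adversary_shift2 m p : 0 < m -> 3 < p -> adversary m m.+1 p 2.
Proof.
move=> m0 p4; have n2 : 1 < m.+1 by lia.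
apply: (@adversary_sw m m.+1 p 0 1 0 (p + m) [:: (p.-2, p.-1, p + m, p.-1)]).
- exact: shift_ok.
- move=> t; rewrite inE => /eqP -> {t}; split; first by tests.
  exists (fun x => if x == p.-1 then 0 else if x == p + m then x else if p + m < x then x - m.+1 else
    if x == 0 then p.-1 else if p <= x then x + m.+1 else p.-1 - x).
  homs.
- aparts.
- exact: shift_niso.
Qed.

Lemma adern_adversary m n p k : 0 < m -> m <= n -> 1 < p -> adversary m n p k -> ~ mates_bound m n p k.+1 ->
  adern (double_broom m n p) = k.+1.
Proof.
move=> m0 mn p2 [H [cH nH]] nub; have p0 : 0 < p by lia.
apply: (adern_eq (double_broom_B m n p0) cH nH) => H' c.
by apply: boolp.contrapT => ni; apply: nub; exact: common_bound c ni.
Qed.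

Lemma adversary_pinched n p : 0 < n -> 1 < p -> adversary 2 n p 2.
Proof.
move=> n0 p2; have [pE|pE] : p = 2 \/ 2 < p by lia.
  exact: adversary_pinch2.
exact: adversary_pinch.
Qed.

Ltac pick_disjunct := repeat (first [solve [left; lia] | right]); solve [lia].

Section Families.
Variables m n p : nat.
Hypotheses (m0 : 0 < m) (mn : m <= n) (p2 : 1 < p).

Lemma family1E : family1 m n p <->
  (p = 2 /\ m <> 2 /\ n <> 2 /\ n <> m + 2) \/ (p = 3 /\ 4 <= m /\ n <> m + 2).
Proof. by split=> [[[? ? ? ?]|[? ? ?]]|[[? [? []]]|[? []]]]; [left|right|left|right]. Qed.

Lemma family5E : family5 m n p <->
  (m = 1 /\ n = 2 /\ p = 4) \/ (m = 1 /\ n = 2 /\ 6 <= p) \/ (n = m + 2 /\ p = 3 /\ 2 <= m).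
Proof.
split=> [[[? ? ?]|[? ? ?]|[? ? ?]]|[[? []]|[[? []]|[? []]]]] *;
  by [left | right; left | right; right | constructor 1 | constructor 2 | constructor 3].
Qed.

Lemma family4E : family4 m n p <->
  (m = 1 /\ n = 2 /\ p = 5) \/ (m = 1 /\ n = 3 /\ p = 3) \/ (m = 2 /\ 5 <= p).
Proof.
split=> [[[? ? ?]|[? ? ?]|[? ?]]|[[? []]|[[? []]|[? ?]]]] *;
  by [left | right; left | right; right | constructor 1 | constructor 2 | constructor 3].
Qed.

Lemma adversary_family5 : family5 m n p -> adversary m n p 4.
Proof.
have p0 : 0 < p by lia.
case/family5E => [[mE [nE pE]]|[[mE [nE pE]]|[nE [pE m2]]]]; subst.
- by apply: adversary_mirror => //; apply: adversary_legs4.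
- by apply: adversary_mirror => //; apply: adversary_legs4; lia.
- by rewrite addn2; apply: adversary_twin4.
Qed.

Lemma adversary_family4 : family4 m n p -> adversary m n p 3.
Proof.
have p0 : 0 < p by lia.
case/family4E => [[mE [nE pE]]|[[mE [nE pE]]|[mE pE]]]; subst.
- by apply: adversary_mirror => //; apply: adversary_legs.
- exact: adversary_twin3.
- by apply: adversary_legs => //; lia.
Qed.

Lemma adversary_family3 : family3 m n p -> adversary m n p 2.
Proof.
have p0 : 0 < p by lia. have n0 : 0 < n by lia.
case=> [[? [? p3]]|[[? [? p3]]|[[? [n4 p4]]|[[? _]|[[? p4]|[[? [m4 p5]]|[[nE [m4 p4]]|[[nE [m2 [m3 p3]]]|[? [? ?]]]]]]]]]]; subst.
- exact: adversary_cycle.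
- by apply: adversary_mirror => //; apply: adversary_pinched.
- by apply: adversary_spider2 => //; lia.
- exact: adversary_pinched.
- exact: adversary_square.
- by apply: adversary_star.
- by rewrite addn1; apply: adversary_shift2.
- by rewrite addn2; apply: adversary_twin2.
- exact: (@adversary_twin2 3 2).
Qed.

(** Comparing [m] with 1, 2, 3, [n] with [m], [m + 1], [m + 2], and [p] with 2 to 5 cuts the
    parameters into cells on which every family condition is decided. *)
Lemma family_rest : ~ family1 m n p -> ~ family5 m n p -> ~ family4 m n p -> ~ family3 m n p ->
  (m = 1 /\ 4 <= n /\ p = 3) \/ (m = 3 /\ n <> 5 /\ p = 3) \/
  (4 <= m /\ 4 <= p /\ n <> m.+1 /\ n <> m.+2 /\ (n <> m \/ p = 4)).
Proof.
have mc : m = 1 \/ m = 2 \/ m = 3 \/ 3 < m by lia.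
have nc : n = m \/ n = m.+1 \/ n = m.+2 \/ m.+2 < n by lia.
have pc : p = 2 \/ p = 3 \/ p = 4 \/ p = 5 \/ 5 < p by lia.
rewrite family1E family5E family4E /family3 => h1 h5 h4 h3.
case: mc => [|[|[|]]] mc; case: nc => [|[|[|]]] nc; case: pc => [|[|[|[|]]]] pc;
  first [clear h1 h3 h4 h5; pick_disjunct | exfalso; apply: h3; clear -mc nc pc; pick_disjunct
    | exfalso; apply: h1; clear -mc nc pc; pick_disjunct | exfalso; apply: h5; clear -mc nc pc; pick_disjunct
    | exfalso; apply: h4; clear -mc nc pc; pick_disjunct].
Qed.

Lemma adversary_rest : (m = 1 /\ 4 <= n /\ p = 3) \/ (m = 3 /\ n <> 5 /\ p = 3) \/
  (4 <= m /\ 4 <= p /\ n <> m.+1 /\ n <> m.+2 /\ (n <> m \/ p = 4)) -> adversary m n p 1.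
Proof.
have n0 : 0 < n by lia.
case=> [[? [n4 ?]]|[[? [n5 ?]]|[m4 [p4 _]]]]; subst.
- by apply: adversary_spider1 => //; lia.
- exact: adversary_triangle.
- by apply: adversary_shift1; lia.
Qed.
End Families.

Theorem theorem2 (m n p : nat) (hm : 1 <= m) (hmn : m <= n) (hp : 2 <= p) :
  (family1 m n p -> adern (double_broom m n p) = 1) /\
  (family5 m n p -> adern (double_broom m n p) = 5) /\
  (family4 m n p -> adern (double_broom m n p) = 4) /\
  (family3 m n p -> adern (double_broom m n p) = 3) /\
  (~ family1 m n p -> ~ family5 m n p -> ~ family4 m n p -> ~ family3 m n p ->
     adern (double_broom m n p) = 2).
Proof.
split; [|split; [|split; [|split]]].
- move=> F; apply: adern_adversary => //; first by apply: adversary_zero; lia.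
  move=> [_ [_ [_ [_ u]]]]; move/family1E: F; rewrite addn2 => F; by have := u F.
- move=> F; apply: adern_adversary => //; first exact: adversary_family5.
  by case.
- move=> F; apply: adern_adversary => //; first exact: adversary_family4.
  by case=> _ [u _]; move/family4E: F => F; have := u F.
- move=> F; apply: adern_adversary => //; first exact: adversary_family3.
  by case=> _ [_ [u _]]; have := u F.
move=> F1 F5 F4 F3; have R := family_rest hm hmn hp F1 F5 F4 F3.
apply: adern_adversary => //; first exact: adversary_rest.
by case=> _ [_ [_ [u _]]]; have := u R.
Qed.
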